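(* Let $S$ be a double occurrence word, with interlacement graph $\Lambda_S$ and interlacement matrix $M_S$. Then the following are equivalent: (a) $S$ is realizable by a generic smooth immersion $f\colon S^1\to S^2$. (b) There exists a subset $A$ of the vertex set of $\Lambda_S$ such that the looped graph obtained from $\Lambda_S$ by placing a loop at each vertex of $A$ is an orthoprojection graph. (c) There exists a diagonal matrix $D_S$ over $GF(2)$ such that $M_S + D_S$ is idempotent over $GF(2)$.
   Context: A double occurrence word is a finite string of symbols in which each symbol appears precisely twice. Two distinct symbols are interlaced if each appears precisely once between the two occurrences of the other. The interlacement graph $\Lambda_S$ of $S$ is the simple graph with a vertex for each symbol of $S$, two vertices being adjacent iff their symbols are interlaced; the interlacement matrix $M_S$ is the adjacency matrix of $\Lambda_S$ regarded as a matrix over $GF(2)$. A generic smooth immersion $f\colon S^1\to S^2$ has finitely many transverse double points; labelling each with a unique symbol, orienting $S^1$ and traversing the image once from a non-double point, recording double point symbols as encountered, yields a double occurrence word, said to be realized by $f$; $S$ is realizable if it is realized (up to naming of symbols) by some such immersion. A finite looped graph (no multiple loops or multiple edges) is an orthoprojection graph if for every pair of (not necessarily distinct) vertices $u,v$, $u$ and $v$ have an odd number of common neighbors iff $u$ and $v$ are neighbors, where a vertex is a neighbor of itself iff it is looped. *)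

(* Defs.v *)
From mathcomp Require Import all_boot all_order all_algebra.
From mathcomp Require Import all_classical all_reals all_analysis.
Set Implicit Arguments.
Unset Strict Implicit.
Unset Printing Implicit Defensive.
Import Order.TTheory GRing.Theory Num.Theory.
Import numFieldNormedType.Exports.
Local Open Scope classical_set_scope.
Local Open Scope ring_scope.

Section Words.
Variable T : choiceType.
Implicit Types (S : seq T) (x y : T).

Definition double_occurrence_word S : Prop :=
  forall x, x \in S -> count_mem x S = 2.

(* The part of S strictly between the first two occurrences of x. *)
Definition between S x : seq T :=
  let S' := drop (index x S).+1 S in take (index x S') S'.

Definition interlaced S x y : bool :=
  [&& x != y, count_mem y (between S x) == 1%N
            & count_mem x (between S y) == 1%N].

(* The vertex set is the finite type seq_sub S of symbols occurring in S. *)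
Definition interlacement_graph S : rel (seq_sub S) :=
  fun u v => interlaced S (val u) (val v).

End Words.

Section LoopedGraphs.
Variable V : finType.
Implicit Types (e : rel V) (A : {set V}).

Definition add_loops e A : rel V :=
  fun u v => e u v || ((u == v) && (u \in A)).

(* A looped graph is a symmetric relation; u is looped when e u u. *)
Definition orthoprojection_graph e : Prop :=
  symmetric e /\
  forall u v, odd #|[set w | e u w && e v w]%SET| <-> e u v.

Definition adjacency_mx (F : nzRingType) e : 'M[F]_#|V| :=
  \matrix_(i, j) (e (enum_val i) (enum_val j))%:R.

End LoopedGraphs.

Definition interlacement_mx (T : choiceType) (S : seq T) :
    'M['F_2]_#|{: seq_sub S}| :=
  adjacency_mx 'F_2 (@interlacement_graph T S).

(* The circle is R/Z: a map S^1 -> S^2 is a 1-periodic map from R to the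
   Euclidean unit sphere of R^3, and it is smooth (an immersion) exactly when
   the periodic map is. *)
Section Curves.
Variable R : realType.
Implicit Types (f : R -> 'rV[R]_3) (p : 'rV[R]_3) (s t : R).

(* Not stated with the norm of 'rV[R]_3, which is the sup norm. *)
Definition sphere2 : set 'rV[R]_3 := [set p | \sum_i p 0 i ^+ 2 = 1].

(* The row space of this matrix is the tangent space at p of the sphere, the
   orthogonal complement of p. *)
Definition tangent_sphere2 p : 'M[R]_3 := kermx p^T.

Definition same_circle_point s t : Prop := s - t \is a Num.int.

Definition smooth f : Prop := forall n t, derivable (derive1n n f) t 1.

Definition smooth_immersion f : Prop :=
  [/\ forall t, f (t + 1) = f t,
      forall t, sphere2 (f t),
      smooth f
    & forall t, derive1 f t != 0].

Definition double_points f : set 'rV[R]_3 :=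
  [set p | exists s t, [/\ ~ same_circle_point s t, f s = p & f t = p]].

Definition generic_immersion f : Prop :=
  [/\ smooth_immersion f,
      finite_set (double_points f),
      (* no triple points *)
      forall r s t, f r = f s -> f s = f t ->
        [\/ same_circle_point r s, same_circle_point s t
          | same_circle_point r t]
    & (* transversality in the tangent plane of the sphere *)
      forall s t, ~ same_circle_point s t -> f s = f t ->
        (derive1 f s + derive1 f t == tangent_sphere2 (f s))%MS].

(* The image is traversed once from the base point f t0, forwards or backwards
   according to the orientation o; ts lists in increasing order the times at
   which double points are met. The labelling of the double points is given by
   its inverse pt, sending a symbol of S to the double point it labels. *)
Definition realizes (T : choiceType) f (S : seq T) : Prop :=
  exists (t0 : R) (o : bool) (ts : seq R) (pt : T -> 'rV[R]_3),
    let g t := f (t0 + (-1) ^+ o * t) in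
    [/\ ~ double_points f (g 0),
        sorted <%R ts,
        forall t, t \in ts <-> (0 < t < 1 /\ double_points f (g t)),
        {in S &, injective pt}
      & [seq pt x | x <- S] = [seq g t | t <- ts]].

Definition realizable (T : choiceType) (S : seq T) : Prop :=
  exists f, generic_immersion f /\ realizes f S.

End Curves.
Arguments realizable R {T} S.

(* Main.v *)
Require Import Defs.
From mathcomp Require Import all_boot all_order all_algebra.
From mathcomp Require Import all_classical all_reals all_analysis.
From mathcomp Require Import zify ring lra.
Set Implicit Arguments.
Unset Strict Implicit.
Unset Printing Implicit Defensive.
Import Order.TTheory GRing.Theory Num.Theory.

(** Let [M] be the interlacement matrix and [d] a diagonal over GF(2). Read entry by entry,
    idempotence of [M] plus the diagonal [d] says that every symbol is interlaced with an even
    number of others, and that two distinct symbols have an odd number of common neighbours exactly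
    when they are interlaced and [d] agrees on them. This is [gauss_invariant] with no letter
    processed; (b) and (c) are two spellings of it ([gauss_projection], [adjacency_idempotent]). The
    content is its equivalence with realizability.

    Sufficiency. Reversing the segment between the two occurrences of a letter [u] is the effect on
    the word of smoothing the crossing [u], and complements the interlacement graph locally at [u]
    ([interlace_rev]). The parity conditions survive when they are restricted to the letters not yet
    processed and [d] is toggled on the unprocessed neighbours of [u]
    ([gauss_invariant_local_complement]). Once all letters are processed, the conditions say that
    [d] properly 2-colours the interlacement graph, so the chords of the last word can be drawn
    without crossings on the two sides of a line. Undoing the smoothings one at a time reconnects
    the curve at each touching point and turns it into a crossing ([unprocess_drawing],
    [gauss_drawing]). The drawing becomes a closed polygon whose chords are tents of slope 1 and -1
    ([tents_realizable]); its corners are rounded without altering the crossings ([smooth_polygon]),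
    and inverse stereographic projection puts it on the sphere ([realizable_of_plane_curve]).

    Necessity. Stereographic projection from a point off the curve ([exists_pole]) gives a closed
    plane curve, and two cycles in the plane have signed crossing number 0
    ([crossing_number_cycles]). This is applied to closed curves cut out of the given one by
    switching strands at one or two double points ([crossing_self], [crossing_disjoint],
    [crossing_nested], [crossing_interlaced]). Modulo 2 these identities give even degrees and the
    condition for letters that are not interlaced. For interlaced letters the integer identities
    have to be combined and halved before reduction; the outcome is that [d] may be taken as the
    sign of the crossing plus the parity of its first position ([gauss_interlaced]). *)

(** * Interlacement as the parity of a count of ordered pairs *)

Section OrderedPairs.
Local Open Scope nat_scope.
Variable T : choiceType.
Implicit Types (S P Q R W : seq T) (x y u w : T).

Fixpoint ordered_pairs x y W : nat :=
  if W is z :: W' then (z == x) * count_mem y W' + ordered_pairs x y W' else 0.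

Lemma ordered_pairs_cat x y P Q :
  ordered_pairs x y (P ++ Q) =
  ordered_pairs x y P + ordered_pairs x y Q + count_mem x P * count_mem y Q.
Proof.
elim: P => [|z P IH] /=; first by rewrite addn0.
by rewrite IH count_cat; case: (z == x); rewrite /= ?mul0n ?mul1n ?add0n //; lia.
Qed.

Lemma ordered_pairs_rev x y Q : ordered_pairs x y (rev Q) = ordered_pairs y x Q.
Proof.
elim: Q => // z Q IH; rewrite rev_cons -cats1 ordered_pairs_cat IH /= count_rev.
by rewrite !addn0 !muln0 !addn0 mulnC addnC.
Qed.

Lemma ordered_pairs_sym x y Q : x != y ->
  ordered_pairs x y Q + ordered_pairs y x Q = count_mem x Q * count_mem y Q.
Proof.
move=> nxy; elim: Q => //= z Q IH.
have : ((z == x) && (z == y)) = false.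
  by apply/negP => /andP[/eqP -> /eqP e]; rewrite e eqxx in nxy.
case: (z == x); case: (z == y) => //= _; nia.
Qed.

(** For letters occurring twice each the count is 1 or 3 when they alternate and 0, 2 or 4
    otherwise. Unlike [between], it behaves well under concatenation and reversal. *)
Definition interlace W x y := (x != y) && odd (ordered_pairs x y W).

Lemma interlacexx W x : interlace W x x = false.
Proof. by rewrite /interlace eqxx. Qed.

Lemma interlace_sym W x y : count_mem x W = 2 ->
  interlace W x y = interlace W y x.
Proof.
move=> cx; rewrite /interlace eq_sym; case: eqVneq => //= nyx.
have /(congr1 odd) := ordered_pairs_sym W nyx.
by rewrite oddD oddM cx andbF; case: (odd _); case: (odd _).
Qed.

Lemma double_split S x : count_mem x S = 2 ->
  exists P Q R, [/\ S = P ++ x :: Q ++ x :: R, x \notin P, x \notin Q &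
    x \notin R].
Proof.
have split1 W : 0 < count_mem x W ->
    exists P R, W = P ++ x :: R /\ x \notin P.
  rewrite -has_count has_pred1 => xW; have ixW := xW; rewrite -index_mem in ixW.
  exists (take (index x W) W), (drop (index x W).+1 W).
  rewrite -[in LHS](cat_take_drop (index x W) W) (drop_nth x) // nth_index //.
  by split=> //; apply: contraL xW => /index_ltn; rewrite ltnn.
move=> cS; have [|P [W [eS nP]]] := split1 S; first by rewrite cS.
move: cS; rewrite eS count_cat /= eqxx (count_memPn nP) => cW.
have [|Q [R [eW nQ]]] := split1 W; first by move: cW => /=; lia.
move: cW; rewrite eW count_cat /= eqxx (count_memPn nQ) /= => cR.
move: cR; rewrite !add0n !add1n => -[/count_memPn nR].
by exists P, Q, R.
Qed.

Lemma ordered_pairs_notin x y W : x \notin W -> ordered_pairs x y W = 0.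
Proof.
by elim: W => //= z W IH; rewrite inE negb_or eq_sym => /andP[/negbTE-> /IH->].
Qed.

Lemma interlace_splitE P Q R x y : x != y ->
  x \notin P -> x \notin Q -> x \notin R ->
  interlace (P ++ x :: Q ++ x :: R) x y = odd (count_mem y Q).
Proof.
move=> nxy nP nQ nR; rewrite /interlace nxy ordered_pairs_cat (count_memPn nP).
rewrite ordered_pairs_notin //= ordered_pairs_cat (ordered_pairs_notin _ nQ) /=.
rewrite (ordered_pairs_notin _ nR) (count_memPn nQ) eqxx count_cat /= (negbTE nxy).
by rewrite !(oddD, mul1n, mul0n) /= !addbF -addbA addbb addbF.
Qed.

Lemma between_split P Q R x : x \notin P -> x \notin Q ->
  between (P ++ x :: Q ++ x :: R) x = Q.
Proof.
move=> nP nQ; rewrite /between index_cat (negbTE nP) /= eqxx addn0.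
rewrite -cat_rcons drop_size_cat ?size_rcons //.
by rewrite index_cat (negbTE nQ) /= eqxx addn0 take_size_cat.
Qed.

Lemma interlacedE S x y : double_occurrence_word S -> x \in S -> y \in S ->
  interlaced S x y = interlace S x y.
Proof.
move=> dS xS yS; rewrite /interlaced; case: (eqVneq x y) => [->|nxy] /=.
  by rewrite interlacexx.
have half z t : z \in S -> t \in S -> z != t ->
    (count_mem t (between S z) == 1) = interlace S z t.
  move=> /dS zS /dS tS nzt; have [P [Q [R [eS nP nQ nR]]]] := double_split zS.
  move: tS; rewrite eS between_split // interlace_splitE //.
  by rewrite count_cat /= count_cat /= (negbTE nzt); case: (count_mem t Q) => [|[|[|]]] //; lia.
rewrite !half // 1?eq_sym // (interlace_sym y (dS x xS)) andbb //.
Qed.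

(** Only pairs inside [Q] change their order, which alters the parity by the product of the counts
    of [x] and [y] in [Q]; each factor is interlacement with [u]. This is local complementation at
    [u]. *)
Lemma interlace_rev P Q R u x y : x != y ->
  u \notin P -> u \notin Q -> u \notin R ->
  count_mem x (P ++ u :: Q ++ u :: R) = 2 ->
  count_mem y (P ++ u :: Q ++ u :: R) = 2 ->
  interlace (P ++ u :: rev Q ++ u :: R) x y =
  interlace (P ++ u :: Q ++ u :: R) x y (+)
  (interlace (P ++ u :: Q ++ u :: R) x u && interlace (P ++ u :: Q ++ u :: R) u y).
Proof.
move=> nxy nP nQ nR cx cy.
have cQ z : u != z -> odd (count_mem z Q) = interlace (P ++ u :: Q ++ u :: R) u z.
  by move=> nz; rewrite interlace_splitE.
have [eux|nux] := eqVneq u x.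
  rewrite -eux in nxy *.
  by rewrite interlacexx addbF !interlace_splitE ?mem_rev ?count_rev.
have [euy|nuy] := eqVneq u y.
  rewrite -euy interlacexx andbF addbF in nxy *.
  have nxu : u != x by rewrite eq_sym.
  rewrite interlace_sym; last by move: cx; rewrite !(count_cat,count_rev) /= !(count_cat,count_rev).
  by rewrite [RHS]interlace_sym // !interlace_splitE ?mem_rev ?count_rev.
rewrite (interlace_sym u cx) -!cQ //.
rewrite /interlace nxy /= -oddM -oddD.
have e A : P ++ u :: A ++ u :: R = rcons P u ++ A ++ (u :: R) by rewrite cat_rcons.
rewrite !e.
(* The pairs [x y] and [y x] inside [Q] add up to the product of the two counts, which is the change
   of parity under the reversal. *)
have := ordered_pairs_sym Q nxy.
rewrite !(ordered_pairs_cat, count_cat) ?count_rev ordered_pairs_rev => <-.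
set A := ordered_pairs x y Q; set B := ordered_pairs y x Q.
set C := ordered_pairs x y (u :: R); set D := _ * count_mem y (u :: R).
set E := _ * (_ + _); set F := ordered_pairs x y (rcons P u).
rewrite (_ : F + (A + C + D) + E + (A + B) = F + (B + C + D) + E + A.*2).
  by rewrite [RHS]oddD odd_double addbF.
by rewrite -addnn; lia.
Qed.

End OrderedPairs.

(** * Parity conditions and their behaviour under local complementation *)

Section LocalComplementation.
Variables (T : choiceType) (U : seq T).
Hypothesis uniqU : uniq U.
Implicit Types (M : rel T) (X : pred T) (d : T -> bool).

Local Notation "\xor_ ( w <- s | P ) F" := (\big[addb/false]_(w <- s | P) F)
  (at level 41, w, s at level 50).

(** [X] marks the letters already processed; they are dropped from the sums but still constrained by
    the first clause. For empty [X] and a symmetric [M] with zero diagonal, this is idempotence over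
    GF(2) of [M] with diagonal [d]. *)
Definition gauss_invariant M X d :=
  (forall x y, x \in U -> y \in U -> x != y ->
    \xor_(w <- U | ~~ X w) (M x w && M w y) = M x y && ~~ (d x (+) d y)) /\
  (forall x, x \in U -> ~~ X x -> \xor_(w <- U | ~~ X w) M x w = false).

Lemma xor_andl (s : seq T) (P F : T -> bool) b :
  \xor_(w <- s | P w) (b && F w) = b && \xor_(w <- s | P w) F w.
Proof. by rewrite big_distrr. Qed.

Lemma xor_andr (s : seq T) (P F : T -> bool) b :
  \xor_(w <- s | P w) (F w && b) = (\xor_(w <- s | P w) F w) && b.
Proof. by rewrite big_distrl. Qed.

Lemma eq_xor (P F G : T -> bool) : {in U, F =1 G} ->
  \xor_(w <- U | P w) F w = \xor_(w <- U | P w) G w.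
Proof.
move=> e; rewrite big_seq_cond [RHS]big_seq_cond.
by apply: eq_bigr => w /andP[/e].
Qed.

Lemma xor_eq1 X z : z \in U ->
  \xor_(w <- U | ~~ X w) (w == z) = ~~ X z.
Proof.
move=> zU; rewrite big_mkcond (bigD1_seq z) //= eqxx big1 ?addbF.
  by case: (X z).
by move=> w /negbTE ->; case: ifP.
Qed.

Lemma xor_split X u F : u \in U -> ~~ X u ->
  \xor_(w <- U | ~~ X w) F w = F u (+) \xor_(w <- U | ~~ (X w || (w == u))) F w.
Proof.
move=> uU nXu; rewrite big_mkcond (bigD1_seq u) //= nXu; congr (_ (+) _).
by rewrite -big_mkcondl; apply: eq_bigl => w; rewrite negb_or.
Qed.

Variables (M : rel T) (X : pred T) (d : T -> bool) (u : T).
Hypotheses (Msym : {in U &, symmetric M}) (Mxx : forall x, M x x = false).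
Hypotheses (uU : u \in U) (nXu : ~~ X u) (inv : gauss_invariant M X d).

Definition local_complement x y := M x y (+) ((x != y) && M x u && M u y).
Definition processed w := X w || (w == u).
Definition toggled y := d y (+) (~~ X y && M y u).

Let lcE x w : w \in U -> local_complement x w =
  M x w (+) (M x u && M u w) (+) ((w == x) && M x u).
Proof.
move=> wU; rewrite /local_complement eq_sym; case: (eqVneq w x) => [e|] /=.
  by rewrite e (Msym uU) -?e // andbb Mxx; case: (M _ _).
by rewrite addbF.
Qed.

(** A neighbour [x] of [u] has its edges toggled towards the other neighbours of [u], whose
    unprocessed ones are even in number. The corrections come from [x] itself, if unprocessed, and
    from the removal of [u]; they cancel unless [x] is processed. *)
Lemma sum_local_complement x : x \in U ->
  \xor_(w <- U | ~~ processed w) local_complement x w =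
  \xor_(w <- U | ~~ X w) M x w (+) (X x && M x u).
Proof.
move=> xU; have := xor_split (local_complement x) uU nXu.
rewrite (_ : \xor_(w <- U | ~~ X w) local_complement x w =
  \xor_(w <- U | ~~ X w) M x w (+) (~~ X x && M x u)); last first.
  rewrite (eq_xor _ (lcE x)) !big_split /= xor_andl xor_andr xor_eq1 //.
  by rewrite (inv.2 _ uU nXu) andbF addbF.
rewrite lcE // Mxx andbF addbF.
have -> : (u == x) && M x u = false by case: eqVneq => // <-; rewrite Mxx.
rewrite addbF /processed.
set A := \big[_/_]_(_ <- _ | _) _; set B := \big[_/_]_(_ <- _ | _) _.
by case: A; case: B; case: (X x); case: (M x u).
Qed.

(** Expanding the product of two complemented entries leaves only sums that the old invariant
    evaluates: at the pairs [x y], [x u], [u y], and the even degree of [u]. What remains is a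
    Boolean identity in finitely many variables. *)
Lemma gauss_invariant_local_complement :
  gauss_invariant local_complement processed toggled.
Proof.
split=> [x y xU yU nxy|x xU]; last first.
  rewrite /processed negb_or => /andP[nXx nxu].
  rewrite sum_local_complement // (inv.2 _ xU nXx).
  by rewrite (negbTE nXx).
(* The terms with [w == x] or [w == y] compensate for the zero diagonal that local complementation
   preserves. *)
have E w : w \in U -> local_complement x w && local_complement w y =
   (M x w && M w y) (+) (M u y && (M x w && M w u))
   (+) ((w == y) && (M x y && M u y)) (+) (M x u && (M u w && M w y))
   (+) ((M x u && M u y) && M u w) (+) ((w == y) && (M x u && M u y))
   (+) ((w == x) && (M x u && M x y)) (+) ((w == x) && (M x u && M u y)).
  move=> wU; rewrite (lcE x wU).
  have -> : local_complement w y = M w y (+) (M w u && M u y) (+) ((w == y) && M u y).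
    rewrite /local_complement; case: (eqVneq w y) => [->|] /=; last by rewrite addbF.
    by rewrite (Msym yU uU) andbb Mxx; case: (M u y).
  have [ewx|] := eqVneq w x.
    have [ewy|_] := eqVneq w y; first by rewrite -ewx ewy eqxx in nxy.
    by rewrite ewx (Msym uU xU) Mxx; case: (M x u); case: (M x y); case: (M u y).
  have [->|_ _] := eqVneq w y.
    by rewrite (Msym yU uU) Mxx; case: (M x y); case: (M x u); case: (M u y).
  by rewrite (Msym wU uU); case: (M x w); case: (M x u); case: (M u w); case: (M u y); case: (M w y).
have := xor_split (fun w => local_complement x w && local_complement w y) uU nXu.
rewrite (eq_xor _ E).
rewrite !big_split /= !xor_andl !xor_andr !xor_eq1 //.
rewrite (inv.2 _ uU nXu) (inv.1 _ _ xU yU nxy).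
(* The case [z = u] is outside the first clause of the invariant: there the sum is the degree of
   [u], which is even. *)
have Sx z : z \in U -> \xor_(w <- U | ~~ X w) (M z w && M w u) = M z u && ~~ (d z (+) d u).
  move=> zU; have [->|nzu] := eqVneq z u; last exact: inv.1.
  rewrite Mxx -[RHS](inv.2 _ uU nXu); apply: eq_xor => w wU.
  by rewrite (Msym wU uU) andbb.
have Sy z : z \in U -> \xor_(w <- U | ~~ X w) (M u w && M w z) = M u z && ~~ (d z (+) d u).
  move=> zU; rewrite (Msym uU zU) -Sx // big_seq_cond [RHS]big_seq_cond.
  by apply: eq_bigr => w /andP[wU _]; rewrite (Msym uU wU) (Msym wU zU) andbC.
rewrite Sx // Sy // [X in _ = X (+) _ -> _](_ : _ = M x u && M u y); last first.
  by rewrite /local_complement !Mxx !andbF !addbF.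
rewrite /processed; set B := \big[_/_]_(_ <- _ | _) _.
rewrite /local_complement nxy /toggled (Msym yU uU) /=.
case: B; case: (M x y); case: (M x u); case: (M u y); case: (d x); case: (d y);
  by case: (d u); case: (X x); case: (X y).
Qed.

End LocalComplementation.

(** * Combinatorial drawings of a word along a line *)

Section Drawing.
Local Open Scope nat_scope.
Variable T : choiceType.
Implicit Types (L S W P Q R : seq T) (X : pred T) (d : T -> bool) (u x y w : T).
Implicit Types (p q : T * (nat * nat)) (ps : seq (T * (nat * nat))).

Local Notation "\xor_ ( w <- s | P ) F" := (\big[addb/false]_(w <- s | P) F)
  (at level 41, w, s at level 50).

(* The [k]-th position of the layout owns the points [2k+1] and [2k+2]. *)
Definition position (c : nat) := c.-1./2.

(** Steps along the line join [2c] and [2c+1], in either direction: the gap between the points owned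
    by consecutive positions. *)
Definition baseline_step (b a : nat) :=
  ~~ odd b && (a == b.+1) || ~~ odd a && (b == a.+1).

Fixpoint chain s ps e :=
  if ps is p :: ps' then baseline_step s p.2.1 && chain p.2.2 ps' e
  else baseline_step s e.

Definition endpoints ps := flatten [seq [:: p.2.1; p.2.2] | p <- ps].

Definition located L x c :=
  [&& 0 < c, position c < size L & nth x L (position c) == x].

Definition pass_ok L X p :=
  [/\ located L p.1 p.2.1, located L p.1 p.2.2 &
      if X p.1 then position p.2.1 = position p.2.2
      else position p.2.1 <> position p.2.2 /\ odd p.2.1 = odd p.2.2].

Definition drawing W X L (side : T -> bool) ps :=
  [/\ perm_eq L W,
      {in L &, forall x y, interlace L x y -> side x != side y},
      map fst ps = W,
      uniq (endpoints ps) &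
      [/\ chain 0 ps (size W).*2.+1,
          (forall p, p \in ps -> pass_ok L X p) &
          forall x, x \in W -> X x ->
            \xor_(p <- ps | p.1 == x) odd p.2.2 =
            \xor_(w <- undup W | ~~ X w) interlace W x w]].

Definition flip p := (p.1, (p.2.2, p.2.1)).

Lemma baseline_stepC a b : baseline_step a b = baseline_step b a.
Proof. exact: orbC. Qed.

Lemma chain_cat s ps p ps' e :
  chain s (ps ++ p :: ps') e = chain s ps p.2.1 && chain p.2.2 ps' e.
Proof. by elim: ps s => [|p' ps IH] s //=; rewrite IH andbA. Qed.

Lemma chain_flip s ps e : chain e (rev (map flip ps)) s = chain s ps e.
Proof.
elim: ps s => [|p ps IH] s /=; first exact: baseline_stepC.
by rewrite rev_cons -cats1 chain_cat /= IH andbC baseline_stepC.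
Qed.

Lemma endpoints_cat ps ps' : endpoints (ps ++ ps') = endpoints ps ++ endpoints ps'.
Proof. by rewrite /endpoints map_cat flatten_cat. Qed.

Lemma endpoints_cons p ps : endpoints (p :: ps) = p.2.1 :: p.2.2 :: endpoints ps.
Proof. by []. Qed.

Lemma endpoints_flip ps : perm_eq (endpoints (rev (map flip ps))) (endpoints ps).
Proof.
elim: ps => // p ps IH /=; rewrite rev_cons -cats1 endpoints_cat perm_catC /=.
by rewrite (perm_catCA [:: p.2.2] [:: p.2.1]) /= !perm_cons.
Qed.

Lemma map_fst_flip ps : map fst (rev (map flip ps)) = rev (map fst ps).
Proof. by rewrite map_rev -map_comp. Qed.

Lemma map_cat_split (A B : Type) (f : A -> B) (s : seq A) (P Q : seq B) :
  map f s = P ++ Q -> exists s1 s2, [/\ s = s1 ++ s2, map f s1 = P & map f s2 = Q].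
Proof.
elim: P s => [|z P IH] s /=; first by exists [::], s.
case: s => // a s [<- /IH [p [q [-> <- <-]]]].
by exists (a :: p), q.
Qed.

(** With every letter processed the sums are empty, so the invariant says that [d] differs on
    interlaced letters. The line itself, with a short pass at each position, is then a drawing with
    layout [W]. *)
Lemma base_drawing W X d : double_occurrence_word W ->
  (forall x, x \in W -> X x) -> gauss_invariant (undup W) (interlace W) X d ->
  exists L side ps, drawing W X L side ps.
Proof.
move=> dW WX [inv _].
pose fix mk k (s : seq T) :=
  if s is z :: s' then (z, (k.*2.+1, k.*2.+2)) :: mk k.+1 s' else [::].
have none (f : T -> bool) : \xor_(w <- undup W | ~~ X w) f w = false.
  rewrite big_seq_cond big1 // => w; rewrite mem_undup => /andP[/WX ->] //.
exists W, d, (mk 0 W); split=> //.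
- move=> x y xW yW Ixy; have nxy : x != y by case/andP: Ixy.
  have := inv x y; rewrite !mem_undup => /(_ xW yW nxy); rewrite none Ixy /=.
  by case: (d x); case: (d y).
- by elim: W 0 {dW WX inv none} => //= z s IH k; rewrite IH.
- have H k s : uniq (endpoints (mk k s)) /\ forall c, c \in endpoints (mk k s) -> k.*2 < c.
    elim: s k => [|z s IH] k /=; first by [].
    have [uk lk] := IH k.+1; split.
      rewrite /endpoints /= -/(endpoints _) uk andbT inE negb_or.
      apply/andP; split; last by apply/negP => /lk; lia.
      by apply/andP; split; [lia|apply/negP => /lk; lia].
    move=> c; rewrite /endpoints /= -/(endpoints _) !inE => /or3P[/eqP->|/eqP->|/lk]; lia.
  by have [] := H 0 W.
split.
- have H k s : chain k.*2 (mk k s) (k + size s).*2.+1.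
    elim: s k => [|z s IH] k /=; rewrite /baseline_step.
      by rewrite addn0 odd_double eqxx.
    by rewrite odd_double eqxx /= -doubleS addnS -addSn.
  exact: (H 0 W).
- have H k s p : p \in mk k s -> exists i, [/\ i < size s, p.2 = ((k + i).*2.+1, (k + i).*2.+2) & nth p.1 s i = p.1].
    elim: s k => [|z s IH] k //=; rewrite inE => /orP[/eqP -> /=|/IH [i [H1 H2 H3]]].
      by exists 0; rewrite addn0.
    by exists i.+1; rewrite H2 addnS.
  move=> p /H [i [H1 H2 H3]]; rewrite /pass_ok /located H2 /position /= !add0n doubleK.
  rewrite uphalf_double.
  by rewrite WX ?H1 ?H3 ?eqxx // -H3 mem_nth.
- move=> x xW Xx; rewrite none.
  have H k s : \xor_(p <- mk k s | p.1 == x) odd p.2.2 = false.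
    elim: s k => [|z s IH] k /=; rewrite ?big_nil // big_cons IH /=.
    by rewrite negbK odd_double; case: ifP.
  exact: H.
Qed.

Lemma xor_perm (I : Type) (r1 r2 : seq T) (P F : T -> bool) : perm_eq r1 r2 ->
  \xor_(w <- r1 | P w) F w = \xor_(w <- r2 | P w) F w.
Proof. exact: perm_big. Qed.

Lemma eq_gauss_invariant (U : seq T) M M' X d : {in U &, M =2 M'} ->
  gauss_invariant U M X d -> gauss_invariant U M' X d.
Proof.
move=> e [i1 i2]; split=> [x y xU yU nxy|x xU nX].
  by rewrite -(e x y) // -i1 //; apply: eq_xor => w wU; rewrite !e.
by rewrite -[RHS](i2 x) //; apply: eq_xor => w wU; rewrite e.
Qed.

Lemma perm_gauss_invariant (U U' : seq T) M X d : perm_eq U U' ->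
  gauss_invariant U M X d -> gauss_invariant U' M X d.
Proof.
move=> e [i1 i2]; split=> [x y xU yU nxy|x xU nX].
  by rewrite -i1 ?(perm_mem e) //; apply/esym/perm_big.
by rewrite -[RHS](i2 x) ?(perm_mem e) //; apply/esym/perm_big.
Qed.

Lemma position_parity a b : position a = position b -> a != b -> 0 < a -> 0 < b ->
  odd a = ~~ odd b.
Proof. by rewrite /position; lia. Qed.

Lemma position_neq a b a' : position a = position b -> 0 < a -> 0 < b ->
  0 < a' -> a != b -> a != a' -> b != a' -> position a <> position a'.
Proof. by rewrite /position; lia. Qed.

Lemma xor_flip x ps :
  (forall p, p \in ps -> p.1 == x -> odd p.2.1 = ~~ odd p.2.2) ->
  \xor_(p <- rev (map flip ps) | p.1 == x) odd p.2.2 =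
  \xor_(p <- ps | p.1 == x) odd p.2.2 (+) odd (count (fun p => p.1 == x) ps).
Proof.
rewrite (perm_big (map flip ps)) ?perm_rev //= big_map /=.
elim: ps => [|p ps IH] H; first by rewrite !big_nil.
rewrite !big_cons /= IH => [|q qs]; last by apply: H; rewrite inE qs orbT.
case: ifP => // px; rewrite (H p) ?inE ?eqxx // oddD /=.
by case: (odd p.2.2); case: (odd (count _ _)); case: (\big[_/_]_(_ <- _ | _) _).
Qed.

(** If the passes of [u] are [(a, b)] and [(a', b')], the curve is reconnected as [(a, a')] and
    [(b, b')], and the part between them is run backwards. This undoes the reversal of [Q] and makes
    the two strands at [u] cross. *)
Lemma unprocess_drawing P Q R u X d L side ps :
  let W := P ++ u :: Q ++ u :: R in
  double_occurrence_word W -> u \notin P -> u \notin Q -> u \notin R -> ~~ X u ->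
  gauss_invariant (undup W) (interlace W) X d ->
  drawing (P ++ u :: rev Q ++ u :: R) (processed X u) L side ps ->
  exists ps', drawing W X L side ps'.
Proof.
move=> W dW nP nQ nR nX inv; set W' := P ++ u :: rev Q ++ u :: R.
have pWW' : perm_eq W' W.
  by rewrite perm_cat2l perm_cons perm_cat2r perm_rev.
case=> pL sideL mps uqps [chps okps orps].
have uW : u \in W by rewrite mem_cat inE eqxx orbT.
have IW' : {in undup W &, forall x y, interlace W' x y = local_complement (interlace W) u x y}.
  move=> x y; rewrite !mem_undup /local_complement => xW yW.
  case: (eqVneq x y) => [->|nxy] /=; first by rewrite !interlacexx.
  by rewrite interlace_rev ?dW.
have symW : {in undup W &, symmetric (interlace W)}.
  by move=> x y; rewrite !mem_undup => xW yW; rewrite interlace_sym ?dW.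
have uU : u \in undup W by rewrite mem_undup.
have xorW' x : x \in W -> \xor_(w <- undup W' | ~~ processed X u w) interlace W' x w =
   \xor_(w <- undup W | ~~ X w) interlace W x w (+) (X x && interlace W x u).
  move=> xW; rewrite -(sum_local_complement (undup_uniq W) symW (interlacexx W) uU nX inv) ?mem_undup //.
  rewrite (perm_big _ (perm_undup (perm_mem pWW'))) /=.
  by apply: eq_xor => w wU; rewrite IW' // mem_undup.
have [p1 [s1 [eps mp1 ms1]]] := map_cat_split mps.
case: s1 ms1 eps => // -[u1 [a b]] s1 /= [-> /map_cat_split [q1 [s2 [-> mq1 ms2]]]].
case: s2 ms2 => // -[u2 [a' b']] r1 /= [-> mr1] eps; rewrite {s1 u1 u2}eps in mps uqps chps okps orps.
have ok1 := okps (u, (a, b)); have ok2 := okps (u, (a', b')).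
have [|la lb] := ok1; first by rewrite mem_cat inE eqxx orbT.
have [|la' lb'] := ok2; first by rewrite !(mem_cat, inE) eqxx !orbT.
rewrite /processed /= eqxx orbT /= in la lb la' lb' *.
move=> eab' eab {ok1 ok2}.
have u_notin (s : seq (T * (nat * nat))) (V : seq T) : map fst s = V -> u \notin V ->
   \xor_(p <- s | p.1 == u) odd p.2.2 = false.
  move=> <- nV; rewrite big_seq_cond big1 // => p /andP[ps0 /eqP e].
  by case/negP: nV; rewrite -e map_f.
(* The even degree of [u] enters here: the two exits have equal parity, so that both new chords join
   points of equal parity. *)
have oru : odd b = odd b'.
  have := orps u; rewrite -(perm_mem pWW') in uW; move=> /(_ uW).
  rewrite /processed eqxx orbT => /(_ isT); rewrite -/(processed X u) xorW'; last by rewrite -(perm_mem pWW').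
  rewrite (negbTE nX) addbF (inv.2 _ uU nX).
  rewrite big_cat big_cons /= eqxx big_cat big_cons /= eqxx.
  rewrite (u_notin _ _ mp1 nP) (u_notin _ _ mr1 nR) (u_notin _ _ mq1) ?mem_rev //=.
  by case: (odd b); case: (odd b').
have puq : perm_eq (endpoints (p1 ++ (u, (a, a')) :: rev (map flip q1) ++ (u, (b, b')) :: r1))
    (endpoints (p1 ++ (u, (a, b)) :: q1 ++ (u, (a', b')) :: r1)).
  apply/permP => pr; rewrite !(endpoints_cat, endpoints_cons, count_cat) /=.
  rewrite !(endpoints_cat, endpoints_cons, count_cat) (permP (endpoints_flip q1) pr) /=.
  move: (count pr _) (count pr _) (count pr _) (nat_of_bool (pr a)) (nat_of_bool (pr b)) (nat_of_bool (pr a')) (nat_of_bool (pr b')).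
  clear; lia.
have [ab aa' ba' a'b'] : [/\ a != b, a != a', b != a' & a' != b'].
  move: (uqps); rewrite !(endpoints_cat, endpoints_cons) cat_uniq /= => /and3P[_ _].
  rewrite cat_uniq /= !(inE, mem_cat) !negb_or.
  by case/and4P => /and5P[-> _ -> _ _] /and4P[_ -> _ _] _ /and4P[_ /andP[-> _] _ _].
have [a0 b0 a'0 b'0] : [/\ 0 < a, 0 < b, 0 < a' & 0 < b'].
  by case/andP: la => ->; case/andP: lb => ->; case/andP: la' => ->; case/andP: lb' => ->.
have locab : position a <> position a' by apply: (@position_neq a b a').
have ora : odd a = odd a'.
  by rewrite (position_parity eab) // (position_parity eab') // oru.
exists (p1 ++ (u, (a, a')) :: rev (map flip q1) ++ (u, (b, b')) :: r1).
split=> //.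
- exact: perm_trans pL pWW'.
- by rewrite map_cat /= map_cat map_fst_flip mp1 mq1 revK /= mr1.
- by rewrite (perm_uniq puq).
split.
- move: chps; rewrite (perm_size pWW') !chain_cat /= chain_flip.
  by case/and3P => -> -> ->.
- move=> p; rewrite mem_cat inE mem_cat inE mem_rev.
  have okp q : q.1 != u -> pass_ok L (processed X u) q -> pass_ok L X q.
    by rewrite /pass_ok /processed => /negbTE ->; rewrite orbF.
  have neq (s : seq (T * (nat * nat))) V q : map fst s = V -> u \notin V -> q \in s -> q.1 != u.
    by move=> <- nV qs; apply: contra nV => /eqP <-; rewrite map_f.
  case/or4P => [pp1|/eqP ->|/mapP [q qq1 ->]|/orP[/eqP->|pr1]].
  + apply: okp (okps _ _); first exact: neq mp1 nP pp1.
    by rewrite mem_cat pp1.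
  + by rewrite /pass_ok /= (negbTE nX); split=> //; split.
  + have nu : q.1 != u by apply: neq mq1 _ qq1; rewrite mem_rev.
    have [] := okp q nu (okps q _); first by rewrite !(mem_cat, inE) qq1 !orbT.
    rewrite /pass_ok /flip /= => l1 l2 H; split=> //.
    by case: ifP H => // _ [H1 H2]; split=> // /esym.
  + rewrite /pass_ok /= (negbTE nX); split=> //; split; last exact: oru.
    by rewrite -eab -eab'.
  + apply: okp (okps _ _); first exact: neq mr1 nR pr1.
    by rewrite !(mem_cat, inE) pr1 !orbT.
- move=> x xW Xx; have nux : u == x = false by apply: contraNF nX => /eqP ->.
  have := orps x; rewrite (perm_mem pWW') => /(_ xW).
  rewrite {1}/processed Xx /= => /(_ isT); rewrite xorW' // Xx /=.
  rewrite big_cat big_cons /= nux big_cat big_cons /= nux => e.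
  rewrite big_cat big_cons /= nux big_cat big_cons /= nux xor_flip; last first.
    move=> q qq1 /eqP qx; have qps : q \in p1 ++ (u, (a, b)) :: q1 ++ (u, (a', b')) :: r1.
      by rewrite !(mem_cat, inE) qq1 !orbT.
    have [/andP[q10 _] /andP[q20 _]] := okps _ qps.
    rewrite qx /processed Xx /= => eq; apply: position_parity eq _ _ _ => //.
    apply: contraTneq uqps => eq; move: qq1 => /splitPr[t1 t2].
    rewrite !(endpoints_cat, endpoints_cons) cat_uniq /= !cat_uniq /= -eq.
    by rewrite !inE eqxx ?(andbF, andFb).
  (* Each flipped pass of [x] exchanges an entry and an exit of opposite parity. The total changes
     exactly when [x] is interlaced with [u], which is also the change in the count of unprocessed
     neighbours. *)
  have -> : count (fun p => p.1 == x) q1 = count_mem x Q.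
    by rewrite -[RHS](count_rev (pred1 x)) -mq1 count_map.
  have -> : odd (count_mem x Q) = interlace W x u.
    by rewrite interlace_sym ?dW // interlace_splitE // nux.
  move: e; case: (interlace W x u); rewrite ?(addbT, addbF) //.
  set A := \big[_/_]_(_ <- _ | _) _; set B := \big[_/_]_(_ <- _ | _) _.
  set C := \big[_/_]_(_ <- _ | _) _; set D := \big[_/_]_(_ <- _ | _) _.
  by case: A; case: B; case: C; case: D.
Qed.

(** Induction on the number of unprocessed letters: the segment between the occurrences of one of
    them is reversed, the resulting word is drawn, and the reversal is undone in the drawing. *)
Theorem gauss_drawing W d : double_occurrence_word W ->
  gauss_invariant (undup W) (interlace W) pred0 d ->
  exists L side ps, drawing W pred0 L side ps.
Proof.
suff H n X V d' : count (fun x => ~~ X x) (undup V) <= n -> double_occurrence_word V ->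
    gauss_invariant (undup V) (interlace V) X d' ->
    exists L side ps, drawing V X L side ps.
  by move=> dW inv; apply: (H _ _ _ d (leqnn _) dW inv).
elim: n X V d' => [|n IH] X V d' lec dV inv.
  apply: base_drawing dV _ inv => x xV; apply/negPn/negP => nX.
  move: lec; rewrite leqn0 => /eqP/eqP; rewrite -leqn0 leqNgt -has_count => /hasP[].
  by exists x; rewrite ?mem_undup.
have [/hasP[u]|nh] := boolP (has (fun x => ~~ X x) (undup V)); last first.
  apply: base_drawing dV _ inv => x xV; apply/negPn/negP => nX.
  by case/negP: nh; apply/hasP; exists x; rewrite ?mem_undup.
rewrite mem_undup => uV nX.
have [P [Q [R [eV nP nQ nR]]]] := double_split (dV u uV).
rewrite eV in lec dV inv uV *.
set V' := P ++ u :: rev Q ++ u :: R.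
have pV : perm_eq V' (P ++ u :: Q ++ u :: R).
  by rewrite perm_cat2l perm_cons perm_cat2r perm_rev.
have dV' : double_occurrence_word V'.
  by move=> x; rewrite (perm_mem pV) (permP pV); apply: dV.
have [||L [side [ps Hps]]] := IH (processed X u) V' (toggled (interlace (P ++ u :: Q ++ u :: R)) X d' u) _ dV'.
- rewrite (permP (perm_undup (perm_mem pV))) -ltnS; apply: leq_trans lec.
  have uu : u \in undup (P ++ u :: Q ++ u :: R) by rewrite mem_undup.
  rewrite -!size_filter; apply: (leq_trans (n := size (u :: [seq x <- undup (P ++ u :: Q ++ u :: R) | ~~ processed X u x]))) => //.
  apply: uniq_leq_size.
    by rewrite /= filter_uniq ?undup_uniq // mem_filter /processed eqxx orbT.
  move=> x; rewrite inE !mem_filter => /orP[/eqP ->|/andP[]]; first by rewrite nX.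
  by rewrite /processed negb_or => /andP[-> _] ->.
- have symV : {in undup (P ++ u :: Q ++ u :: R) &, symmetric (interlace (P ++ u :: Q ++ u :: R))}.
    by move=> x y; rewrite !mem_undup => xW yW; rewrite interlace_sym ?dV.
  have uU : u \in undup (P ++ u :: Q ++ u :: R) by rewrite mem_undup.
  have := gauss_invariant_local_complement (undup_uniq _) symV (interlacexx _) uU nX inv.
  move/(perm_gauss_invariant (perm_undup (fun x => esym (perm_mem pV x)))).
  apply: eq_gauss_invariant => x y; rewrite !mem_undup !(perm_mem pV) /local_complement => xW yW.
  case: (eqVneq x y) => [->|nxy] /=; first by rewrite !interlacexx.
  by rewrite interlace_rev ?dV.
have [ps' Hps'] := unprocess_drawing dV nP nQ nR nX inv Hps.
by exists L, side, ps'.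
Qed.

End Drawing.

Import numFieldNormedType.Exports.
Local Open Scope classical_set_scope.
Local Open Scope ring_scope.

(** * Calculus of smooth real functions and a smooth ramp *)

Section Smooth.
Variable R : realType.
Implicit Types (f g : R -> R) (t x : R) (n k : nat).

Lemma is_derive_add f g x (a b : R) : is_derive x 1 f a -> is_derive x 1 g b ->
  is_derive x 1 (fun y => f y + g y) (a + b).
Proof. exact: is_deriveD. Qed.

Lemma is_derive_opp f x (a : R) : is_derive x 1 f a ->
  is_derive x 1 (fun y => - f y) (- a).
Proof. exact: is_deriveN. Qed.

Lemma is_derive_sub f g x (a b : R) : is_derive x 1 f a -> is_derive x 1 g b ->
  is_derive x 1 (fun y => f y - g y) (a - b).
Proof. by move=> df dg; apply: is_derive_add => //; apply: is_derive_opp. Qed.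

Lemma is_derive_mul f g x (a b : R) : is_derive x 1 f a -> is_derive x 1 g b ->
  is_derive x 1 (fun y => f y * g y) (f x * b + g x * a).
Proof. exact: is_deriveM. Qed.

Lemma is_derive_inv f x (a : R) : f x != 0 -> is_derive x 1 f a ->
  is_derive x 1 (fun y => (f y)^-1) (- (f x) ^- 2 * a).
Proof. exact: is_deriveV. Qed.

Lemma is_derive_const x (c : R) : is_derive x 1 (fun=> c) 0.
Proof. exact: is_derive_cst. Qed.

Lemma is_derive_var x : is_derive x 1 (fun y => y) 1.
Proof. exact: is_derive_id. Qed.

Lemma is_derive_compose f g x (a b : R) : is_derive (g x) 1 f a ->
  is_derive x 1 g b -> is_derive x 1 (fun y => f (g y)) (a * b).
Proof. exact: is_derive1_comp. Qed.

Lemma is_derive_exp f x (a : R) n : is_derive x 1 f a ->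
  is_derive x 1 (fun y => f y ^+ n) (n%:R * f x ^+ n.-1 * a).
Proof.
move=> df; elim: n => [|n IH].
  rewrite !mul0r (_ : (fun _ => _) = fun=> 1); first exact: is_derive_const.
  by apply/funext => y; rewrite expr0.
rewrite (_ : (fun _ => _) = fun y => f y * f y ^+ n); last by apply/funext => y; rewrite exprS.
have := is_derive_mul df IH; congr is_derive => /=.
by case: n {IH} => [|n] /=; rewrite ?expr0 ?exprS -?natr1; ring.
Qed.

(** The division-free form of differentiability; it gives the derivative of [flat] at 0 and the
    estimates for a curve near its double points. *)
Lemma is_deriveP f x (a : R) : is_derive x 1 f a <->
  forall e, 0 < e -> \forall y \near x, `|f y - f x - a * (y - x)| <= e * `|y - x|.
Proof.
have E (b e z : R) : z != 0 -> (`|b - z^-1 *: (f (z *: 1 + x) - f x)| <= e) =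
    (`|f (z + x) - f x - b * (z + x - x)| <= e * `|z + x - x|).
  move=> z0; rewrite addrK -ler_pdivrMr ?normr_gt0 // -normfV -normrM distrC.
  by congr (`|_| <= _); rewrite [z *: 1](mulr1 z) /GRing.scale /=; field.
split=> [[+ <-] e e0|H].
  move=> /cvg_ex[l /= Hl]; have := Hl => /cvg_lim -/(_ (@norm_hausdorff _ _)) El.
  rewrite /derive El.
  move/cvgrPdist_le : Hl => /(_ _ e0) /nbhs_ballP[d /= d0 Hd].
  apply/nbhs_ballP; exists d => //= y; rewrite /ball /= => yd.
  have [->|nyx] := eqVneq y x; first by rewrite !subrr mulr0 subr0 normr0 mulr0.
  have yx0 : y - x != 0 by rewrite subr_eq0.
  have := Hd (y - x); rewrite /ball /= sub0r normrN distrC yd yx0 => /(_ isT isT).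
  by rewrite E ?subrK // [`|x - y|]distrC.
have cv : (fun h => h^-1 *: (f (h *: 1 + x) - f x)) @ 0^' --> a.
  apply/cvgrPdist_le => e /H /nbhs_ballP[d /= d0 Hd].
  near=> h; rewrite E; last by near: h; exact: nbhs_dnbhs_neq.
  apply: Hd; rewrite /ball /= opprD addrCA subrr addr0 normrN.
  by near: h; exact: dnbhs0_lt.
by apply: DeriveDef; [apply/cvg_ex; exists a|exact: cvg_lim].
Unshelve. all: by end_near. Qed.

(** The recursion peels off the first derivative, so that closure under products, inverses and
    composition follows by induction on [n]. *)
Fixpoint smoothn n f : Prop :=
  (forall t, derivable f t 1) /\ (if n is n'.+1 then smoothn n' (derive1 f) else True).

Lemma smoothn_derivable n f t : smoothn n f -> derivable f t 1.
Proof. by case: n => [|n] [+ _]; apply. Qed.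

Lemma smoothnW n f : smoothn n.+1 f -> smoothn n f.
Proof.
elim: n f => [|n IH] f [df sf]; first by split.
by split=> //; apply: IH.
Qed.

Lemma smoothnD n f g : smoothn n f -> smoothn n g ->
  smoothn n (fun t => f t + g t).
Proof.
elim: n f g => [|n IH] f g [df sf] [dg sg]; (split; first by move=> t; apply: derivableD).
  exact: I.
rewrite (_ : derive1 _ = fun t => (derive1 f) t + (derive1 g) t); first exact: IH.
by apply/funext => t; rewrite !derive1E deriveD.
Qed.

Lemma smoothn_cst n (c : R) : smoothn n (fun=> c).
Proof.
elim: n c => [|n IH] c; (split=> [t|//]; first exact: derivable_cst).
rewrite (_ : derive1 _ = fun=> (0 : R)) //.
by apply/funext => t; rewrite derive1_cst.
Qed.

Lemma smoothn_id n : smoothn n (fun t => t).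
Proof.
have d t : derivable (fun t : R => t) t 1 by exact: derivable_id.
case: n => [|n]; split=> //.
rewrite (_ : derive1 _ = fun=> (1 : R)); first exact: smoothn_cst.
by apply/funext => t; rewrite derive1E derive_id.
Qed.

Lemma smoothnM n f g : smoothn n f -> smoothn n g ->
  smoothn n (fun t => f t * g t).
Proof.
elim: n f g => [|n IH] f g; first by move=> [df _] [dg _]; split; [move=> t; exact: derivableM|exact: I].
move=> sf sg; have [df sf'] := sf; have [dg sg'] := sg.
split; first by move=> t; exact: derivableM.
rewrite (_ : derive1 _ = fun t => f t * (derive1 g) t + g t * (derive1 f) t).
  by apply: smoothnD; apply: IH => //; exact: smoothnW.
by apply/funext => t; rewrite !derive1E deriveM.
Qed.

Lemma smoothnN n f : smoothn n f -> smoothn n (fun t => - f t).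
Proof.
move=> sf; rewrite (_ : (fun t => _) = fun t => (-1) * f t).
  exact: smoothnM (smoothn_cst _ _) sf.
by apply/funext => t; rewrite mulN1r.
Qed.

Lemma smoothnB n f g : smoothn n f -> smoothn n g ->
  smoothn n (fun t => f t - g t).
Proof. by move=> sf sg; apply: smoothnD => //; apply: smoothnN. Qed.

Lemma smoothnV n f : (forall t, f t != 0) -> smoothn n f ->
  smoothn n (fun t => (f t)^-1).
Proof.
move=> f0; elim: n => [|n IH]; first by move=> [df _]; split; [move=> t; exact: derivableV|exact: I].
move=> sf; have [df sf'] := sf; split; first by move=> t; exact: derivableV.
have IHf := IH (smoothnW sf).
rewrite (_ : derive1 _ = fun t => - ((f t)^-1 * (f t)^-1) * (derive1 f) t).
  by apply: smoothnM => //; apply/smoothnN/smoothnM.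
by apply/funext => t; rewrite !derive1E deriveV // expr2 invfM.
Qed.

Lemma smoothn_comp n f g : smoothn n f -> smoothn n g ->
  smoothn n (fun t => g (f t)).
Proof.
elim: n f g => [|n IH] f g.
  move=> [df _] [dg _]; split; last exact: I.
  by move=> t; apply/derivable1_diffP/differentiable_comp; exact/derivable1_diffP.
move=> sf sg; have [df sf'] := sf; have [dg sg'] := sg; split.
  by move=> t; apply/derivable1_diffP/differentiable_comp; exact/derivable1_diffP.
rewrite (_ : derive1 _ = fun t => (derive1 g) (f t) * (derive1 f) t).
  by apply: smoothnM => //; apply: IH => //; exact: smoothnW.
by apply/funext => t; rewrite -derive1_comp.
Qed.

Lemma smoothn_local n f :
  (forall t, exists2 g, smoothn n g & \forall x \near t, f x = g x) -> smoothn n f.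
Proof.
have derf k f1 h t : smoothn k h -> (\forall x \near t, f1 x = h x) -> derivable f1 t 1.
  move=> sh e; apply: (near_eq_derivable (f := h)); last exact: smoothn_derivable sh.
  by apply: filterS e => x ->.
elim: n f => [|n IH] f H; first by split=> // t; have [g sg e] := H t; apply: derf sg e.
split; first by move=> t; have [g sg e] := H t; apply: derf sg e.
apply: IH => t; have [g [dg sg] e] := H t; exists (derive1 g) => //.
have := near_join e; apply: filterS => x ex.
by rewrite !derive1E; apply: near_eq_derive.
Qed.

(** The whole family over [k] is needed because the derivative of a member is a combination of
    members; smoothness then follows by induction. *)
Definition flat k x := if 0 < x then x ^- k * expR (- x^-1) else 0.

(** The exponential of [x^-1] exceeds the term of order [k + 2] of its series. A quadratic bound
    makes the derivative at 0 vanish. *)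
Lemma flat_bound k x : `|flat k x| <= (k.+2)`!%:R * x ^+ 2.
Proof.
rewrite /flat; case: ifPn => [x0|_]; last by rewrite normr0 mulr_ge0 ?ler0n ?sqr_ge0.
have xk : 0 <= x ^- k by rewrite invr_ge0 exprn_ge0 // ltW.
rewrite ger0_norm; last by rewrite mulr_ge0 ?expR_ge0.
have := expR_ge1Dxn k.+1 (ltW (_ : 0 < x^-1)); rewrite invr_gt0 => /(_ x0) H.
have {}H : x^-1 ^+ k.+2 / (k.+2)`!%:R <= expR x^-1 by apply: le_trans H; rewrite lerDr.
have f0 : 0 < (k.+2)`!%:R :> R by rewrite ltr0n fact_gt0.
rewrite expRN ler_pdivrMr ?expR_gt0 // -mulrA -ler_pdivrMl //.
apply: le_trans (ler_wpM2l (sqr_ge0 x) H); rewrite le_eqVlt; apply/orP; left; apply/eqP.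
by rewrite -[k.+2]addn2 exprD exprVn; field; rewrite !gt_eqF ?exprn_gt0 ?addn2.
Qed.

Lemma is_derive_flat k x :
  is_derive x 1 (flat k) (flat k.+2 x - k%:R * flat k.+1 x).
Proof.
have [x0|x0|x0] := ltrgtP x 0.
- rewrite {2 3}/flat !ltNge (ltW x0) /= mulr0 subr0.
  apply: (near_eq_is_derive (f := cst (0 : R))).
  near=> y; rewrite /flat ltNge (_ : y <= 0) // ltW //; near: y; exact: lt_nbhsl.
- have xn0 : x != 0 by rewrite gt_eqF.
  apply: (near_eq_is_derive (f := fun y : R => (y^-1) ^+ k * expR (- y^-1))).
    by near=> y; rewrite /flat ifT ?exprVn //; near: y; exact: lt_nbhsr.
  have d1 := is_derive_inv xn0 (is_derive_var x).
  have d2 := @is_derive_compose expR (fun y => - y^-1) x _ _ (is_derive_expR _) (is_derive_opp d1).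
  have := is_derive_mul (is_derive_exp k d1) d2; congr is_derive.
  rewrite /flat x0 !exprVn.
  case: k {d1 d2} => [|k]; first by rewrite expr0 expr1; field.
  by rewrite /= !exprS -!natr1; field; rewrite expf_neq0.
rewrite {2 3}/flat x0 !ltxx mulr0 subr0; apply/is_deriveP => e e0.
have C0 : 0 < (k.+2)`!%:R :> R by rewrite ltr0n fact_gt0.
near=> y; rewrite mul0r subr0 /(flat k 0) ltxx !subr0.
apply: le_trans (flat_bound k y) _.
rewrite -[y ^+ 2]ger0_norm ?sqr_ge0 // normrX expr2 mulrA ler_wpM2r //.
rewrite -ler_pdivlMl //; near: y; apply: (@nbhs0_le _ R).
by rewrite mulr_gt0 ?invr_gt0.
Unshelve. all: by end_near. Qed.

Lemma is_derive_derive1 f x (a : R) : is_derive x 1 f a -> derive1 f x = a.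
Proof. by move=> df; rewrite derive1E derive_val. Qed.

Lemma smoothn_flat n k : smoothn n (flat k).
Proof.
have d k' t : derivable (flat k') t 1 by have [] := is_derive_flat k' t.
elim: n k => [|n IH] k; split=> //.
rewrite (_ : derive1 _ = fun x => flat k.+2 x - k%:R * flat k.+1 x).
  by apply: smoothnB => //; apply: smoothnM => //; apply: smoothn_cst.
by apply/funext => x; exact/is_derive_derive1/is_derive_flat.
Qed.

Lemma flat_ge0 k x : 0 <= flat k x.
Proof.
by rewrite /flat; case: ifPn => // x0; rewrite mulr_ge0 ?expR_ge0 ?invr_ge0 ?exprn_ge0 ?ltW.
Qed.

Lemma flat_gt0 k x : 0 < x -> 0 < flat k x.
Proof. by move=> x0; rewrite /flat x0 mulr_gt0 ?expR_gt0 ?invr_gt0 ?exprn_gt0. Qed.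

Lemma flat_eq0 k x : x <= 0 -> flat k x = 0.
Proof. by rewrite /flat leNgt => /negbTE ->. Qed.

Definition smooth_step x := flat 0 (1 + x) / (flat 0 (1 + x) + flat 0 (1 - x)).

Lemma smooth_step_den x : 0 < flat 0 (1 + x) + flat 0 (1 - x).
Proof.
have [x0|x0] := ltP 0 (1 + x); first by rewrite ltr_pwDl ?flat_gt0 ?flat_ge0.
by rewrite ltr_pwDr ?flat_ge0 // flat_gt0; lra.
Qed.

Lemma smooth_step_le1 x : 0 <= smooth_step x <= 1.
Proof.
rewrite /smooth_step divr_ge0 ?flat_ge0 ?(ltW (smooth_step_den x)) //=.
by rewrite ler_pdivrMr ?smooth_step_den // mul1r lerDl flat_ge0.
Qed.

Lemma smooth_step0 x : x <= -1 -> smooth_step x = 0.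
Proof. by move=> x1; rewrite /smooth_step flat_eq0 ?mul0r //; lra. Qed.

Lemma smooth_step1 x : 1 <= x -> smooth_step x = 1.
Proof.
move=> x1; rewrite /smooth_step (flat_eq0 _ (_ : 1 - x <= 0)) ?subr_le0 // addr0 divff //.
by rewrite gt_eqF ?flat_gt0 //; lra.
Qed.

Lemma smoothn_smooth_step n : smoothn n smooth_step.
Proof.
have s1 : smoothn n (fun x => flat 0 (1 + x)).
  apply: (smoothn_comp _ (smoothn_flat n 0)).
  by apply: smoothnD; [exact: smoothn_cst|exact: smoothn_id].
have s2 : smoothn n (fun x => flat 0 (1 - x)).
  apply: (smoothn_comp _ (smoothn_flat n 0)).
  by apply: smoothnB; [exact: smoothn_cst|exact: smoothn_id].
apply: smoothnM => //; apply: smoothnV; last exact: smoothnD.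
by move=> x; rewrite gt_eqF ?smooth_step_den.
Qed.

(** A smooth substitute for the maximum of [x] and 0 that agrees with it outside the interval from
    [-e] to [e]. *)
Definition ramp e x := x * smooth_step (x / e).

Lemma smoothn_ramp n e : smoothn n (ramp e).
Proof.
apply: smoothnM; first exact: smoothn_id.
apply: (smoothn_comp _ (smoothn_smooth_step n)).
by apply: smoothnM; [exact: smoothn_id|exact: smoothn_cst].
Qed.

Lemma ramp_le e x : x <= - e -> 0 < e -> ramp e x = 0.
Proof.
by move=> xe e0; rewrite /ramp smooth_step0 ?mulr0 // ler_pdivrMr // mulN1r.
Qed.

Lemma ramp_ge e x : e <= x -> 0 < e -> ramp e x = x.
Proof.
by move=> xe e0; rewrite /ramp smooth_step1 ?mulr1 // ler_pdivlMr // mul1r.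
Qed.

Lemma ramp_dist e x : 0 < e -> `|ramp e x - Num.max x 0| <= e.
Proof.
move=> e0; have [xe|xe] := lerP x (- e).
  by rewrite ramp_le // max_r ?subrr ?normr0 ?ltW //; lra.
have [ex|ex] := lerP e x.
  by rewrite ramp_ge // max_l ?subrr ?normr0 ?ltW //; lra.
have /andP[s0 s1] := smooth_step_le1 (x / e); rewrite /ramp.
by have [x0|x0] := lerP 0 x; rewrite ler_norml; apply/andP; split; nra.
Qed.

Lemma derive1_row m (f : 'I_m -> R -> R) t : (forall i, derivable (f i) t 1) ->
  derivable (fun x => \row_i f i x) t 1 /\
  derive1 (fun x => \row_i f i x) t = \row_i derive1 (f i) t.
Proof.
have E i : (fun x => (\row_i f i x : 'rV[R]_m) 0 i) = f i.
  by apply/funext => x; rewrite mxE.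
move=> df; have drow : derivable (fun x => \row_i f i x) t 1.
  by apply/derivable_mxP => i j; rewrite ord1 E.
split=> //; rewrite derive1E derive_mx //; apply/matrixP => i j.
by rewrite ord1 !mxE E derive1E.
Qed.

Lemma smooth_row (f : 'I_3 -> R -> R) : (forall n i, smoothn n (f i)) ->
  smooth (fun x => \row_i f i x).
Proof.
move=> sf n; elim: n f sf => [|n IH] f sf t.
  by apply: (derive1_row _).1 => i; exact: smoothn_derivable (sf 0 i).
rewrite derive1Sn (_ : derive1 _ = fun x => \row_i derive1 (f i) x).
  by apply: IH => k i; have [] := sf k.+1 i.
apply/funext => x; apply: (derive1_row _).2 => i.
exact: smoothn_derivable (sf 0 i).
Qed.

End Smooth.

(** * From plane curves to curves on the sphere *)

Section InverseStereographic.
Variable R : realType.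
Implicit Types (x y : R -> R) (s t : R) (p A B : 'rV[R]_3).

Definition row3 (a b c : R) : 'rV[R]_3 := \row_i nth 0 [:: a; b; c] i.

Lemma sum3 (F : 'I_3 -> R) : \sum_i F i = F 0 + F 1 + F (lift 0 (lift 0 0)).
Proof.
by rewrite !big_ord_recl big_ord0 addr0 addrA; congr (_ + F _ + F _); apply/val_inj.
Qed.

Lemma row3E a b c : [/\ row3 a b c 0 0 = a, row3 a b c 0 1 = b &
  row3 a b c 0 (lift 0 (lift 0 0)) = c].
Proof. by rewrite !mxE. Qed.

Lemma rank_tangent p : p != 0 -> \rank (tangent_sphere2 p) = 2%N.
Proof. by move=> p0; rewrite mxrank_ker mxrank_tr rank_rV p0. Qed.

Lemma sphere2_neq0 p : sphere2 p -> p != 0.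
Proof.
rewrite /sphere2 /=; apply: contra_eqN => /eqP ->.
by rewrite sum3 !mxE !expr0n /= !addr0 eq_sym oner_neq0.
Qed.

(** The tangent plane has rank 2, so two tangent vectors span it as soon as some linear map to the
    plane sends them to independent vectors. *)
Lemma tangent_spanned p A B (C : 'M[R]_(3, 2)) : p != 0 ->
  A *m p^T = 0 -> B *m p^T = 0 ->
  (A *m C) 0 0 * (B *m C) 0 1 - (A *m C) 0 1 * (B *m C) 0 0 != 0 ->
  (A + B == tangent_sphere2 p)%MS.
Proof.
move=> p0 Ap Bp d.
have AB : (A + B <= tangent_sphere2 p)%MS.
  by rewrite addsmx_sub; apply/andP; split; apply/sub_kermxP.
rewrite AB -(mxrank_leqif_sup AB).2 rank_tangent //.
rewrite /= eqn_leq; apply/andP; split; first by have := mxrankS AB; rewrite rank_tangent.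
have := mxrankM_maxl (col_mx A B) C; rewrite -addsmxE mul_col_mx; apply: leq_trans.
suff /mxrank_unit -> : (col_mx (A *m C) (B *m C) : 'M[R]_2) \in unitmx by [].
rewrite unitmxE unitfE (expand_det_row _ 0) !big_ord_recl big_ord0 addr0.
rewrite /cofactor !det_mx11 !mxE /=.
have s0 (i : 'I_(1 + 1)) : i = 0%N :> nat -> fintype.split i = inl 0.
  by move=> e; rewrite (_ : i = lshift 1 0) ?(unsplitK (inl _)) //; apply/val_inj.
have s1 (i : 'I_(1 + 1)) : i = 1%N :> nat -> fintype.split i = inr 0.
  by move=> e; rewrite (_ : i = rshift 1 0) ?(unsplitK (inr _)) //; apply/val_inj.
rewrite s0 // s1 // (_ : lift ord0 0 = 1); last exact/val_inj.
rewrite (_ : lift 1 0 = 0); last exact/val_inj.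
by rewrite addn0 add0n expr0 mul1r expr1 mulN1r mulrN.
Qed.

Variables (x y : R -> R).
Hypotheses (sx : forall n, smoothn n x) (sy : forall n, smoothn n y).

Definition stereo_den t := 1 + x t ^+ 2 + y t ^+ 2.
Definition inv_stereo t : 'rV[R]_3 :=
  row3 (2 * x t / stereo_den t) (2 * y t / stereo_den t) (1 - 2 / stereo_den t).

Lemma stereo_den_gt0 t : 0 < stereo_den t.
Proof. by rewrite /stereo_den -addrA ltr_wpDr ?addr_ge0 ?sqr_ge0. Qed.
Let D0 t : stereo_den t != 0. Proof. by rewrite gt_eqF ?stereo_den_gt0. Qed.

Lemma inv_stereo_sphere2 t : sphere2 (inv_stereo t).
Proof.
rewrite /sphere2 /= sum3; have [-> -> ->] := row3E (2 * x t / stereo_den t) (2 * y t / stereo_den t) (1 - 2 / stereo_den t).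
have := D0 t; rewrite /stereo_den => d; field.
by [].
Qed.

Lemma inv_stereo_inj s t : inv_stereo s = inv_stereo t -> x s = x t /\ y s = y t.
Proof.
move=> /matrixP e; have := e 0 0; have := e 0 1; have := e 0 (lift 0 (lift 0 0)).
have n2 : (2 : R) != 0 by rewrite pnatr_eq0.
rewrite !mxE /= => /addrI/oppr_inj /(mulfI n2)/invr_inj ->.
move=> /(mulIf (invr_neq0 (D0 t)))/(mulfI n2) ->.
by move=> /(mulIf (invr_neq0 (D0 t)))/(mulfI n2) ->.
Qed.

Let dx t : is_derive t 1 x (derive1 x t).
Proof. by rewrite derive1E; apply: derivableP; exact: smoothn_derivable (sx 0%N). Qed.
Let dy t : is_derive t 1 y (derive1 y t).
Proof. by rewrite derive1E; apply: derivableP; exact: smoothn_derivable (sy 0%N). Qed.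

Definition dstereo_den t := 2 * (x t * derive1 x t + y t * derive1 y t).

Lemma is_derive_stereo_den t : is_derive t 1 stereo_den (dstereo_den t).
Proof.
have := is_derive_add (is_derive_add (is_derive_const t 1) (is_derive_exp 2 (dx t)))
  (is_derive_exp 2 (dy t)).
by congr is_derive; rewrite /dstereo_den /=; ring.
Qed.

Lemma smooth_inv_stereo : smooth inv_stereo.
Proof.
have sD n : smoothn n stereo_den.
  have sq z : smoothn n z -> smoothn n (fun t => z t ^+ 2).
    move=> sz; rewrite (_ : (fun _ => _) = fun t => z t * z t); first exact: smoothnM.
    by apply/funext => t; rewrite expr2.
  by apply: smoothnD; [apply: smoothnD; [exact: smoothn_cst|]|]; exact: sq.
have sV n : smoothn n (fun t => (stereo_den t)^-1) by exact: smoothnV.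
apply: (@smooth_row _ (fun i t => nth 0 [:: 2 * x t / stereo_den t; 2 * y t / stereo_den t; 1 - 2 / stereo_den t] i)).
move=> n [[|[|[|//]]] i3] /=.
- by apply: smoothnM => //; apply: smoothnM => //; apply: smoothn_cst.
- by apply: smoothnM => //; apply: smoothnM => //; apply: smoothn_cst.
- by apply: smoothnB; [exact: smoothn_cst|]; apply: smoothnM => //; apply: smoothn_cst.
Qed.

Lemma derive1_inv_stereo t : derive1 inv_stereo t =
  row3 (2 * derive1 x t / stereo_den t - 2 * x t * dstereo_den t / stereo_den t ^+ 2)
       (2 * derive1 y t / stereo_den t - 2 * y t * dstereo_den t / stereo_den t ^+ 2)
       (2 * dstereo_den t / stereo_den t ^+ 2).
Proof.
have dD := is_derive_inv (D0 t) (is_derive_stereo_den t).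
have d1 := is_derive_mul (is_derive_mul (is_derive_const t 2) (dx t)) dD.
have d2 := is_derive_mul (is_derive_mul (is_derive_const t 2) (dy t)) dD.
have d3 := is_derive_sub (is_derive_const t 1) (is_derive_mul (is_derive_const t 2) dD).
rewrite (derive1_row (f := fun i t => nth 0 [:: 2 * x t / stereo_den t; 2 * y t / stereo_den t; 1 - 2 / stereo_den t] i) _).2.
  apply/matrixP => i j; rewrite !mxE; case: j => [[|[|[|//]]] j3] /=.
  - by rewrite (is_derive_derive1 d1); field.
  - by rewrite (is_derive_derive1 d2); field.
  - by rewrite (is_derive_derive1 d3); field.
by move=> [[|[|[|//]]] j3] /=; [case: d1|case: d2|case: d3].
Qed.

Lemma inv_stereo_immersion t :
  (derive1 x t != 0) || (derive1 y t != 0) -> derive1 inv_stereo t != 0.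
Proof.
rewrite derive1_inv_stereo => H; apply/eqP => /matrixP e.
have := e 0 0; have := e 0 1; have := e 0 (lift 0 (lift 0 0)).
rewrite !mxE /= => ez ey ex; case/negP: H.
have d0 := D0 t; have dD : dstereo_den t = 0.
  move/eqP: ez; rewrite !mulf_eq0 invr_eq0 expf_eq0 (negbTE d0) pnatr_eq0 /= orbF.
  by move/eqP => H; rewrite /dstereo_den H mulr0.
move: ex ey; rewrite dD !mulr0 !mul0r !subr0 => /eqP ex /eqP ey.
by move: ex ey; rewrite !mulf_eq0 invr_eq0 (negbTE d0) pnatr_eq0 /= !orbF => -> ->.
Qed.

Lemma tangent_inv_stereo s t : x s = x t -> y s = y t ->
  derive1 inv_stereo t *m (inv_stereo s)^T = 0.
Proof.
move=> ex ey; apply/matrixP => i j; rewrite !ord1 !mxE sum3 derive1_inv_stereo !mxE /=.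
have := D0 t; rewrite /dstereo_den /stereo_den ex ey => d.
by field.
Qed.

Lemma inv_stereo_transverse s t : x s = x t -> y s = y t ->
  derive1 x s * derive1 y t - derive1 y s * derive1 x t != 0 ->
  (derive1 inv_stereo s + derive1 inv_stereo t == tangent_sphere2 (inv_stereo s))%MS.
Proof.
move=> ex ey d.
(* [C] is a left inverse of the differential of inverse stereographic projection at the common
   point, so it recovers the plane velocities. *)
pose C : 'M[R]_(3, 2) := \matrix_(i, j) nth 0 (nth [::]
  [:: [:: stereo_den t / 2; 0]; [:: 0; stereo_den t / 2];
      [:: x t * stereo_den t ^+ 2 / 4 * 2 / stereo_den t; y t * stereo_den t ^+ 2 / 4 * 2 / stereo_den t]] i) j.
have den : stereo_den s = stereo_den t by rewrite /stereo_den ex ey.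
have d0 := D0 t.
have HC r : x r = x t -> y r = y t ->
    (derive1 inv_stereo r *m C) 0 0 = derive1 x r /\ (derive1 inv_stereo r *m C) 0 1 = derive1 y r.
  move=> er er'; have denr : stereo_den r = stereo_den t by rewrite /stereo_den er er'.
  rewrite derive1_inv_stereo !mxE !sum3 !mxE /= denr er er'.
  by split; field.
apply: (@tangent_spanned _ _ _ C); try exact: tangent_inv_stereo.
  exact/sphere2_neq0/inv_stereo_sphere2.
have key (u1 v1 u2 v2 : R) : u1 = derive1 x s -> v1 = derive1 y s ->
    u2 = derive1 x t -> v2 = derive1 y t -> u1 * v2 - v1 * u2 != 0 by move=> -> -> -> ->.
have [h1 h2] := HC s ex ey; have [h3 h4] := HC t erefl erefl.
exact: key h1 h2 h3 h4.
Qed.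

End InverseStereographic.

(** * Words with two occurrences of each letter and the plane curves realizing them *)

Section Occurrences.
Local Open Scope nat_scope.
Variables (T : choiceType) (S : seq T) (z0 : T).
Hypothesis dS : double_occurrence_word S.

Definition occurrences (z : T) := [seq i <- iota 0 (size S) | nth z0 S i == z].

Lemma mem_occurrences z i : (i \in occurrences z) = (i < size S) && (nth z0 S i == z).
Proof. by rewrite mem_filter mem_iota /= add0n andbC. Qed.

Lemma size_occurrences z : z \in S -> size (occurrences z) = 2.
Proof.
move=> zS; have <- : count_mem z S = 2 by exact: dS.
rewrite size_filter -(count_map (nth z0 S) (pred1 z)).
by rewrite map_nth_iota0 // take_size.
Qed.

Lemma no_third_occurrence i j k : i < size S -> j < size S -> k < size S ->
  nth z0 S i = nth z0 S j -> nth z0 S i = nth z0 S k ->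
  [|| i == j, j == k | i == k].
Proof.
move=> iS jS kS ij ik; apply: contraT; rewrite !negb_or => /and3P[nij njk nik].
have := size_occurrences (mem_nth z0 iS).
suff : size [:: i; j; k] <= size (occurrences (nth z0 S i)) by move=> /= + H; rewrite H.
apply: uniq_leq_size; first by rewrite /= !inE negb_or nij nik njk.
by move=> l; rewrite !inE mem_occurrences => /or3P[] /eqP ->; rewrite ?iS ?jS ?kS -?ij -?ik eqxx.
Qed.

Lemma other_occurrence i : i < size S ->
  exists j, [/\ j < size S, j != i & nth z0 S j = nth z0 S i].
Proof.
move=> iS; have := size_occurrences (mem_nth z0 iS).
have := filter_uniq (fun j => nth z0 S j == nth z0 S i) (iota_uniq 0 (size S)).
have := mem_occurrences (nth z0 S i); rewrite -/(occurrences _).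
case: (occurrences _) => [|a [|b []]] // H /andP[]; rewrite inE => nab _ _.
have := H a; have := H b; rewrite !inE !eqxx orbT => /esym /andP[bS /eqP Sb] /esym /andP[aS /eqP Sa].
have [ai|nai] := eqVneq a i; last by exists a.
by exists b; split=> //; rewrite eq_sym -ai.
Qed.

End Occurrences.

Section Periodic.
Variables (R : realType) (V : Type) (f : R -> V).
Hypothesis f1 : forall t, f (t + 1) = f t.

Lemma periodic_nat t n : f (t + n%:R) = f t.
Proof. by elim: n => [|n IH]; rewrite ?addr0 // -natr1 addrA f1. Qed.

Lemma periodic_int t (m : int) : f (t + m%:~R) = f t.
Proof.
case: m => n; first exact: periodic_nat.
rewrite NegzE mulrNz -[LHS](periodic_nat _ n.+1); congr f.
by rewrite -addrA [X in _ + X]addNr addr0.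
Qed.

Definition frac_part (t : R) := t - (Num.floor t)%:~R.

Lemma frac_itv t : 0 <= frac_part t < 1.
Proof.
by have := Num.Theory.floor_itv t; rewrite /frac_part intrD; lra.
Qed.

Lemma periodic_frac t : f (frac_part t) = f t.
Proof. by rewrite /frac_part -mulrNz periodic_int. Qed.

Lemma same_circle_frac s t : frac_part s = frac_part t -> same_circle_point s t.
Proof.
rewrite /frac_part /same_circle_point => e; apply/intrP; exists (Num.floor s - Num.floor t).
by rewrite intrB; lra.
Qed.

End Periodic.

Section PlaneCurve.
Variables (R : realType) (T : choiceType) (S : seq T).
Hypothesis dS : double_occurrence_word S.
Variables (x y : R -> R) (ts : seq R).
Hypotheses (sx : forall n, smoothn n x) (sy : forall n, smoothn n y).
Hypotheses (x1 : forall t, x (t + 1) = x t) (y1 : forall t, y (t + 1) = y t).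
Hypothesis imm : forall t, (derive1 x t != 0) || (derive1 y t != 0).
Hypotheses (sorted_ts : sorted <%R ts) (size_ts : size ts = size S).
Hypothesis ts01 : forall t, t \in ts -> 0 < t < 1.
Hypothesis dbl : forall s t, 0 <= s < 1 -> 0 <= t < 1 ->
  x s = x t -> y s = y t -> s != t -> s \in ts.
Hypothesis coincide : forall z i j, (i < size S)%N -> (j < size S)%N ->
  (x (nth 0 ts i) = x (nth 0 ts j) /\ y (nth 0 ts i) = y (nth 0 ts j)) <->
  nth z S i = nth z S j.
Hypothesis transverse : forall z i j, (i < size S)%N -> (j < size S)%N -> i != j ->
  nth z S i = nth z S j ->
  derive1 x (nth 0 ts i) * derive1 y (nth 0 ts j) -
  derive1 y (nth 0 ts i) * derive1 x (nth 0 ts j) != 0.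

Let f := inv_stereo x y.

Let f1 t : f (t + 1) = f t.
Proof. by rewrite /f /inv_stereo /stereo_den x1 y1. Qed.

Let derive_frac (g : R -> R) (g1 : forall t, g (t + 1) = g t) (sg : smoothn 0 g) t :
  derive1 g (frac_part t) = derive1 g t.
Proof.
apply: periodic_frac => u.
have dg : is_derive (u + 1) 1 g (derive1 g (u + 1)).
  by rewrite derive1E; apply: derivableP; exact: smoothn_derivable sg.
have := @is_derive_compose R g (fun v => v + 1) u _ _ dg (is_derive_add (is_derive_var u) (is_derive_const u 1)).
rewrite (_ : (fun _ => _) = g); last by apply/funext => v; rewrite g1.
by rewrite addr0 mulr1 => /is_derive_derive1.
Qed.

Let f_coincide z i j : (i < size S)%N -> (j < size S)%N ->
  f (nth 0 ts i) = f (nth 0 ts j) <-> nth z S i = nth z S j.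
Proof.
move=> iS jS; rewrite -(coincide z iS jS); split; first exact: inv_stereo_inj.
by case=> ex ey; rewrite /f /inv_stereo /stereo_den ex ey.
Qed.

Let inhab t : t \in ts -> exists z : T, True.
Proof.
rewrite -index_mem size_ts; case: (S) => [|z s]; first by [].
by exists z.
Qed.

Let double_in s t : ~ same_circle_point s t -> f s = f t ->
  frac_part s \in ts /\ frac_part t \in ts.
Proof.
move=> nst; rewrite -(periodic_frac f1 s) -(periodic_frac f1 t) => /inv_stereo_inj [ex ey].
have nf : frac_part s != frac_part t by apply/eqP => /same_circle_frac.
by split; [apply: dbl ex ey nf|apply: dbl (esym ex) (esym ey) _; rewrite 1?eq_sym];
  rewrite ?frac_itv.
Qed.

(** All hypotheses concern parameters in one period; times are moved there by [frac_part], and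
    equality on the circle is equality of fractional parts. *)
Lemma realizable_of_plane_curve : realizable R S.
Proof.
have nsc i j : (i < size ts)%N -> (j < size ts)%N -> i != j ->
    ~ same_circle_point (nth 0 ts i) (nth 0 ts j).
  move=> iS jS nij /intrP[m em].
  have := ts01 (mem_nth 0 iS); have := ts01 (mem_nth 0 jS) => /andP[? ?] /andP[? ?].
  have m0 : m = 0.
    have h1 : m < 1 by rewrite -(ltr_int R) mulr1z; lra.
    have h2 : -1 < m by rewrite -(ltr_int R) mulrN1z; lra.
    lia.
  have /eqP := em; rewrite m0 subr_eq0 nth_uniq // ?(negbTE nij) //.
  exact: sorted_uniq lt_trans (@ltxx _ _) _ sorted_ts.
have dblp p : double_points f p -> exists2 i, (i < size ts)%N & p = f (nth 0 ts i).
  case=> s [t [nst <- ft]]; have [sts _] := double_in nst (esym ft).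
  by exists (index (frac_part s) ts); rewrite ?index_mem // nth_index // (periodic_frac f1).
have dbli i : (i < size ts)%N -> double_points f (f (nth 0 ts i)).
  move=> iS; have [z _] := inhab (mem_nth 0 iS).
  rewrite size_ts in iS; have [j [jS nji e]] := other_occurrence z dS iS.
  exists (nth 0 ts i), (nth 0 ts j); split=> //; last by apply/(f_coincide z).
  by apply: nsc; rewrite ?size_ts // eq_sym.
exists f; split.
  split.
  - split=> //; first exact: inv_stereo_sphere2.
      exact: smooth_inv_stereo.
    by move=> t; apply: inv_stereo_immersion.
  - apply: (@sub_finite_set _ _ [set f t | t in [set` ts]]).
      move=> p /dblp [i iS ->]; exists (nth 0 ts i) => //=; exact: mem_nth.
    by apply: finite_image; exact: finite_seq.
  - move=> r s t ers est.
    have [|nrs] := EM (same_circle_point r s); first by constructor 1.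
    have [|nst] := EM (same_circle_point s t); first by constructor 2.
    have [|nrt] := EM (same_circle_point r t); first by constructor 3.
    have [rts sts] := double_in nrs ers; have [_ tts] := double_in nst est.
    have [z _] := inhab rts.
    have H a b : frac_part a \in ts -> frac_part b \in ts -> f a = f b ->
        nth z S (index (frac_part a) ts) = nth z S (index (frac_part b) ts).
      move=> ats bts eab; apply/f_coincide; rewrite -?size_ts ?index_mem //.
      by rewrite !nth_index // !(periodic_frac f1).
    have Ha a : frac_part a \in ts -> (index (frac_part a) ts < size S)%N by rewrite -index_mem size_ts.
    have := no_third_occurrence (z0 := z) dS (Ha _ rts) (Ha _ sts) (Ha _ tts) (H _ _ rts sts ers) (H _ _ rts tts (etrans ers est)).
    have K a b : frac_part a \in ts -> index (frac_part a) ts == index (frac_part b) ts -> same_circle_point a b.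
      move=> ats /eqP e; apply: same_circle_frac.
      have bts : frac_part b \in ts by rewrite -index_mem -e index_mem.
      by rewrite -(nth_index 0 ats) e nth_index.
    by case/or3P => /K; [move/(_ rts)|move/(_ sts)|move/(_ rts)].
  - move=> s t nst est; have [sts tts] := double_in nst est.
    have [z _] := inhab sts.
    have [ex ey] := inv_stereo_inj est.
    apply: inv_stereo_transverse => //.
    rewrite -(derive_frac x1 (sx 0%N) s) -(derive_frac x1 (sx 0%N) t) -(derive_frac y1 (sy 0%N) s) -(derive_frac y1 (sy 0) t).
    rewrite -[frac_part s](nth_index 0 sts) -[frac_part t](nth_index 0 tts).
    apply: (transverse (z := z)); rewrite -?size_ts ?index_mem //.
      apply: contra_not_neq nst => e; apply: same_circle_frac.
      by rewrite -(nth_index 0 sts) e nth_index.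
    apply/f_coincide; rewrite -?size_ts ?index_mem // !nth_index //.
    by rewrite !(periodic_frac f1).
have gE t : f (0 + (-1) ^+ false * t) = f t by rewrite add0r expr0 mul1r.
(* A letter labels the point met at its first occurrence. *)
exists 0, false, ts, (fun z => f (nth 0 ts (index z S))); split=> //.
- rewrite gE => -[s [t [nst fs ft]]].
  have [sts tts] := double_in nst (etrans fs (esym ft)).
  have H a : frac_part a \in ts -> f a = f 0 -> 0 \in ts.
    move=> ats; rewrite -(periodic_frac f1 a) => /esym/inv_stereo_inj[ex ey].
    apply: dbl ex ey _; rewrite ?lexx ?ltr01 ?frac_itv //.
    by have /andP[a0 _] := ts01 ats; rewrite lt_eqF.
  by have := ts01 (H s sts fs); rewrite ltxx.
- move=> t; rewrite gE; split=> [tts|[t01 [s [r [nsr fs fr]]]]].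
    split; first exact: ts01.
    by rewrite -(nth_index 0 tts); apply: dbli; rewrite index_mem.
  have [|/eqP nst] := EM (frac_part s = t).
    by move=> <-; have [] := double_in nsr (etrans fs (esym fr)).
  have /inv_stereo_inj[ex ey] : f t = f (frac_part s) by rewrite (periodic_frac f1).
  by apply: dbl ex ey _; rewrite ?frac_itv 1?eq_sym //; lra.
- move=> z w zS wS /f_coincide; rewrite !index_mem => /(_ z zS wS).
  by rewrite !nth_index.
case: (S) size_ts f_coincide => [|z s] sz fc.
  by case: (ts) sz.
apply: (@eq_from_nth _ 0); rewrite ?size_map // => i iS.
rewrite (nth_map z) // (nth_map 0) ?sz // gE; apply/(fc z) => //.
  by rewrite index_mem mem_nth.
by rewrite nth_index // mem_nth.
Qed.

End PlaneCurve.

(** * Polygons and the rounding of their corners *)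

Section Corners.
Variable R : realType.
Implicit Types (p : int -> R) (k : int) (s t : R).

Definition side p k := p (k + 1) - p k.

(** Time relative to vertex [k] is split into [u - r u], spent on the side before, and [r u], spent
    on the side after. With [pos_part] for [r] this is the polygon, with [ramp e] the rounded
    polygon, so both share their lemmas. *)
Definition corner (r : R -> R) p k (u : R) :=
  p k + (u - r u) * side p (k - 1) + r u * side p k.

Definition nearest t : int := Num.floor (t + 2^-1).

Definition rounded r p t := corner r p (nearest t) (t - (nearest t)%:~R).

Definition pos_part (u : R) := Num.max u 0.

Definition polygon := rounded pos_part.

Definition ramp_like e (r : R -> R) :=
  (forall u, u <= - e -> r u = 0) /\ (forall u, e <= u -> r u = u).

Lemma nearestP t : (nearest t)%:~R - 2^-1 <= t < (nearest t)%:~R + 2^-1.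
Proof. by rewrite /nearest; have := Num.Theory.floor_itv (t + 2^-1); rewrite intrD; lra. Qed.

Lemma ramp_like_ramp e : 0 < e -> ramp_like e (ramp e).
Proof. by move=> e0; split=> u ue; [apply: ramp_le|apply: ramp_ge]. Qed.

Lemma ramp_like_pos e : 0 <= e -> ramp_like e pos_part.
Proof.
by move=> e0; split=> u ue; [apply: max_r|apply: max_l]; lra.
Qed.

Lemma intr_between (a b : int) : (a%:~R : R) < b%:~R + 1 -> (b%:~R : R) < a%:~R + 1 -> a = b.
Proof.
move=> ab ba; have h1 : a < b + 1 by rewrite -(ltr_int R) intrD mulr1z.
have h2 : b < a + 1 by rewrite -(ltr_int R) intrD mulr1z.
by lia.
Qed.

(** The formulas at two neighbouring vertices agree on the middle of the edge between them, so each
    is valid well beyond the times nearest to its vertex. *)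
Lemma rounded_corner e r p k t : ramp_like e r -> 0 <= e -> e <= 4^-1 ->
  k%:~R - 1 + e <= t <= k%:~R + 1 - e -> rounded r p t = corner r p k (t - k%:~R).
Proof.
move=> [r0 r1] e0 e4 /andP[t1 t2]; have := nearestP t; rewrite /rounded.
set n := nearest t => /andP[n1 n2].
have [en|nen] := eqVneq n k; first by rewrite en.
have [ltnk|ltkn] : n = k - 1 \/ n = k + 1.
- have [nk|nk] := leP n k.
    left; apply: intr_between; rewrite intrB mulr1z.
      have : (n + 1 <= k) by lia.
      rewrite -(ler_int R) intrD mulr1z; lra.
    lra.
  right; apply: intr_between; rewrite intrD mulr1z; last first.
    have : (k + 1 <= n) by lia.
    rewrite -(ler_int R) intrD mulr1z; lra.
  lra.
- rewrite ltnk /corner intrB mulr1z in n1 n2 *.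
  rewrite (r1 (t - _)); last lra.
  rewrite (r0 (t - k%:~R)); last lra.
  by rewrite /side !subrK; ring.
rewrite ltkn /corner intrD mulr1z in n1 n2 *.
rewrite (r0 (t - _)); last lra.
rewrite (r1 (t - k%:~R)); last lra.
by rewrite /side !addrK; ring.
Qed.

Lemma rounded_edge e r p k t : ramp_like e r -> 0 <= e -> e <= 4^-1 ->
  k%:~R + e <= t <= k%:~R + 1 - e -> rounded r p t = p k + (t - k%:~R) * side p k.
Proof.
move=> rr e0 e4 tk; rewrite (rounded_corner (k := k) _ rr) //; last lra.
by rewrite /corner rr.2; [ring|lra].
Qed.

Lemma polygon_edge p k t : k%:~R <= t <= k%:~R + 1 ->
  polygon p t = p k + (t - k%:~R) * side p k.
Proof.
by move=> tk; apply: rounded_edge (ramp_like_pos (lexx 0)) _ _ _; lra.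
Qed.

Lemma rounded_periodic r p (m : int) t : (forall k, p (k + m) = p k) ->
  rounded r p (t + m%:~R) = rounded r p t.
Proof.
move=> pm; have en : nearest (t + m%:~R) = nearest t + m.
  by have := nearestP t; have := nearestP (t + m%:~R) => *; apply: intr_between; rewrite intrD; lra.
rewrite /rounded en intrD opprD addrACA subrr addr0.
have sm k : side p (k + m) = side p k by rewrite /side addrAC !pm.
by rewrite /corner pm sm [nearest t + m - 1]addrAC sm.
Qed.

Lemma smooth_rounded e p n : 0 < e -> e <= 4^-1 -> smoothn n (rounded (ramp e) p).
Proof.
move=> e0 e4; apply: smoothn_local => t.
exists (fun s => corner (ramp e) p (nearest t) (s - (nearest t)%:~R)).
  have si : smoothn n (fun s : R => s - (nearest t)%:~R).
    by apply: smoothnB; [exact: smoothn_id|exact: smoothn_cst].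
  have sr := smoothn_comp si (smoothn_ramp n e).
  apply: smoothnD; [apply: smoothnD; [exact: smoothn_cst|]|];
    (apply: smoothnM; last exact: smoothn_cst) => //.
  exact: smoothnB.
have := nearestP t => /andP[t1 t2].
near=> s; apply: (rounded_corner _ (ramp_like_ramp e0) (ltW e0) e4).
apply/andP; split; near: s; [apply: lt_le_nbhsr|apply: lt_le_nbhsl]; lra.
Unshelve. all: by end_near. Qed.

Lemma derive_rounded e p t : 0 < e -> e <= 4^-1 ->
  derive1 (rounded (ramp e) p) t = side p (nearest t - 1) +
    derive1 (ramp e) (t - (nearest t)%:~R) * (side p (nearest t) - side p (nearest t - 1)).
Proof.
move=> e0 e4; set n := nearest t.
apply: is_derive_derive1.
apply: (near_eq_is_derive (f := fun s => corner (ramp e) p n (s - n%:~R))).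
  have := nearestP t => /andP[t1 t2].
  near=> s; apply/esym; apply: (rounded_corner _ (ramp_like_ramp e0) (ltW e0) e4).
  apply/andP; split; near: s; [apply: lt_le_nbhsr|apply: lt_le_nbhsl]; rewrite /n; lra.
have di := is_derive_sub (is_derive_var t) (is_derive_const t n%:~R).
have dr : is_derive (t - n%:~R) 1 (ramp e) (derive1 (ramp e) (t - n%:~R)).
  by rewrite derive1E; apply: derivableP; exact: smoothn_derivable (smoothn_ramp 0 e).
have dri := @is_derive_compose R (ramp e) (fun s => s - n%:~R) t _ _ dr di.
have := is_derive_add (is_derive_add (is_derive_const t (p n))
  (is_derive_mul (is_derive_sub di dri) (is_derive_const t (side p (n - 1)))))
  (is_derive_mul dri (is_derive_const t (side p n))).
by congr is_derive; ring.
Unshelve. all: by end_near. Qed.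

Lemma derive_rounded_edge e p k t : 0 < e -> e <= 4^-1 ->
  k%:~R + e < t < k%:~R + 1 - e -> derive1 (rounded (ramp e) p) t = side p k.
Proof.
move=> e0 e4 /andP[t1 t2]; apply: is_derive_derive1.
apply: (near_eq_is_derive (f := fun s => p k + (s - k%:~R) * side p k)).
  near=> s; apply/esym; apply: (rounded_edge _ (ramp_like_ramp e0) (ltW e0) e4).
  by apply/andP; split; near: s; [apply: lt_le_nbhsr|apply: lt_le_nbhsl].
have := is_derive_add (is_derive_const t (p k)) (is_derive_mul
  (is_derive_sub (is_derive_var t) (is_derive_const t k%:~R)) (is_derive_const t (side p k))).
by congr is_derive; ring.
Unshelve. all: by end_near. Qed.

Lemma rounded_dist e p t C : 0 < e -> (forall k, `|side p k - side p (k - 1)| <= C) ->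
  `|rounded (ramp e) p t - polygon p t| <= e * C.
Proof.
move=> e0 pC; rewrite /polygon /rounded /corner /pos_part.
set n := nearest t; set u := t - _.
rewrite [X in `|X|](_ : _ = (ramp e u - Num.max u 0) * (side p n - side p (n - 1))); last by ring.
by rewrite normrM ler_pM // ramp_dist.
Qed.

Lemma continuous_polygon p : continuous (polygon p).
Proof.
move=> t; set n := nearest t.
have e : \forall s \near t, corner pos_part p n (s - n%:~R) = polygon p s.
  have := nearestP t => /andP[t1 t2].
  near=> s; apply/esym; apply: (rounded_corner _ (ramp_like_pos (lexx 0)) (lexx 0)); first lra.
  by apply/andP; split; near: s; [apply: lt_le_nbhsr|apply: lt_le_nbhsl]; rewrite /n; lra.
have en : polygon p t = corner pos_part p n (t - n%:~R) by apply/esym/(nbhs_singleton e).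
rewrite /continuous_at en; apply: cvg_trans (near_eq_cvg e) _.
have cu : (fun s => s - n%:~R) s @[s --> t] --> t - n%:~R.
  by apply: cvgB; [exact: cvg_id|exact: cvg_cst].
have cp : pos_part (s - n%:~R) @[s --> t] --> pos_part (t - n%:~R).
  apply: (cvg_comp _ _ cu); rewrite /pos_part; exact: (continuous_max (cvg_id) (cvg_cst _)).
apply: cvgD; [apply: cvgD; [exact: cvg_cst|]|]; (apply: cvgM; last exact: cvg_cst) => //.
exact: cvgB.
Unshelve. all: by end_near. Qed.

(** When the two sides are independent, the point determines its coefficients [u - r u] and [r u],
    hence their sum. *)
Lemma corner_inj r (px py : int -> R) k u v :
  side px (k - 1) * side py k - side py (k - 1) * side px k != 0 ->
  corner r px k u = corner r px k v -> corner r py k u = corner r py k v -> u = v.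
Proof.
rewrite /corner; set a := side px _; set b := side py k; set c := side py _; set d := side px k.
move=> det ex ey.
have e1 : (u - r u - (v - r v)) * (a * b - c * d) = 0.
  have -> : (u - r u - (v - r v)) * (a * b - c * d) =
    ((px k + (u - r u) * a + r u * d) - (px k + (v - r v) * a + r v * d)) * b -
    ((py k + (u - r u) * c + r u * b) - (py k + (v - r v) * c + r v * b)) * d by ring.
  by rewrite ex ey !subrr !mul0r subr0.
have e2 : (r u - r v) * (a * b - c * d) = 0.
  have -> : (r u - r v) * (a * b - c * d) =
    ((py k + (u - r u) * c + r u * b) - (py k + (v - r v) * c + r v * b)) * a -
    ((px k + (u - r u) * a + r u * d) - (px k + (v - r v) * a + r v * d)) * c by ring.
  by rewrite ex ey !subrr !mul0r subr0.
move/eqP: e1; move/eqP: e2; rewrite !mulf_eq0 (negbTE det) !orbF => /eqP e2 /eqP e1.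
by lra.
Qed.

End Corners.

(** * Rounding creates no crossing and destroys none *)

Section Smoothing.
Variables (R : realType) (px py : int -> R) (m : nat).
Hypothesis m_gt0 : (0 < m)%N.
Hypotheses (pxm : forall k : int, px (k + m%:Z) = px k) (pym : forall k : int, py (k + m%:Z) = py k).
Hypothesis det_corner : forall k,
  side px (k - 1) * side py k - side py (k - 1) * side px k != 0.

Definition congruent (s t : R) := exists z : int, s - t = z%:~R * m%:R.
Definition edge_interior (t : R) (k : int) := k%:~R < t < k%:~R + 1.

Hypothesis crossing : forall s t, polygon px s = polygon px t ->
  polygon py s = polygon py t ->
  congruent s t \/
  (exists k, edge_interior s k) /\ (exists k, edge_interior t k).

Lemma int_periodic (V : Type) (q : int -> V) : (forall k : int, q (k + m%:Z) = q k) ->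
  forall k z : int, q (k + z * m) = q k.
Proof.
move=> qm k; have H (n : nat) k' : q (k' + n%:Z * m) = q k'.
  elim: n k' => [|n IH] k'; first by rewrite mul0r addr0.
  by rewrite intS mulrDl mul1r addrA IH.
case=> n; first exact: H.
by rewrite NegzE mulNr -[LHS](H n.+1) subrK.
Qed.

Lemma int_periodic_bounded (q : int -> R) : (forall k : int, q (k + m%:Z) = q k) ->
  exists C, forall k, `|q k| <= C.
Proof.
move=> qm; exists (\sum_(i < m) `|q i|) => k.
have m0 : (m : int) != 0 by lia.
have mp : 0 < (m : int) by lia.
have := modz_ge0 k m0; have := ltz_pmod k mp.
rewrite [in q _](divz_eq k m) addrC int_periodic //.
case: (k %% m)%Z => // i; rewrite ltz_nat => im _.
by rewrite (bigD1 (Ordinal im)) //= lerDl sumr_ge0.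
Qed.

Lemma near_box (s t d h : R) (P : R -> R * R -> Prop) : 0 < d -> 0 < h ->
  (forall s' t' e, `|s' - s| < d -> `|t' - t| < d -> 0 < e < h -> P e (s', t')) ->
  \forall x \near (s, t) & e \near 0^'+, P e x.
Proof.
move=> d0 h0 H; exists ([set x | `|x.1 - s| < d /\ `|x.2 - t| < d], [set e | 0 < e < h]).
  split=> /=.
    exists (ball s d, ball t d); first by split; exact: nbhsx_ballx.
    by move=> [a b] [/= ad bd]; rewrite /ball /= in ad bd; rewrite ![`|_ - s|]distrC ![`|_ - t|]distrC.
  by near=> e; apply/andP; split; near: e; [exact: nbhs_right_gt|exact: nbhs_right_lt].
by move=> [[a b] e] [[/= ad bd] e0]; apply: H.
Unshelve. all: by end_near. Qed.

(** Two times closer than 1/4 fall under the formula of one corner: the first is within 1/2 of its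
    vertex, the second within 3/4, which is less than [1 - e]. *)
Lemma rounded_local_inj e r s t : ramp_like e r -> 0 <= e -> e <= 8^-1 ->
  `|s - t| < 4^-1 -> rounded r px s = rounded r px t ->
  rounded r py s = rounded r py t -> s = t.
Proof.
move=> rr e0 e8 st; have := nearestP s => ns.
have e4 : e <= 4^-1 by lra.
have stE : s - 4^-1 < t < s + 4^-1 by rewrite ltr_norml in st; lra.
have cs p : rounded r p s = corner r p (nearest s) (s - (nearest s)%:~R).
  by apply: (rounded_corner _ rr e0 e4); lra.
have ct p : rounded r p t = corner r p (nearest s) (t - (nearest s)%:~R).
  by apply: (rounded_corner _ rr e0 e4); lra.
by rewrite !cs !ct => ex ey; have := corner_inj (det_corner _) ex ey; lra.
Qed.

Definition smoothing_ok (e : R) (st : R * R) :=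
  let X := rounded (ramp e) px in let Y := rounded (ramp e) py in
  (X st.1 = X st.2 -> Y st.1 = Y st.2 ->
    polygon px st.1 = polygon px st.2 /\ polygon py st.1 = polygon py st.2) /\
  (polygon px st.1 = polygon px st.2 -> polygon py st.1 = polygon py st.2 ->
    congruent st.1 st.2 \/ forall t, t = st.1 \/ t = st.2 ->
    [/\ X t = polygon px t, Y t = polygon py t & exists k, [/\ edge_interior t k,
      derive1 X t = side px k & derive1 Y t = side py k]]).

Let far_ok (p : int -> R) (s t : R) : (forall k : int, p (k + m%:Z) = p k) -> polygon p s != polygon p t ->
  exists d h, [/\ 0 < d, 0 < h & forall s' t' e,
    `|s' - s| < d -> `|t' - t| < d -> 0 < e < h ->
    rounded (ramp e) p s' <> rounded (ramp e) p t' /\ polygon p s' <> polygon p t'].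
Proof.
move=> pm; rewrite -subr_eq0 -normr_gt0; set D := `|_| => D0.
have [C HC] : exists C, forall k, `|side p k - side p (k - 1)| <= C.
  have sm k : side p (k + m%:Z) = side p k by rewrite /side addrAC !pm.
  by apply: int_periodic_bounded => k; rewrite sm [k + _ - 1]addrAC sm.
have C0 : 0 <= C by apply: le_trans (HC 0).
have D8 : 0 < D / 8 by lra.
have /cvgrPdist_lt /(_ _ D8) /nbhs_ballP[d1 /= d10 Hd1] := @continuous_polygon R p s.
have /cvgrPdist_lt /(_ _ D8) /nbhs_ballP[d2 /= d20 Hd2] := @continuous_polygon R p t.
(* At each of the two times the polygon moves by less than [D / 8] and the rounding displaces it by
   at most [e * C], again less than [D / 8]; together this is below [D]. *)
exists (Num.min d1 d2), (D / 8 / (C + 1)); split; first by rewrite lt_min d10.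
  by rewrite divr_gt0 //; lra.
move=> s' t' e; rewrite !lt_min => /andP[sd _] /andP[_ td] /andP[e0 eh].
have h1 := Hd1 s'; have h2 := Hd2 t'; rewrite /ball /= in h1 h2.
rewrite distrC in sd; rewrite distrC in td; have {}h1 := h1 sd; have {}h2 := h2 td.
have eC : e * C < D / 8.
  by rewrite ltr_pdivlMr in eh; lra.
have r1 := rounded_dist s' e0 HC; have r2 := rounded_dist t' e0 HC.
move: h1 h2 r1 r2 D0 eC D8; rewrite /D {D eh Hd1 Hd2}.
move: (polygon p s) (polygon p t) (polygon p s') (polygon p t') (rounded _ p s') (rounded _ p t') => a b a' b' x y.
rewrite !ltr_norml !ler_norml => h1 h2 r1 r2 D0 eC D8.
have [ab|ab] := lerP 0 (a - b).
  by rewrite (ger0_norm ab) in h1 h2 D0 eC D8; split=> E; lra.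
by rewrite (ltr0_norm ab) in h1 h2 D0 eC D8; split=> E; lra.
Qed.

(** Three cases: distinct images stay distinct; congruent times reduce to local injectivity after a
    shift by a period; at a genuine crossing both times lie inside edges, where a small rounding
    changes nothing. *)
Let near_ok (s t : R) : \forall x \near (s, t) & e \near 0^'+, smoothing_ok e x.
Proof.
have [xst|/(far_ok pxm) [d [h [d0 h0 H]]]] := eqVneq (polygon px s) (polygon px t); last first.
  apply: (near_box d0 h0) => s' t' e ds dt e0; have [H1 H2] := H s' t' e ds dt e0.
  by split=> /= ex ey.
have [yst|/(far_ok pym) [d [h [d0 h0 H]]]] := eqVneq (polygon py s) (polygon py t); last first.
  apply: (near_box d0 h0) => s' t' e ds dt e0; have [H1 H2] := H s' t' e ds dt e0.
  by split=> /= ex ey.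
have [[z ez]|[[k ks] [l lt]]] := crossing xst yst.
  apply: (@near_box _ _ (8^-1) (8^-1)); [lra|lra|] => s' t' e ds dt /andP[e0 e8].
  have per p (pm : forall k : int, p (k + m%:Z) = p k) r : rounded r p t' = rounded r p (t' + z%:~R * m%:R).
    rewrite -[m%:R]/((m : int)%:~R) -intrM rounded_periodic // => k; exact: int_periodic.
  have dist : `|s' - (t' + z%:~R * m%:R)| < 4^-1.
    by rewrite -ez; move: ds dt; rewrite !ltr_norml; lra.
  have cong : s' = t' + z%:~R * m%:R -> congruent s' t' by exists z; lra.
  split=> /= ex ey.
    rewrite per // in ex; rewrite [RHS]per // in ey.
    have E := rounded_local_inj (ramp_like_ramp e0) (ltW e0) (ltW e8) dist ex ey.
    by rewrite /polygon [RHS]per // [in X in _ /\ X]per // E.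
  rewrite /polygon per // in ex; rewrite /polygon [RHS]per // in ey.
  left; apply: cong.
  by apply: (rounded_local_inj (ramp_like_pos (lexx 0)) _ _ dist ex ey); lra.
have room (u : R) j : edge_interior u j -> exists d, [/\ 0 < d, d <= 4^-1 &
    forall u' e, `|u' - u| < d -> 0 < e < d -> j%:~R + e < u' < j%:~R + 1 - e].
  move=> /andP[u1 u2]; exists (Num.min (4^-1) (Num.min ((u - j%:~R) / 2) ((j%:~R + 1 - u) / 2))).
  split; first by rewrite !lt_min; lra.
    by rewrite ge_min lexx.
  move=> u' e; rewrite !lt_min !ltr_norml => /and3P[_ /andP[a1 a2] /andP[a3 a4]].
  move=> /andP[e0 /and3P[_ e1 e2]]; apply/andP; split; lra.
have [d1 [d10 d14 H1]] := room s k ks; have [d2 [d20 d24 H2]] := room t l lt.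
apply: (@near_box _ _ (Num.min d1 d2) (Num.min d1 d2)); rewrite ?lt_min ?d10 //.
move=> s' t' e; rewrite !lt_min => /andP[ds _] /andP[_ dt] /andP[e0 /andP[e1 e2]].
have {}H1 := H1 s' e ds; have {}H2 := H2 t' e dt; rewrite e0 e1 in H1; rewrite e0 e2 in H2.
have {}H1 := H1 isT; have {}H2 := H2 isT.
have e4 : e <= 4^-1 by lra.
have eqr p u j : j%:~R + e < u < j%:~R + 1 - e -> rounded (ramp e) p u = polygon p u.
  move=> uj; rewrite (rounded_edge (k := j) _ (ramp_like_ramp e0) (ltW e0) e4); last lra.
  by rewrite (@polygon_edge R p j u) //; lra.
split=> /= ex ey.
  by rewrite -(eqr px s' k) // -(eqr px t' l) // -(eqr py s' k) // -(eqr py t' l).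
right=> u [->|->].
  split; [exact: eqr H1|exact: eqr H1|exists k; split].
  - by rewrite /edge_interior; lra.
  - exact: derive_rounded_edge.
  - exact: derive_rounded_edge.
split; [exact: eqr H2|exact: eqr H2|exists l; split].
- by rewrite /edge_interior; lra.
- exact: derive_rounded_edge.
- exact: derive_rounded_edge.
Qed.

(** Compactness of the square of pairs of times turns the local statements [near_ok] into a single
    radius [e] valid for all pairs. *)
Theorem smooth_polygon : exists X Y : R -> R,
  [/\ (forall n, smoothn n X) /\ (forall n, smoothn n Y),
      (forall t, X (t + m%:R) = X t) /\ (forall t, Y (t + m%:R) = Y t),
      forall t, (derive1 X t != 0) || (derive1 Y t != 0),
      forall s t, 0 <= s <= m%:R -> 0 <= t <= m%:R -> X s = X t -> Y s = Y t ->
        polygon px s = polygon px t /\ polygon py s = polygon py t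
    & forall s t, 0 <= s <= m%:R -> 0 <= t <= m%:R ->
        polygon px s = polygon px t -> polygon py s = polygon py t ->
        congruent s t \/ forall u, u = s \/ u = t ->
        [/\ X u = polygon px u, Y u = polygon py u & exists k, [/\ edge_interior u k,
          derive1 X u = side px k & derive1 Y u = side py k]]].
Proof.
have cK : compact (`[0, m%:R] `*` `[0, m%:R] : set (R * R)).
  by apply: compact_setX; exact: segment_compact.
have /compact_near_coveringP cov := cK.
have {cov} : \forall e \near (0 : R)^'+, (`[0, m%:R] `*` `[0, m%:R] : set (R * R)) `<=` smoothing_ok e.
  by apply: cov => -[s t] _; exact: near_ok.
move=> Hcov; have : \forall e \near (0 : R)^'+, exists e, [/\ 0 < e, e <= 4^-1 &
    (`[0, m%:R] `*` `[0, m%:R] : set (R * R)) `<=` smoothing_ok e].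
  near=> e; exists e; split; near: e; [exact: nbhs_right_gt|apply: nbhs_right_le; lra|exact: Hcov].
move=> /filter_ex[_ [e [e0 e4 He]]].
have inK s t : 0 <= s <= m%:R -> 0 <= t <= m%:R -> smoothing_ok e (s, t).
  by move=> sm tm; apply: He; split; rewrite /= in_itv.
exists (rounded (ramp e) px), (rounded (ramp e) py); split.
- by split=> n; exact: smooth_rounded.
- by split=> t; rewrite -[m%:R]/((m : int)%:~R) rounded_periodic.
(* The velocity is an affine combination of two consecutive sides; its vanishing would make them
   dependent. *)
- move=> t; rewrite !derive_rounded //; set n := nearest t; set c := derive1 _ _.
  have D := det_corner n; apply: contraNT D; rewrite negb_or !negbK => /andP[/eqP ex /eqP ey].
  apply/eqP; have -> : side px (n - 1) * side py n - side py (n - 1) * side px n =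
    (side px (n - 1) + c * (side px n - side px (n - 1))) * (side py n - side py (n - 1)) -
    (side py (n - 1) + c * (side py n - side py (n - 1))) * (side px n - side px (n - 1)) by ring.
  by rewrite ex ey !mul0r subrr.
- by move=> s t sm tm; apply: (inK s t sm tm).1.
- by move=> s t sm tm; apply: (inK s t sm tm).2.
Unshelve. all: by end_near. Qed.

End Smoothing.

(** * The closed polygon made of tents over a line *)

Section Tents.
Variables (R : realType) (N : nat) (A B : nat -> nat) (up : nat -> bool).
Hypothesis A_inj : forall k l, (k <= N)%N -> (l <= N)%N -> A k = A l -> k = l.
Hypothesis B_inj : forall k l, (k <= N)%N -> (l <= N)%N -> B k = B l -> k = l.
Hypothesis A_neq_B : forall k l, (k <= N)%N -> (l <= N)%N -> A k != B l.

Definition previous k := if k is k'.+1 then k' else N.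
Hypothesis baseline : forall k, (k <= N)%N -> baseline_step (B (previous k)) (A k).

Lemma previous_le k : (k <= N)%N -> (previous k <= N)%N.
Proof. by case: k => //= k /ltnW. Qed.

Definition a k : R := (A k)%:R.
Definition b k : R := (B k)%:R.
Definition sg k : R := if up k then 1 else -1.
Definition half k : R := (b k - a k) / 2.

Lemma half_neq0 k : (k <= N)%N -> half k != 0.
Proof.
move=> kN; rewrite /half mulf_neq0 ?invr_eq0 ?pnatr_eq0 // subr_eq0 /a /b eqr_nat.
by rewrite eq_sym A_neq_B.
Qed.

(** Three vertices for each index [k]: the start of the step along the line, the foot [A k] of the
    tent and its apex. The second foot [B k] is the first vertex of the next index, and [previous]
    makes this cyclic. Both legs have slope 1 or -1. *)
Definition vertex (j : nat) : R * R :=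
  let k := (j %/ 3)%N in
  match (j %% 3)%N with
  | 0 => (b (previous k), 0)
  | 1 => (a k, 0)
  | _ => (a k + half k, sg k * `|half k|)
  end.

Definition period := (3 * N.+1)%N.

Definition vertex_x (e : int) := (vertex `|(e %% period)%Z|%N).1.
Definition vertex_y (e : int) := (vertex `|(e %% period)%Z|%N).2.

Lemma vertex3 k : [/\ vertex (3 * k) = (b (previous k), 0), vertex (3 * k + 1) = (a k, 0) &
  vertex (3 * k + 2) = (a k + half k, sg k * `|half k|)].
Proof.
rewrite /vertex mulnC; split; rewrite ?modnMDl ?divnMDl ?modnMl ?mulnK //= ?addn0 //.
Qed.

Lemma vertex_period : vertex period = vertex 0.
Proof. by have [-> _ _] := vertex3 N.+1; have [] := vertex3 0. Qed.

Lemma vertex_x_periodic k : vertex_x (k + period%:Z) = vertex_x k.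
Proof. by rewrite /vertex_x modzDr. Qed.
Lemma vertex_y_periodic k : vertex_y (k + period%:Z) = vertex_y k.
Proof. by rewrite /vertex_y modzDr. Qed.

Lemma side_vertex (j : nat) (e : int) : (j < period)%N -> (e %% period)%Z = j ->
  side vertex_x e = (vertex j.+1).1 - (vertex j).1 /\
  side vertex_y e = (vertex j.+1).2 - (vertex j).2.
Proof.
move=> jm ej; rewrite /side /vertex_x /vertex_y ej /=.
have -> : ((e + 1) %% period)%Z = (j.+1 %% period)%N.
  by rewrite -modzDml ej -PoszD addn1 modz_nat.
have [e1|ne1] := eqVneq j.+1 period; first by rewrite e1 modnn /= vertex_period.
by rewrite modn_small //= ltn_neqAle ne1.
Qed.

Lemma side_base k : (k <= N)%N ->
  side vertex_x (3 * k)%N = a k - b (previous k) /\ side vertex_y (3 * k)%N = 0.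
Proof.
move=> kN; have jm : (3 * k < period)%N by rewrite ltn_mul2l.
have [|-> ->] := @side_vertex (3 * k) (3 * k)%N jm; first by rewrite modz_nat modn_small.
by rewrite -addn1; have [-> -> _] := vertex3 k; rewrite subrr.
Qed.

Lemma side_up k : (k <= N)%N ->
  side vertex_x (3 * k + 1)%N = half k /\ side vertex_y (3 * k + 1)%N = sg k * `|half k|.
Proof.
move=> kN; have jm : (3 * k + 1 < period)%N by rewrite /period; lia.
have [|-> ->] := @side_vertex (3 * k + 1) (3 * k + 1)%N jm; first by rewrite modz_nat modn_small.
rewrite -addnS; have [_ -> ->] := vertex3 k; rewrite subr0 /=; split=> //.
by rewrite addrAC subrr add0r.
Qed.

Lemma side_down k : (k <= N)%N ->
  side vertex_x (3 * k + 2)%N = half k /\ side vertex_y (3 * k + 2)%N = - (sg k * `|half k|).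
Proof.
move=> kN; have jm : (3 * k + 2 < period)%N by rewrite /period; lia.
have [|-> ->] := @side_vertex (3 * k + 2) (3 * k + 2)%N jm; first by rewrite modz_nat modn_small.
rewrite -addnS (_ : 3 * k + 3 = 3 * k.+1)%N; last lia.
have [-> _ _] := vertex3 k.+1; have [_ _ ->] := vertex3 k.
by rewrite /= sub0r; split=> //; rewrite /half; field.
Qed.

Lemma vertex_base k : (k <= N)%N -> vertex_x (3 * k)%N = b (previous k) /\ vertex_y (3 * k)%N = 0.
Proof.
move=> kN; rewrite /vertex_x /vertex_y modz_nat modn_small; last by rewrite ltn_mul2l.
by have [/= -> _ _] := vertex3 k.
Qed.

Lemma vertex_up k : (k <= N)%N -> vertex_x (3 * k + 1)%N = a k /\ vertex_y (3 * k + 1)%N = 0.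
Proof.
move=> kN; rewrite /vertex_x /vertex_y modz_nat modn_small; last by rewrite /period; lia.
by have [_ /= -> _] := vertex3 k.
Qed.

Lemma vertex_down k : (k <= N)%N -> vertex_x (3 * k + 2)%N = a k + half k /\
  vertex_y (3 * k + 2)%N = sg k * `|half k|.
Proof.
move=> kN; rewrite /vertex_x /vertex_y modz_nat modn_small; last by rewrite /period; lia.
by have [_ _ /= ->] := vertex3 k.
Qed.

Definition tent_y k (r : R) := sg k * (Num.min r (2 - r) * `|half k|).

Lemma polygon_base k u : (k <= N)%N -> 0 <= u <= 1 ->
  polygon vertex_x ((3 * k)%:R + u) = b (previous k) + u * (a k - b (previous k)) /\
  polygon vertex_y ((3 * k)%:R + u) = 0.
Proof.
move=> kN u01; have [vx vy] := vertex_base kN; have [sx sy] := side_base kN.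
rewrite !(@polygon_edge R _ (3 * k)%N); try by rewrite -pmulrn; lra.
by rewrite vx vy sx sy -!pmulrn; split; ring.
Qed.

Lemma polygon_tent k r : (k <= N)%N -> 0 <= r <= 2 ->
  polygon vertex_x ((3 * k + 1)%:R + r) = a k + r * half k /\
  polygon vertex_y ((3 * k + 1)%:R + r) = tent_y k r.
Proof.
move=> kN r02; rewrite /tent_y; have [r1|r1] := leP r 1.
  have [vx vy] := vertex_up kN; have [sx sy] := side_up kN.
  rewrite !(@polygon_edge R _ (3 * k + 1)%N); try by rewrite -pmulrn; lra.
  rewrite vx vy sx sy -!pmulrn min_l; last lra.
  by split; ring.
have [vx vy] := vertex_down kN; have [sx sy] := side_down kN.
have e : (3 * k + 1)%:R + r = (3 * k + 2)%:R + (r - 1) :> R by rewrite !natrD; ring.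
rewrite e !(@polygon_edge R _ (3 * k + 2)%N); try by rewrite -pmulrn; lra.
rewrite vx vy sx sy -!pmulrn min_r; last lra.
by split; ring.
Qed.

Lemma time_split t : 0 <= t < period%:R -> exists k : nat, (k <= N)%N /\
  ((exists u : R, 0 <= u < 1 /\ t = (3 * k)%:R + u) \/
   (exists r : R, 0 <= r < 2 /\ t = (3 * k + 1)%:R + r)).
Proof.
move=> /andP[t0 tm]; have /andP[f1 f2] := Num.Theory.truncn_itv t0.
set j := Num.truncn t in f1 f2.
have jm : (j < period)%N by rewrite -(ltr_nat R); apply: le_lt_trans tm.
exists (j %/ 3)%N; split; first by rewrite -ltnS ltn_divLR // mulnC.
have ej := divn_eq j 3; have : (j %% 3 < 3)%N by rewrite ltn_mod.
rewrite mulnC in ej; set q := (j %/ 3)%N in ej *; set i := (j %% 3)%N in ej * => i3.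
rewrite -addn1 natrD ej natrD in f1 f2.
have [i0|i0] := posnP i.
  by left; exists (t - (3 * q)%:R); rewrite i0 in f1 f2; split; lra.
right; exists (t - (3 * q + 1)%:R); split; last by lra.
have : (1 <= i%:R :> R) by rewrite (ler_nat R 1).
have : (i%:R <= 2 :> R) by rewrite (ler_nat R _ 2).
rewrite natrD; lra.
Qed.

Definition lo k : R := Num.min (a k) (b k).
Definition hi k : R := Num.max (a k) (b k).

(** At height [h] the point lies at distance [h] from the left end of the base on the left leg, and
    from the right end on the right leg; at the apex both hold. This removes the direction of travel
    from later arguments. *)
Lemma tent_shape k r : (k <= N)%N -> 0 <= r < 2 ->
  exists h, [/\ tent_y k r = sg k * h, 0 <= h, h = 0 -> r = 0,
    lo k <= a k + r * half k - h /\ a k + r * half k + h <= hi k &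
    (a k + r * half k - h = lo k) /\ (r = 1 -> a k + r * half k + h = hi k) \/
    (a k + r * half k + h = hi k) /\ (r = 1 -> a k + r * half k - h = lo k)].
Proof.
move=> kN /andP[r0 r2]; exists (Num.min r (2 - r) * `|half k|).
have h0 := half_neq0 kN; rewrite /lo /hi /tent_y; have bE : b k = a k + 2 * half k by rewrite /half; field.
rewrite bE; move: (half k) h0 {bE} => d d0.
have m0 : 0 <= Num.min r (2 - r) by rewrite le_min; lra.
split; [by []|by rewrite mulr_ge0| | |].
- move=> /eqP; rewrite mulf_eq0 normr_eq0 (negbTE d0) orbF.
  by case: (leP r (2 - r)) => _ /eqP //; lra.
- have [dp|dn|d0'] := ltrgtP d 0; last by rewrite d0' eqxx in d0.
    rewrite ltr0_norm // [Num.min (a k) _]min_r ?[Num.max (a k) _]max_l; [|lra|lra].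
    by case: (leP r (2 - r)) => rr; split; nra.
  rewrite gtr0_norm // [Num.min (a k) _]min_l ?[Num.max (a k) _]max_r; [|lra|lra].
  by case: (leP r (2 - r)) => rr; split; nra.
have [dp|dn|d0'] := ltrgtP d 0; last by rewrite d0' eqxx in d0.
  rewrite ltr0_norm // [Num.min (a k) _]min_r ?[Num.max (a k) _]max_l; [|lra|lra].
  case: (leP r (2 - r)) => rr; [right|left]; (split; [lra|]).
    by move=> r1; rewrite r1; lra.
  by move=> r1; rewrite r1; lra.
rewrite gtr0_norm // [Num.min (a k) _]min_l ?[Num.max (a k) _]max_r; [|lra|lra].
case: (leP r (2 - r)) => rr; [left|right]; (split; [lra|]).
  by move=> r1; rewrite r1; lra.
by move=> r1; rewrite r1; lra.
Qed.

Lemma natr_inj (i j : nat) : i%:R = j%:R :> R -> i = j.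
Proof. by move/eqP; rewrite eqr_nat => /eqP. Qed.

Lemma baseline_real k : (k <= N)%N -> exists c : nat,
  (B (previous k) = c.*2 /\ A k = c.*2.+1) \/ (B (previous k) = c.*2.+1 /\ A k = c.*2).
Proof.
move=> kN; have := baseline kN; rewrite /baseline_step.
case/orP => /andP[ev /eqP e].
  by exists ((fun i : nat => i./2) (B (previous k))); left; lia.
by exists ((fun i : nat => i./2) (A k)); right; lia.
Qed.

Definition crosses k l (r r' : R) :=
  [/\ up k = up l, lo k < lo l, lo l < hi k & hi k < hi l] /\
  [/\ 0 < r < 2, r != 1, 0 < r' < 2 & r' != 1] /\
  [/\ a k + r * half k = (lo l + hi k) / 2, a l + r' * half l = (lo l + hi k) / 2,
      tent_y k r = sg k * ((hi k - lo l) / 2) & tent_y l r' = sg l * ((hi k - lo l) / 2)].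

(** Distinct feet force a positive height, hence tents on the same side. A common point on two left
    legs, or on two right legs, would force a common end of the bases, so the legs are opposite and
    the bases overlap without nesting. *)
Lemma tents_meet k l r r' : (k <= N)%N -> (l <= N)%N -> 0 <= r < 2 -> 0 <= r' < 2 ->
  a k + r * half k = a l + r' * half l -> tent_y k r = tent_y l r' ->
  (k = l /\ r = r') \/ crosses k l r r' \/ crosses l k r' r.
Proof.
move=> kN lN r02 r02' ex ey.
have [ekl|nkl] := eqVneq k l.
  left; split=> //; move: ex; rewrite -ekl => /addrI.
  exact: (mulIf (half_neq0 kN)).
have [h [ek h0 hr [k1 k2] k3]] := tent_shape kN r02.
have [h' [el h0' hr' [l1 l2] l3]] := tent_shape lN r02'.
have sg2 i : sg i = 1 \/ sg i = -1 by rewrite /sg; case: (up i); [left|right].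
have eh : h = h'.
  by move: ey; rewrite ek el; case: (sg2 k) => ->; case: (sg2 l) => ->; lra.
have nA : A k <> A l by move=> /(A_inj kN lN) e; rewrite e eqxx in nkl.
have nB : B k <> B l by move=> /(B_inj kN lN) e; rewrite e eqxx in nkl.
have nAB : A k <> B l by move/eqP: (A_neq_B kN lN).
have nBA : A l <> B k by move/eqP: (A_neq_B lN kN).
have hn0 : h <> 0.
  move=> e0; have r0 := hr e0; have r0' := hr' (etrans (esym eh) e0).
  by apply: nA; apply: natr_inj; move: ex; rewrite r0 r0' !mul0r !addr0.
have hp : 0 < h by rewrite lt_neqAle h0 andbT eq_sym; apply/eqP.
have eup : up k = up l.
  by move: ey; rewrite ek el -eh /sg; case: (up k); case: (up l) => //; lra.
have nlo : lo k <> lo l.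
  by rewrite /lo; case: (leP (a k)); case: (leP (a l)) => _ _ /natr_inj // /esym.
have nhi : hi k <> hi l.
  by rewrite /hi; case: (leP (a k)); case: (leP (a l)) => _ _ /natr_inj // /esym.
have pos i q : 0 <= q < 2 -> (q = 0 -> tent_y i q = 0) -> tent_y i q <> 0 -> 0 < q < 2.
  by move=> /andP[q0 ->] H n0; rewrite lt_neqAle q0 !andbT; apply: contra_notN n0 => /eqP/esym/H.
have ty0 i : tent_y i 0 = 0 by rewrite /tent_y subr0 min_l ?mul0r ?mulr0.
have tyn i q g : tent_y i q = sg i * g -> g <> 0 -> tent_y i q <> 0.
  by move=> -> g0; have := sg2 i => -[] ->; lra.
have rp : 0 < r < 2 by apply: (pos k) => //; [move=> ->; rewrite ty0|exact: tyn ek hn0].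
have rp' : 0 < r' < 2.
  by apply: (pos l) => //; [move=> ->; rewrite ty0|apply: tyn el _; rewrite -eh].
rewrite -eh in l1 l2 l3; rewrite -ex in l1 l2 l3.
right; case: k3 l3 => [[k3 k4] [[l3 l4]|[l3 l4]]|[k3 k4] [[l3 l4]|[l3 l4]]].
- by case: nlo; lra.
- right; have llk : lo l < lo k by rewrite lt_neqAle; apply/andP; split; [apply/eqP/nesym|lra].
  have hlk : hi l < hi k by rewrite lt_neqAle; apply/andP; split; [apply/eqP/nesym|lra].
  split; first by split; [exact: esym|lra|lra|lra].
  split; first split=> //.
  + by apply/eqP => /l4 e; lra.
  + by apply/eqP => /k4 e; lra.
  by split; [lra|lra|rewrite el -eh|rewrite ek]; congr (_ * _); lra.
- left; have llk : lo k < lo l by rewrite lt_neqAle; apply/andP; split; [apply/eqP|lra].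
  have hlk : hi k < hi l by rewrite lt_neqAle; apply/andP; split; [apply/eqP|lra].
  split; first by split; [by []|lra|lra|lra].
  split; first split=> //.
  + by apply/eqP => /k4 e; lra.
  + by apply/eqP => /l4 e; lra.
  by split; [lra|lra|rewrite ek|rewrite el -eh]; congr (_ * _); lra.
- by case: nhi; lra.
Qed.

Lemma mid k : lo k + hi k = 2 * (a k + half k).
Proof.
by rewrite /lo /hi /half; case: (leP (a k) (b k)) => _; field.
Qed.

Lemma polygon_meet s t : 0 <= s < period%:R -> 0 <= t < period%:R ->
  polygon vertex_x s = polygon vertex_x t -> polygon vertex_y s = polygon vertex_y t ->
  s = t \/ exists k l r r', [/\ (k <= N)%N, (l <= N)%N, s = (3 * k + 1)%:R + r,
    t = (3 * l + 1)%:R + r' & crosses k l r r' \/ crosses l k r' r].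
Proof.
(* A tent is at height 0 only at its foot [A l], as [r < 2]. Among the integers a half-open step
   along the line contains only its start [B (previous k)], which differs from [A l]. *)
have base_tent k l (u r : R) : (k <= N)%N -> (l <= N)%N -> 0 <= u < 1 -> 0 <= r < 2 ->
    b (previous k) + u * (a k - b (previous k)) = a l + r * half l -> 0 = tent_y l r -> False.
  move=> kN lN u01 r02 ex; have [h [-> h0 hr _ _]] := tent_shape lN r02.
  move=> /esym/eqP; rewrite mulf_eq0 => /orP[|/eqP /hr r0].
    by rewrite /sg; case: ifP => _; rewrite ?oppr_eq0 oner_eq0.
  move: ex; rewrite r0 mul0r addr0 => ex.
  have [c [[e1 e2]|[e1 e2]]] := baseline_real kN; move: ex; rewrite /b /a e1 e2 => ex.
  - have h1 : ((c.*2)%:R <= (A l)%:R :> R) by rewrite -ex -natr1; lra.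
    have h2 : ((A l)%:R < (c.*2.+1)%:R :> R) by rewrite -ex -natr1; lra.
    rewrite ler_nat in h1; rewrite ltr_nat in h2.
    have e : A l = B (previous k) by lia.
    by have := A_neq_B lN (previous_le kN); rewrite e eqxx.
  have h1 : ((c.*2)%:R < (A l)%:R :> R) by rewrite -ex -natr1; lra.
  have h2 : ((A l)%:R <= (c.*2.+1)%:R :> R) by rewrite -ex -natr1; lra.
  rewrite ltr_nat in h1; rewrite ler_nat in h2.
  have e : A l = B (previous k) by lia.
  by have := A_neq_B lN (previous_le kN); rewrite e eqxx.
move=> s01 t01; have [k [kN [[u [u01 ->]]|[r [r02 ->]]]]] := time_split s01;
have [l [lN [[v [v01 ->]]|[q [q02 ->]]]]] := time_split t01.
- have [|-> _] := polygon_base (k := k) (u := u) kN; first lra.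
  have [|-> _ ex _] := polygon_base (k := l) (u := v) lN; first lra.
  (* Each step occupies an interval from [2c] to [2c+1]. Two steps that meet share [c], and since no
     [A] equals a [B] they share their end [A]. *)
  left; have ekl : k = l.
    have [c ec] := baseline_real kN; have [d ed] := baseline_real lN.
    have cx : (c.*2)%:R <= b (previous k) + u * (a k - b (previous k)) <= (c.*2.+1)%:R.
      by rewrite /a /b; case: ec => -[-> ->]; rewrite -natr1; lra.
    have dx : (d.*2)%:R <= b (previous k) + u * (a k - b (previous k)) <= (d.*2.+1)%:R.
      by rewrite ex /a /b; case: ed => -[-> ->]; rewrite -natr1; lra.
    have cd1 : ((c.*2)%:R <= (d.*2.+1)%:R :> R) by lra.
    have cd2 : ((d.*2)%:R <= (c.*2.+1)%:R :> R) by lra.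
    have {cd1 cd2} ecd : c = d by move: cd1 cd2; rewrite !ler_nat; clear; lia.
    rewrite -ecd in ed; have nAB := A_neq_B kN (previous_le lN).
    apply: (A_inj kN lN); move: nAB; case: ec => -[_ ->]; case: ed => -[-> ->] //; by rewrite eqxx.
  rewrite -ekl in ex *; move/addrI: ex => /mulIf ->//; rewrite subr_eq0 /a /b eqr_nat.
  exact: A_neq_B kN (previous_le kN).
- have [|-> ->] := polygon_base (k := k) (u := u) kN; first lra.
  have [|-> ->] := polygon_tent (k := l) (r := q) lN; first lra.
  by move=> ex ey; case: (base_tent k l u q kN lN).
- have [|-> ->] := polygon_tent (k := k) (r := r) kN; first lra.
  have [|-> ->] := polygon_base (k := l) (u := v) lN; first lra.
  by move=> ex ey; case: (base_tent l k v r lN kN).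
have [|-> ->] := polygon_tent (k := k) (r := r) kN; first lra.
have [|-> ->] := polygon_tent (k := l) (r := q) lN; first lra.
move=> ex ey; have [[-> ->]|H] := tents_meet kN lN r02 q02 ex ey; first by left.
by right; exists k, l, r, q.
Qed.

Lemma lo_lt_hi k : (k <= N)%N -> lo k < hi k.
Proof.
by move=> kN; have := half_neq0 kN; rewrite /lo /hi /half; case: (ltgtP (a k) (b k)) => // ->;
  rewrite subrr mul0r eqxx.
Qed.

Lemma tent_abscissa k x : (k <= N)%N -> lo k < x < hi k ->
  exists r, 0 < r < 2 /\ a k + r * half k = x.
Proof.
move=> kN xk; have h0 := half_neq0 kN; exists ((x - a k) / half k); split; last by field.
move: xk h0; rewrite /lo /hi; have -> : b k = a k + 2 * half k by rewrite /half; field.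
move: (half k) => d + d0; have [dn|dp|e] := ltrgtP d 0; last by rewrite e eqxx in d0.
  rewrite ltr_ndivlMr // ltr_ndivrMr // mul0r.
  by rewrite min_r ?max_l; lra.
rewrite ltr_pdivlMr // ltr_pdivrMr // mul0r.
by rewrite min_l ?max_r; lra.
Qed.

Lemma crosses_exists k l : (k <= N)%N -> (l <= N)%N -> up k = up l ->
  lo k < lo l -> lo l < hi k -> hi k < hi l -> exists r r', crosses k l r r'.
Proof.
move=> kN lN eup lkl llk hkl.
have [|r [r02 er]] := @tent_abscissa k ((lo l + hi k) / 2) kN; first lra.
have [|r' [r02' er']] := @tent_abscissa l ((lo l + hi k) / 2) lN; first lra.
exists r, r'; split=> //; split; first split=> //.
- by apply/eqP => e; have := mid k; move: er; rewrite e mul1r; lra.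
- by apply/eqP => e; have := mid l; move: er'; rewrite e mul1r; lra.
split=> //.
  have [|h [-> h0 _ [k1 k2] k3]] := @tent_shape k r kN; first lra.
  by congr (_ * _); rewrite er in k1 k2 k3; case: k3 => -[? _]; lra.
have [|h [-> h0 _ [k1 k2] k3]] := @tent_shape l r' lN; first lra.
by congr (_ * _); rewrite er' in k1 k2 k3; case: k3 => -[? _]; lra.
Qed.

(** The signs say that [k] is met on its right leg and [l] on its left leg, whatever the direction
    of travel. *)
Lemma crosses_leg k l r r' : crosses k l r r' -> 0 < (r - 1) * half k /\ (r' - 1) * half l < 0.
Proof.
move=> [[_ c1 c2 c3] [_ [e1 e2 _ _]]]; have := mid k; have := mid l => ml mk.
by rewrite !mulrBl; split; lra.
Qed.

Lemma side_tent k (r : R) (e : int) : (k <= N)%N -> 0 < r < 2 -> r != 1 ->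
  edge_interior ((3 * k + 1)%:R + r) e ->
  side vertex_x e = half k /\
  side vertex_y e = (if r < 1 then 1 else -1) * (sg k * `|half k|).
Proof.
move=> kN r02 r1 /andP[e1 e2].
have [rl|rg] := ltP r 1.
  have -> : e = (3 * k + 1)%N.
    by apply: (@intr_between R); rewrite -pmulrn; lra.
  by rewrite mul1r; exact: side_up.
have rg' : 1 < r by rewrite lt_neqAle eq_sym r1.
have -> : e = (3 * k + 2)%N.
  by apply: (@intr_between R); rewrite -pmulrn; move: e1 e2; rewrite !natrD; lra.
by have [-> ->] := side_down kN; rewrite mulN1r.
Qed.

Lemma side_tent_right k l (r r' : R) (e : int) : (k <= N)%N -> crosses k l r r' ->
  edge_interior ((3 * k + 1)%:R + r) e ->
  side vertex_x e = half k /\ side vertex_y e = - sg k * half k.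
Proof.
move=> kN c ei; have [c1 _] := crosses_leg c; have [_ [[r02 r1 _ _] _]] := c.
have [-> ->] := side_tent kN r02 r1 ei; split=> //.
have [rl|rg] := ltP r 1.
  by rewrite ltr0_norm; [ring|nra].
by rewrite gtr0_norm; [ring|nra].
Qed.

Lemma side_tent_left k l (r r' : R) (e : int) : (l <= N)%N -> crosses k l r r' ->
  edge_interior ((3 * l + 1)%:R + r') e ->
  side vertex_x e = half l /\ side vertex_y e = sg l * half l.
Proof.
move=> lN c ei; have [_ c1] := crosses_leg c; have [_ [[_ _ r02 r1] _]] := c.
have [-> ->] := side_tent lN r02 r1 ei; split=> //.
have [rl|rg] := ltP r' 1.
  by rewrite gtr0_norm; [ring|nra].
by rewrite ltr0_norm; [ring|nra].
Qed.

(** The two legs have slopes 1 and -1, so the crossing is transverse. *)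
Lemma crosses_det k l (r r' : R) (e f : int) : (k <= N)%N -> (l <= N)%N -> crosses k l r r' ->
  edge_interior ((3 * k + 1)%:R + r) e -> edge_interior ((3 * l + 1)%:R + r') f ->
  side vertex_x e * side vertex_y f - side vertex_y e * side vertex_x f != 0.
Proof.
move=> kN lN c ei fi; have [-> ->] := side_tent_right kN c ei.
have [-> ->] := side_tent_left lN c fi; have [[eup _ _ _] _] := c.
rewrite (_ : _ - _ = 2 * sg k * half k * half l); last by rewrite /sg eup; ring.
have s0 : sg k != 0 by rewrite /sg; case: ifP => _; rewrite ?oppr_eq0 oner_eq0.
by apply: mulf_neq0 (half_neq0 lN); apply: mulf_neq0 (half_neq0 kN); rewrite mulf_neq0 ?pnatr_eq0.
Qed.

Lemma period_gt0 : (0 < period)%N. Proof. by []. Qed.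

Lemma side_x_periodic (e z : int) : side vertex_x (e + z * period) = side vertex_x e.
Proof. by rewrite /side addrAC !(int_periodic vertex_x_periodic). Qed.

Lemma side_y_periodic (e z : int) : side vertex_y (e + z * period) = side vertex_y e.
Proof. by rewrite /side addrAC !(int_periodic vertex_y_periodic). Qed.

(** A horizontal step is followed or preceded by a leg of slope 1 or -1, and the two legs at an apex
    have opposite slopes. *)
Lemma tents_det_corner (e : int) :
  side vertex_x (e - 1) * side vertex_y e - side vertex_y (e - 1) * side vertex_x e != 0.
Proof.
have m0 : (period : int) != 0 by [].
have mp : 0 < (period : int) by [].
have := modz_ge0 e m0; have := ltz_pmod e mp; have := divz_eq e period; rewrite addrC.
move: (e %/ period)%Z => q; case: (e %% period)%Z => // j ->; rewrite ltz_nat => jm _.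
rewrite [_ + _ - 1]addrAC !side_x_periodic !side_y_periodic.
have ej := divn_eq j 3; have : (j %% 3 < 3)%N by rewrite ltn_mod.
have kN : (j %/ 3 <= N)%N by rewrite -ltnS ltn_divLR // mulnC.
rewrite mulnC in ej; move: ej; set k := (j %/ 3)%N in kN *; set i := (j %% 3)%N.
have sg0 l : sg l != 0 by rewrite /sg; case: ifP => _; rewrite ?oppr_eq0 oner_eq0.
have ab0 : a k - b (previous k) != 0.
  by rewrite subr_eq0 /a /b eqr_nat A_neq_B // previous_le.
have hk := half_neq0 kN.
case: i => [|[|[|//]]] -> _.
(* For [k = 0] the preceding side is the last leg of tent [N], one period earlier. *)
- have [z ez] : exists z : int, (3 * k + 0)%N%:Z - 1 = (3 * previous k + 2)%N%:Z + z * period%:Z.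
    rewrite /previous; case: (k) => [|k'].
      by exists (-1); rewrite /period; lia.
    by exists 0; rewrite mul0r addr0; lia.
  rewrite ez side_x_periodic side_y_periodic addn0.
  have [-> ->] := side_base kN; have [-> ->] := side_down (previous_le kN).
  rewrite mulr0 sub0r oppr_eq0 mulf_neq0 // oppr_eq0 mulf_neq0 // normr_eq0.
  by rewrite half_neq0 ?previous_le.
- rewrite (_ : (3 * k + 1)%N%:Z - 1 = (3 * k)%N); last by lia.
  have [-> ->] := side_base kN; have [-> ->] := side_up kN.
  by rewrite mul0r subr0 mulf_neq0 // mulf_neq0 // normr_eq0.
rewrite (_ : (3 * k + 2)%N%:Z - 1 = (3 * k + 1)%N); last by lia.
have [-> ->] := side_up kN; have [-> ->] := side_down kN.
rewrite (_ : _ - _ = - (2 * sg k * `|half k| * half k)); last by ring.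
have n0 : `|half k| != 0 by rewrite normr_eq0.
have n2 : (2 : R) != 0 by rewrite pnatr_eq0.
by rewrite oppr_eq0; apply: mulf_neq0 hk; apply: mulf_neq0 n0; apply: mulf_neq0 n2 _.
Qed.

Lemma reduce_time (t : R) : exists z : int, 0 <= t - z%:~R * period%:R < period%:R.
Proof.
have p0 : 0 < period%:R :> R by rewrite ltr0n.
exists (Num.floor (t / period%:R)); have := Num.Theory.floor_itv (t / period%:R).
rewrite intrD ler_pdivlMr // ltr_pdivrMr //; lra.
Qed.

Lemma polygon_reduce (p : int -> R) (t : R) (z : int) :
  (forall k : int, p (k + period%:Z) = p k) ->
  polygon p (t - z%:~R * period%:R) = polygon p t.
Proof.
move=> pm; rewrite -[period%:R]/((period : int)%:~R) -intrM -mulrNz.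
rewrite /polygon rounded_periodic // => k.
by rewrite -mulNr int_periodic.
Qed.

Lemma tent_interior k (r : R) : 0 < r < 2 -> r != 1 ->
  exists e : int, edge_interior ((3 * k + 1)%:R + r) e.
Proof.
move=> r02 r1; have [rl|rg] := ltP r 1.
  by exists (3 * k + 1)%N; rewrite /edge_interior -pmulrn; lra.
have rg' : 1 < r by rewrite lt_neqAle eq_sym r1.
by exists (3 * k + 2)%N; rewrite /edge_interior -pmulrn !natrD; lra.
Qed.

Lemma crosses_itv k l r r' : crosses k l r r' \/ crosses l k r' r ->
  [/\ 0 < r < 2, r != 1, 0 < r' < 2 & r' != 1].
Proof. by case=> -[_ [[? ? ? ?] _]]. Qed.

Lemma tents_crossing (s t : R) : polygon vertex_x s = polygon vertex_x t ->
  polygon vertex_y s = polygon vertex_y t -> congruent period s t \/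
  (exists k, edge_interior s k) /\ (exists k, edge_interior t k).
Proof.
have [z sz] := reduce_time s; have [w tw] := reduce_time t.
rewrite -(polygon_reduce s z vertex_x_periodic) -(polygon_reduce t w vertex_x_periodic).
rewrite -(polygon_reduce s z vertex_y_periodic) -(polygon_reduce t w vertex_y_periodic).
move=> ex ey; have [e|[k [l [r [r' [kN lN es et /crosses_itv[r1 r2 r3 r4]]]]]]] := polygon_meet sz tw ex ey.
  by left; exists (z - w); rewrite intrB; lra.
right; have shift (u : R) (y : int) : (exists e : int, edge_interior (u - y%:~R * period%:R) e) ->
    exists e : int, edge_interior u e.
  move=> [e]; rewrite /edge_interior => H; exists (e + y * period).
  by move: H; rewrite intrD intrM -[(period : int)%:~R]/(period%:R); lra.
by split; [apply: (shift _ z)|apply: (shift _ w)]; rewrite ?es ?et; apply: tent_interior.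
Qed.

Section Word.
Variables (T : choiceType) (S : seq T) (z0 : T).
Hypothesis dS : double_occurrence_word S.
Hypothesis size_S : size S = N.
Hypothesis crossing_letters : forall k l, (k <= N)%N -> (l <= N)%N -> up k = up l ->
  lo k < lo l -> lo l < hi k -> hi k < hi l ->
  [/\ (k < N)%N, (l < N)%N & nth z0 S k = nth z0 S l].
Hypothesis letters_cross : forall k l, (k < N)%N -> (l < N)%N -> k != l ->
  nth z0 S k = nth z0 S l -> up k = up l /\
  ([/\ lo k < lo l, lo l < hi k & hi k < hi l] \/
   [/\ lo l < lo k, lo k < hi l & hi l < hi k]).

(** The existential is placed outside the bound on [k], so that a total function of crossing times
    can be chosen. *)
Lemma crossing_time k : exists r : R, (k < N)%N -> exists l r', [/\ (l < N)%N, l != k,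
  nth z0 S k = nth z0 S l & crosses k l r r' \/ crosses l k r' r].
Proof.
have [kN|] := boolP (k < N)%N; last by move=> _; exists 0.
rewrite -size_S in kN; have [l [lN nlk e]] := other_occurrence z0 dS kN.
rewrite size_S in kN lN; rewrite eq_sym in nlk.
have [eup [[c1 c2 c3]|[c1 c2 c3]]] := letters_cross kN lN nlk (esym e).
  have [r [r' c]] := crosses_exists (ltnW kN) (ltnW lN) eup c1 c2 c3.
  by exists r => _; exists l, r'; split=> //; [rewrite eq_sym|left].
have [r' [r c]] := crosses_exists (ltnW lN) (ltnW kN) (esym eup) c1 c2 c3.
by exists r => _; exists l, r'; split=> //; [rewrite eq_sym|right].
Qed.

Lemma crosses_letters k l r r' : (k <= N)%N -> (l <= N)%N ->
  crosses k l r r' \/ crosses l k r' r ->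
  [/\ (k < N)%N, (l < N)%N, k != l & nth z0 S k = nth z0 S l].
Proof.
move=> kN lN [] c; have [[eup c1 c2 c3] _] := c.
  have [h1 h2 h3] := crossing_letters kN lN eup c1 c2 c3; split=> //.
  by apply: contraTneq c1 => ->; rewrite ltxx.
have [h1 h2 h3] := crossing_letters lN kN eup c1 c2 c3; split=> //.
by apply: contraTneq c1 => ->; rewrite ltxx.
Qed.

Lemma crosses_unique k l l' r r1 q q1 : (k <= N)%N -> (l <= N)%N -> (l' <= N)%N ->
  crosses k l r r1 \/ crosses l k r1 r -> crosses k l' q q1 \/ crosses l' k q1 q ->
  [/\ l = l', r = q & r1 = q1].
Proof.
move=> kN lN lN' c c'.
have [h1 h2 h3 h4] := crosses_letters kN lN c.
have [g1 g2 g3 g4] := crosses_letters kN lN' c'.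
have ell : l = l'.
  rewrite -size_S in h1 h2 g2.
  have /or3P[/eqP e|/eqP //|/eqP e] := no_third_occurrence dS h1 h2 g2 h4 g4.
    by rewrite e eqxx in h3.
  by rewrite e eqxx in g3.
rewrite -ell in c' *.
have inj i x y : (i <= N)%N -> a i + x * half i = a i + y * half i -> x = y.
  by move=> iN /addrI /(mulIf (half_neq0 iN)).
case: c c' => -[[c0 c1 c2 c3] [_ [e1 e2 _ _]]] [] [[d0 d1 d2 d3] [_ [f1 f2 _ _]]].
- by split=> //; [apply: (inj k)|apply: (inj l)] => //; rewrite ?e1 ?f1 ?e2 ?f2.
- by have := lt_trans c1 d1; rewrite ltxx.
- by have := lt_trans c1 d1; rewrite ltxx.
- by split=> //; [apply: (inj k)|apply: (inj l)] => //; rewrite ?e1 ?f1 ?e2 ?f2.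
Qed.

(** The rounded polygon has exactly the crossings of the polygon, which are those between the two
    tents of a letter, and tent [k] is run through before tent [k + 1]. Dividing times by [period]
    gives a curve of period 1. *)
Theorem tents_realizable : realizable R S.
Proof.
have [rc Hrc] := choice crossing_time.
have [X [Y [[sX sY] [perX perY] imm meet cross]]] :=
  smooth_polygon period_gt0 vertex_x_periodic vertex_y_periodic tents_det_corner tents_crossing.
have p0 : 0 < period%:R :> R by rewrite ltr0n.
pose tm k : R := (3 * k + 1)%:R + rc k.
have tmE k : (k < N)%N -> 0 < rc k < 2.
  by move=> /Hrc [l [r' [_ _ _ /crosses_itv[]]]].
have tm_itv k : (k < N)%N -> (3 * k + 1)%:R < tm k < (3 * k + 3)%:R.
  by move=> /tmE; rewrite /tm !natrD; lra.
have tm_period k : (k < N)%N -> 0 < tm k < period%:R.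
  move=> kN; have := tm_itv k kN => /andP[h1 h2]; apply/andP; split.
    by apply: le_lt_trans h1.
  by apply: lt_le_trans h2 _; rewrite ler_nat /period; lia.
have tm_lt k l : (k < l)%N -> (l < N)%N -> tm k < tm l.
  move=> kl lN; have /andP[_ h1] := tm_itv k (ltn_trans kl lN).
  have /andP[h2 _] := tm_itv l lN; apply: lt_le_trans h1 _; apply: le_trans (ltW h2).
  by rewrite ler_nat; lia.
have tm_inj k l : (k < N)%N -> (l < N)%N -> tm k = tm l -> k = l.
  move=> kN lN e; have [kl|kl|//] := ltngtP k l.
    by have := tm_lt _ _ kl lN; rewrite e ltxx.
  by have := tm_lt _ _ kl kN; rewrite e ltxx.
have tm_piece k l (r : R) : (k < N)%N -> 0 < r < 2 -> tm k = (3 * l + 1)%:R + r -> k = l.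
  move=> kN r02 e; have := tm_itv k kN; rewrite e => /andP[h1 h2].
  have h3 : ((3 * k + 1)%:R < (3 * l + 3)%:R :> R) by move: h1; rewrite !natrD; lra.
  have h4 : ((3 * l + 1)%:R < (3 * k + 3)%:R :> R) by move: h2; rewrite !natrD; lra.
  by rewrite !ltr_nat in h3 h4; lia.
pose ts := [seq tm k / period%:R | k <- iota 0 N].
have nth_ts k : (k < N)%N -> nth 0 ts k = tm k / period%:R.
  by move=> kN; rewrite (nth_map 0%N) ?size_iota // nth_iota.
have per_mul (t : R) : (t + 1) * period%:R = t * period%:R + period%:R by ring.
have der (F : R -> R) t : (forall n, smoothn n F) ->
    derive1 (fun t => F (t * period%:R)) t = derive1 F (t * period%:R) * period%:R.
  move=> sF; apply: is_derive_derive1.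
  have d1 : is_derive (t * period%:R) 1 F (derive1 F (t * period%:R)).
    by rewrite derive1E; apply: derivableP; exact: smoothn_derivable (sF 0%N).
  have d2 := is_derive_mul (is_derive_var t) (is_derive_const t period%:R).
  have := @is_derive_compose R F (fun t => t * period%:R) t _ _ d1 d2.
  by congr is_derive; ring.
have meet_time (s t : R) : 0 <= s < period%:R -> 0 <= t < period%:R -> X s = X t -> Y s = Y t ->
    s = t \/ exists k l, [/\ (k < N)%N, (l < N)%N, k != l, nth z0 S k = nth z0 S l &
      s = tm k /\ t = tm l].
  move=> s01 t01 ex ey; have [||fx fy] := meet s t _ _ ex ey; [lra|lra|].
  have [e|[k [l [r [r' [kN lN es et c]]]]]] := polygon_meet s01 t01 fx fy; first by left.
  right; have [h1 h2 h3 h4] := crosses_letters kN lN c.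
  have [l' [q [lN' _ _ c']]] := Hrc k h1.
  have [_ er _] := crosses_unique kN lN (ltnW lN') c c'.
  have [k' [q' [kN' _ _ c'']]] := Hrc l h2.
  have c2 : crosses l k r' r \/ crosses k l r r' by case: c; [right|left].
  have [_ er' _] := crosses_unique lN kN (ltnW kN') c2 c''.
  by exists k, l; split=> //; rewrite es et /tm er er'.
have mate_cross k l : (k < N)%N -> (l < N)%N -> k != l -> nth z0 S k = nth z0 S l ->
    crosses k l (rc k) (rc l) \/ crosses l k (rc l) (rc k).
  move=> kN lN nkl e; have [l' [q [lN' nlk e' c]]] := Hrc k kN.
  have el : l' = l.
    have := kN; have := lN; have := lN'; rewrite -size_S => hl' hl hk.
    have /or3P[/eqP f|/eqP //|/eqP f] := no_third_occurrence dS hk hl' hl e' e.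
      by rewrite f eqxx in nlk.
    by rewrite f eqxx in nkl.
  rewrite el in c; have [k' [q' [kN' _ _ c']]] := Hrc l lN.
  have c2 : crosses l k q (rc k) \/ crosses k l (rc k) q by case: c; [right|left].
  have [_ er _] := crosses_unique (ltnW lN) (ltnW kN) (ltnW kN') c2 c'.
  by rewrite -er.
have cross_time k l : (k < N)%N -> (l < N)%N -> k != l -> nth z0 S k = nth z0 S l ->
    X (tm k) = X (tm l) /\ Y (tm k) = Y (tm l) /\
    derive1 X (tm k) * derive1 Y (tm l) - derive1 Y (tm k) * derive1 X (tm l) != 0.
  move=> kN lN nkl e; have c := mate_cross k l kN lN nkl e.
  have [r02 r1 r02' r1'] := crosses_itv c.
  have [|px py] := polygon_tent (k := k) (r := rc k) (ltnW kN); first lra.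
  have [|qx qy] := polygon_tent (k := l) (r := rc l) (ltnW lN); first lra.
  have ex : polygon vertex_x (tm k) = polygon vertex_x (tm l).
    by rewrite px qx; case: c => -[_ [_ [-> ->]]].
  have ey : polygon vertex_y (tm k) = polygon vertex_y (tm l).
    by rewrite py qy; case: c => -[[eup _ _ _] [_ [_ _ -> ->]]]; rewrite /sg eup.
  have tk := tm_period k kN; have tl := tm_period l lN.
  have [||[z ez]|H] := cross _ _ _ _ ex ey; [lra|lra| |].
    have h1 : (z%:~R : R) * period%:R < 1 * period%:R by rewrite -ez; lra.
    have h2 : -1 * period%:R < (z%:~R : R) * period%:R by rewrite -ez; lra.
    rewrite !ltr_pM2r // in h1 h2.
    have z0' : z = 0 by apply: (@intr_between R); lra.
    have /tm_inj e' : tm k = tm l by move: ez; rewrite z0'; lra.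
    by rewrite e' // eqxx in nkl.
  have [Xk Yk [e1 [ek dXk dYk]]] := H (tm k) (or_introl erefl).
  have [Xl Yl [e2 [el dXl dYl]]] := H (tm l) (or_intror erefl).
  split; first by rewrite Xk Xl.
  split; first by rewrite Yk Yl.
  rewrite dXk dXl dYk dYl; case: c => c.
    exact: (crosses_det (ltnW kN) (ltnW lN) c ek el).
  have := crosses_det (ltnW lN) (ltnW kN) c el ek.
  by rewrite -oppr_eq0 opprB mulrC [X in _ - X]mulrC.
apply: (@realizable_of_plane_curve R T S dS (fun t => X (t * period%:R)) (fun t => Y (t * period%:R)) ts).
- move=> n; apply: (smoothn_comp _ (sX n)).
  by apply: smoothnM; [exact: smoothn_id|exact: smoothn_cst].
- move=> n; apply: (smoothn_comp _ (sY n)).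
  by apply: smoothnM; [exact: smoothn_id|exact: smoothn_cst].
- by move=> t; rewrite per_mul perX.
- by move=> t; rewrite per_mul perY.
- by move=> t; rewrite !der // !mulf_eq0 (gt_eqF p0) !orbF; apply: imm.
- apply: (path_sorted (x := -1)); apply/(pathP 0) => i.
  rewrite size_map size_iota => iN.
  case: i iN => [|i] iN; rewrite /= ?nth_ts //; last exact: ltnW.
    by apply: lt_le_trans (divr_ge0 _ (ltW p0)); [lra|have := tm_period 0%N iN; lra].
  by rewrite ltr_pM2r ?invr_gt0 // tm_lt.
- by rewrite size_map size_iota.
- move=> t /mapP[k]; rewrite mem_iota add0n => /andP[_ kN] ->.
  by rewrite ltr_pdivlMr // ltr_pdivrMr // mul0r mul1r tm_period.
- move=> s t s01 t01 ex ey nst.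
  have bnd (u : R) : 0 <= u < 1 -> 0 <= u * period%:R < period%:R.
    by move=> /andP[u0 u1]; rewrite mulr_ge0 ?(ltW p0) //= gtr_pMl.
  have [e|[k [l [kN lN _ _ [es _]]]]] := meet_time _ _ (bnd s s01) (bnd t t01) ex ey.
    by move/mulIf: e nst => ->; rewrite ?eqxx // gt_eqF.
  apply/mapP; exists k; first by rewrite mem_iota add0n.
  by rewrite -es mulfK // gt_eqF.
- move=> z i j; rewrite size_S => iN jN; rewrite !nth_ts // !divfK ?gt_eqF //.
  rewrite !(set_nth_default z0 z) ?size_S //.
  split=> [[ex ey]|e].
    have ti := tm_period i iN; have tj := tm_period j jN.
    have [||e|[k [l [kN lN _ e [ei ej]]]]] := meet_time _ _ _ _ ex ey; [lra|lra| |].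
      by rewrite (tm_inj _ _ iN jN e).
    by rewrite (tm_inj _ _ iN kN ei) (tm_inj _ _ jN lN ej).
  have [->//|nij] := eqVneq i j.
  by have [-> [-> _]] := cross_time i j iN jN nij e.
move=> z i j; rewrite size_S => iN jN nij; rewrite !(set_nth_default z0 z) ?size_S // => e.
have pn0 : period%:R != 0 :> R by rewrite gt_eqF.
rewrite !nth_ts // !der // !divfK //.
have [_ [_ D]] := cross_time i j iN jN nij e.
rewrite (_ : _ - _ = (derive1 X (tm i) * derive1 Y (tm j) - derive1 Y (tm i) * derive1 X (tm j)) *
  (period%:R * period%:R)); last by ring.
by apply: (mulf_neq0 D); apply: mulf_neq0.
Qed.

End Word.
End Tents.

(* [lia] needs the item type of [size s] and [count p s] in a unique form,
   whichever structure the lemma in use has inferred it from. *)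
Ltac slia :=
  repeat match goal with
  | |- context [@size ?A ?s] =>
      let B := eval hnf in A in progress change (@size A s) with (@size B s)
  | H : context [@size ?A ?s] |- _ =>
      let B := eval hnf in A in progress change (@size A s) with (@size B s) in H
  | |- context [@count ?A ?p ?s] =>
      let B := eval hnf in A in progress change (@count A p s) with (@count B p s)
  | H : context [@count ?A ?p ?s] |- _ =>
      let B := eval hnf in A in progress change (@count A p s) with (@count B p s) in H
  end; lia.

(** * Every drawing yields a realization *)

Section DrawingRealizable.
Local Open Scope nat_scope.
Variables (T : choiceType).
Implicit Types (L S : seq T) (ps : seq (T * (nat * nat))).

Lemma nth_endpoints ps p0 k : k < size ps ->
  nth 0 (endpoints ps) k.*2 = (nth p0 ps k).2.1 /\
  nth 0 (endpoints ps) k.*2.+1 = (nth p0 ps k).2.2.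
Proof. by elim: ps k => // p ps IH [|k] //= /IH. Qed.

Lemma size_endpoints ps : size (endpoints ps) = (size ps).*2.
Proof. by elim: ps => // p ps /= ->. Qed.

Lemma chain_step ps p0 s e k : chain s ps e -> k <= size ps ->
  baseline_step (if k is k'.+1 then (nth p0 ps k').2.2 else s)
    (if k < size ps then (nth p0 ps k).2.1 else e).
Proof.
elim: ps s k => [|p ps IH] s [|k] //= /andP[st ch] kp; first by [].
by have := IH _ k ch kp; rewrite ltnS; case: k kp.
Qed.

Lemma interlace_nth L z0 i1 i2 j1 j2 : double_occurrence_word L ->
  i1 < j1 -> j1 < i2 -> i2 < j2 -> j2 < size L ->
  nth z0 L i1 = nth z0 L i2 -> nth z0 L j1 = nth z0 L j2 ->
  nth z0 L i1 <> nth z0 L j1 -> interlace L (nth z0 L i1) (nth z0 L j1).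
Proof.
move=> dL ij ji ij' jL; set x := nth z0 L i1; set y := nth z0 L j1 => ex ey /eqP nxy.
have xL : x \in L by apply: mem_nth; slia.
have yL : y \in L by apply: mem_nth; slia.
have [P [Q [R [eL nP nQ nR]]]] := double_split (dL x xL).
have cy : count_mem y L = 2 by exact: dL.
have notx (s : seq T) k : x \notin s -> k < size s -> nth z0 s k <> x.
  by move=> ns ks e; case/negP: ns; rewrite -e mem_nth.
have sL : size L = size P + (size Q + (size R).+1).+1.
  by rewrite eL size_cat /= size_cat /=.
have pos k : k < size L -> nth z0 L k = x -> k = size P \/ k = size P + (size Q).+1.
  move=> kL; rewrite eL nth_cat; case: ltnP => [kP /(notx _ _ nP kP) []|kP].
  case ek : (k - size P) => [|m] /=; first by move=> _; left; slia.
  rewrite nth_cat; case: ltnP => [kQ /(notx _ _ nQ kQ) []|kQ].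
  case em : (m - size Q) => [|m'] /=; first by move=> _; right; slia.
  by move=> /(notx _ _ nR) []; slia.
have iL1 : i1 < size L by slia.
have iL2 : i2 < size L by slia.
have := pos _ iL1 erefl; have := pos _ iL2 (esym ex) => p2 p1.
rewrite eL interlace_splitE //.
have e1 : i1 = size P by slia.
have e2 : i2 = size P + (size Q).+1 by slia.
have yQ : y \in Q.
  rewrite /y eL nth_cat ltnNge (_ : size P <= j1) /=; last by slia.
  have -> : j1 - size P = (j1 - (size P).+1).+1 by slia.
  rewrite /= nth_cat (_ : j1 - (size P).+1 < size Q); last by slia.
  by apply: mem_nth; slia.
have yR : y \in R.
  rewrite ey eL nth_cat ltnNge (_ : size P <= j2) /=; last by slia.
  have -> : j2 - size P = (j2 - (size P).+1).+1 by slia.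
  rewrite /= nth_cat ltnNge (_ : size Q <= j2 - (size P).+1) /=; last by slia.
  have -> : j2 - (size P).+1 - size Q = (j2 - (size P).+1 - (size Q).+1).+1 by slia.
  by apply: mem_nth; slia.
move: cy; rewrite eL count_cat /= count_cat /=.
have : 0 < count_mem y Q by rewrite -has_count has_pred1.
have : 0 < count_mem y R by rewrite -has_count has_pred1.
case: (count_mem y Q) => [|[|c]] // cR _; rewrite (negbTE nxy).
by move: (count_mem y R) (count_mem y P) cR => n m; lia.
Qed.

Variables (R : realType) (z0 : T) (S L : seq T) (side : T -> bool) (ps : seq (T * (nat * nat))).
Hypothesis dS : double_occurrence_word S.
Hypothesis dr : drawing S pred0 L side ps.

(** Passes become tents. Alternating feet of two letters on one side would mean letters interlaced
    in [L] with equal [side]. The two tents of one letter join the same two positions, each with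
    feet of equal parity, so their feet alternate and they cross. *)
Theorem drawing_realizable : realizable R S.
Proof.
have [pL sideL mps uqps [chps okps _]] := dr.
have dL : double_occurrence_word L.
  by move=> x; rewrite (perm_mem pL) (permP pL); exact: dS.
have sps : size ps = size S by rewrite -mps size_map.
have sL : size L = size S by exact: perm_size.
set N := size S in sps sL chps.
pose p0 := (z0, (0, 0)).
(* Index [N] is the closing tent, from the end [2N+1] of the chain back to its start 0. It encloses
   all other tents and crosses none. *)
pose A k := if k < N then (nth p0 ps k).2.1 else N.*2.+1.
pose B k := if k < N then (nth p0 ps k).2.2 else 0.
pose up k := if k < N then side (nth z0 S k) else true.
have letter k : k < N -> (nth p0 ps k).1 = nth z0 S k.
  by move=> kN; rewrite -mps (nth_map p0) ?sps.
have ok k : k < N -> [/\ located L (nth z0 S k) (A k), located L (nth z0 S k) (B k),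
    position (A k) <> position (B k) & odd (A k) = odd (B k)].
  move=> kN; have := okps (nth p0 ps k); rewrite mem_nth ?sps // => /(_ isT).
  by rewrite /pass_ok letter //= /A /B kN => -[? ? []].
have AE k : k < N -> A k = nth 0 (endpoints ps) k.*2.
  by move=> kN; rewrite /A kN (nth_endpoints p0 _).1 ?sps.
have BE k : k < N -> B k = nth 0 (endpoints ps) k.*2.+1.
  by move=> kN; rewrite /B kN (nth_endpoints p0 _).2 ?sps.
have bound x c : located L x c -> 0 < c <= N.*2.
  by rewrite /located sL /position => /and3P[c0 cN _]; lia.
have nthE i j : i < N.*2 -> j < N.*2 ->
    (nth 0 (endpoints ps) i == nth 0 (endpoints ps) j) = (i == j).
  by move=> iN jN; rewrite nth_uniq ?size_endpoints ?sps.
have le_cases k : k <= N -> k = N \/ k < N.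
  by rewrite leq_eqVlt => /orP[/eqP|]; [left|right].
have AN : A N = N.*2.+1 by rewrite /A ltnn.
have BN : B N = 0 by rewrite /B ltnn.
have hA k : k < N -> 0 < A k <= N.*2 by move=> /ok[/bound].
have hB k : k < N -> 0 < B k <= N.*2 by move=> /ok[_ /bound].
have A_inj k l : k <= N -> l <= N -> A k = A l -> k = l.
  move=> /le_cases[->|kN] /le_cases[->|lN] //.
  - by move: (hA l lN) => + e; rewrite -e AN ltnn andbF.
  - by move: (hA k kN) => + e; rewrite e AN ltnn andbF.
  rewrite !AE // => /eqP; rewrite nthE ?ltn_double //.
  by move=> /eqP /double_inj.
have B_inj k l : k <= N -> l <= N -> B k = B l -> k = l.
  move=> /le_cases[->|kN] /le_cases[->|lN] //.
  - by move: (hB l lN) => + e; rewrite -e BN.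
  - by move: (hB k kN) => + e; rewrite e BN.
  rewrite !BE // => /eqP; rewrite nthE ?ltn_Sdouble //.
  by move=> /eqP [] /double_inj.
have A_neq_B k l : k <= N -> l <= N -> A k != B l.
  move=> /le_cases[->|kN] /le_cases[->|lN] //.
  - by rewrite AN BN.
  - by rewrite AN; move: (hB l lN); apply: contraTneq => <-; rewrite ltnn andbF.
  - by rewrite BN; move: (hA k kN); case: (A k).
  rewrite AE // BE // nthE ?ltn_double ?ltn_Sdouble //.
  by apply/eqP => /(congr1 odd); rewrite /= !odd_double.
have base k : k <= N -> baseline_step (B (previous N k)) (A k).
  move=> kN; have := chain_step p0 chps (_ : k <= size ps).
  rewrite sps => /(_ kN); rewrite /A /B; case: k kN => [|k] kN /=.
    by rewrite ltnn.
  by rewrite (kN : k < N).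
have natR k l : ((k%:R : R) < l%:R)%R = (k < l) by rewrite ltr_nat.
have loE k : lo R A B k = (minn (A k) (B k))%:R%R.
  rewrite /lo /a /b; case: (leqP (A k) (B k)) => h; [rewrite min_l|rewrite min_r];
    by rewrite ?ler_nat // ltnW.
have hiE k : hi R A B k = (maxn (A k) (B k))%:R%R.
  rewrite /hi /a /b; case: (leqP (A k) (B k)) => h; [rewrite max_r|rewrite max_l];
    by rewrite ?ler_nat // ltnW.
apply: (@tents_realizable R N A B up A_inj B_inj A_neq_B base T S z0 dS erefl).
  move=> k l kN lN; rewrite !loE !hiE !natR => eup c1 c2 c3.
  have kN' : k < N.
    case: (le_cases k kN) => // ek; move: c3; rewrite ek AN BN.
    case: (le_cases l lN) => [->|ll]; first by rewrite AN BN ltnn.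
    by move: (hA l ll) (hB l ll); move: (A l) (B l) => x y; clear; lia.
  have lN' : l < N by case: (le_cases l lN) => // el; move: c1; rewrite el AN BN minn0.
  split=> //; apply/eqP; apply: contraT => /eqP nkl.
  have [lak lbk pk ok'] := ok k kN'; have [lal lbl pl ol] := ok l lN'.
  have nth_loc x c : located L x c -> nth z0 L (position c) = x /\ position c < N.
    by rewrite /located sL => /and3P[_ cN /eqP]; rewrite (set_nth_default z0) ?sL.
  have nth_min x c d : located L x c -> located L x d ->
      located L x (minn c d) /\ located L x (maxn c d) by case: (leqP c d).
  have [lk hk] := nth_min _ _ _ lak lbk; have [ll hl] := nth_min _ _ _ lal lbl.
  have [n1 b1] := nth_loc _ _ lk; have [n2 b2] := nth_loc _ _ hk.
  have [n3 b3] := nth_loc _ _ ll; have [n4 b4] := nth_loc _ _ hl.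
  have mono c d : c < d -> nth z0 L (position c) <> nth z0 L (position d) ->
      position c < position d.
    move=> cd nq; rewrite ltn_neqAle; apply/andP; split; first by apply/eqP => e; rewrite e in nq.
    by move: cd; rewrite /position; clear; lia.
  have o1 := mono _ _ c1; rewrite n1 n3 in o1; have {}o1 := o1 nkl.
  have o2 := mono _ _ c2; rewrite n3 n2 in o2; have {}o2 := o2 (nesym nkl).
  have o3 := mono _ _ c3; rewrite n2 n4 in o3; have {}o3 := o3 nkl.
  have := interlace_nth (z0 := z0) dL o1 o2 o3.
  rewrite sL n1 n2 n3 n4 => /(_ b4 erefl erefl nkl) /sideL.
  rewrite !(perm_mem pL) !mem_nth // => /(_ isT isT).
  by move: eup; rewrite /up kN' lN' => ->; rewrite eqxx.
move=> k l kN lN nkl e; split; first by rewrite /up kN lN e.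
rewrite !loE !hiE !natR.
have [/and3P[a1 a2 a3] /and3P[a4 a5 a6] pk ok'] := ok k kN.
have [/and3P[b1 b2 b3] /and3P[b4 b5 b6] pl ol] := ok l lN.
move: a3 a6 b3 b6; rewrite !(set_nth_default z0) // -e => /eqP a3 /eqP a6 /eqP b3 /eqP b6.
have t1 := no_third_occurrence dL a2 a5 b2 (etrans a3 (esym a6)) (etrans a3 (esym b3)).
have t2 := no_third_occurrence dL a2 a5 b5 (etrans a3 (esym a6)) (etrans a3 (esym b6)).
have d1 : A k != A l by apply: contra_neq nkl => /A_inj -> //; exact: ltnW.
have d2 : B k != B l by apply: contra_neq nkl => /B_inj -> //; exact: ltnW.
have d3 := A_neq_B k l (ltnW kN) (ltnW lN).
have d4 := A_neq_B l k (ltnW lN) (ltnW kN).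
(* With common positions [i < j], one tent has feet [2i+1] and [2j+1] and the other [2i+2] and
   [2j+2]. *)
have order_cases x y z w : 0 < x -> 0 < y -> 0 < z -> 0 < w -> position x <> position y ->
    position z <> position w -> odd x = odd y -> odd z = odd w ->
    [|| position x == position y, position y == position z | position x == position z] ->
    [|| position x == position y, position y == position w | position x == position w] ->
    x != z -> y != w -> x != w -> z != y ->
    [&& minn x y < minn z w, minn z w < maxn x y & maxn x y < maxn z w] ||
    [&& minn z w < minn x y, minn x y < maxn z w & maxn z w < maxn x y].
  have pe i : 0 < i -> i = (position i).*2.+1 + ~~ odd i by rewrite /position; clear; lia.
  move=> /pe + /pe + /pe + /pe; move: (position x) (position y) (position z) (position w).
  move=> p q r v ex ey ez ew npq nrv oxy ozw; rewrite oxy in ex; rewrite ozw in ez.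
  move=> /or3P[] /eqP e1 /or3P[] /eqP e2; try (by case: npq); try (by case: nrv; rewrite -e1 -e2).
    move: (odd y) (odd w) ex ey ez ew => o1 o2 -> -> -> ->.
    by rewrite -e1 -e2; move: npq; clear; case: o1; case: o2 => /=; lia.
  move: (odd y) (odd w) ex ey ez ew => o1 o2 -> -> -> ->.
  by rewrite -e1 -e2; move: npq; clear; case: o1; case: o2 => /=; lia.
have := order_cases _ _ _ _ a1 a4 b1 b4 pk pl ok' ol t1 t2 d1 d2 d3 d4.
by case/orP=> /and3P; [left|right].
Qed.

End DrawingRealizable.

Lemma realizable_nil (R : realType) (T T' : choiceType) :
  realizable R ([::] : seq T) -> realizable R ([::] : seq T').
Proof.
move=> [f [gf [t0 [ori [ts [pt [H1 H2 H3 _ H5]]]]]]]; exists f; split=> //.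
by exists t0, ori, ts, (fun=> 0%R); split.
Qed.

Theorem gauss_realizable (R : realType) (T : choiceType) (S : seq T) (d : T -> bool) :
  double_occurrence_word S -> gauss_invariant (undup S) (interlace S) pred0 d ->
  realizable R S.
Proof.
move=> dS inv; case: S dS inv => [|z s] dS inv.
  (* The drawing argument needs a default letter and [T] may be empty; the empty word does not
     depend on the alphabet. *)
  apply: (@realizable_nil R unit).
  have dn : double_occurrence_word ([::] : seq unit) by [].
  have [|L [side [ps dr]]] := @gauss_drawing unit [::] (fun=> true) dn.
    by split=> // x y.
  exact: (drawing_realizable R tt dn dr).
have [L [side [ps dr]]] := gauss_drawing dS inv.
exact: (drawing_realizable R z dS dr).
Qed.

(* [lia] is exponential in the number of boolean hypotheses that it sees. *)
Ltac order_lia := match goal with order : _ /\ _ |- _ => clear -order; lia end.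

(** * Winding numbers and signed crossings of plane cycles *)

Section RayCrossing.
Variable R : realType.
Local Notation point := (R * R)%type.
Local Notation edge := (point * point)%type.
Local Notation ind b := (Posz (nat_of_bool b%R)).
Implicit Types (v w : point) (e f : edge).

Definition det v w := v.1 * w.2 - v.2 * w.1.

(* The signed number of crossings of the segment from [v] to [w] with the
   positive x-axis, the axis itself being counted in the upper half-plane. *)
Definition ray_crossing v w : int :=
  if (0 <= v.2) == (0 <= w.2) then 0
  else if 0 <= w.2 then ind (0 < det v w) else - ind (det v w < 0).

Lemma detC v w : det w v = - det v w.
Proof. by rewrite /det; ring. Qed.

Lemma ray_crossingC v w : ray_crossing w v = - ray_crossing v w.
Proof.
rewrite /ray_crossing eq_sym detC oppr_gt0 oppr_lt0.
by case: (0 <= v.2); case: (0 <= w.2); rewrite /= ?oppr0 ?opprK.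
Qed.

(** An open half-plane bounded by a line through the origin meets the x-axis either only on its
    positive part or not there at all, according to the sign of [p]; the crossing count becomes a
    difference of values at the end points. *)
Lemma ray_crossing_half (p q : R) v w : 0 < p * v.1 + q * v.2 -> 0 < p * w.1 + q * w.2 ->
  ray_crossing v w = ind (0 < p) * (ind (0 <= w.2) - ind (0 <= v.2)).
Proof.
have up (v' w' : point) : 0 < p * v'.1 + q * v'.2 -> 0 < p * w'.1 + q * w'.2 ->
    v'.2 < 0 -> 0 <= w'.2 -> (0 < det v' w') = (0 < p).
  move=> fv fw v0 w0; have d : 0 < p * det v' w' by rewrite /det; nra.
  apply/idP/idP => H.
    by rewrite -(pmulr_lgt0 _ H).
  by rewrite -(pmulr_rgt0 _ H).
move=> fv fw; rewrite /ray_crossing; case: (leP 0 v.2) => v0; case: (leP 0 w.2) => w0 /=.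
- by rewrite subrr mulr0.
- by rewrite -oppr_gt0 -detC up // sub0r mulrN1.
- by rewrite up // subr0 mulr1.
- by rewrite subrr mulr0.
Qed.

Definition circuit v0 v1 v2 v3 :=
  ray_crossing v0 v1 + ray_crossing v1 v2 + ray_crossing v2 v3 + ray_crossing v3 v0.

Lemma circuit_half (p q : R) v0 v1 v2 v3 :
  0 < p * v0.1 + q * v0.2 -> 0 < p * v1.1 + q * v1.2 ->
  0 < p * v2.1 + q * v2.2 -> 0 < p * v3.1 + q * v3.2 -> circuit v0 v1 v2 v3 = 0.
Proof.
by move=> h0 h1 h2 h3; rewrite /circuit !(@ray_crossing_half p q) //; ring.
Qed.

Lemma ray_crossing_pos v w : 0 < det v w -> ray_crossing v w = ind ((v.2 < 0) && (0 <= w.2)).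
Proof.
move=> d; rewrite /ray_crossing d (lt_gtF d).
by case: (leP 0 v.2); case: (leP 0 w.2).
Qed.

(** With positive turns the count is the number of cyclic passages from the lower to the upper
    half-plane. It could differ from 1 only if all four points lay in one half-plane or if they
    alternated; both are excluded by following the cotangent [x / y] around the cycle, where it
    would be strictly monotone. *)
Lemma circuit_pos v0 v1 v2 v3 : 0 < det v0 v1 -> 0 < det v1 v2 -> 0 < det v2 v3 ->
  0 < det v3 v0 -> circuit v0 v1 v2 v3 = 1.
Proof.
move=> d0 d1 d2 d3; rewrite /circuit !ray_crossing_pos //.
have slope v w : v.2 != 0 -> w.2 != 0 -> det v w = v.2 * w.2 * (v.1 / v.2 - w.1 / w.2).
  by move=> nv nw; rewrite /det; field; rewrite ?nv ?nw.
have dec v w : 0 < det v w -> 0 < v.2 * w.2 -> w.1 / w.2 < v.1 / v.2.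
  move=> d vw; have : v.2 * w.2 != 0 by rewrite gt_eqF.
  rewrite mulf_eq0 negb_or => /andP[nv nw]; move: d; rewrite slope // pmulr_rgt0 //.
  by rewrite subr_gt0.
have inc v w : 0 < det v w -> v.2 * w.2 < 0 -> v.1 / v.2 < w.1 / w.2.
  move=> d vw; have : v.2 * w.2 != 0 by rewrite lt_eqF.
  rewrite mulf_eq0 negb_or => /andP[nv nw]; move: d; rewrite slope // nmulr_rgt0 //.
  by rewrite subr_lt0.
have allpos w0 w1 w2 w3 : 0 < det w0 w1 -> 0 < det w1 w2 -> 0 < det w2 w3 -> 0 < det w3 w0 ->
    0 <= w0.2 -> 0 <= w1.2 -> 0 <= w2.2 -> 0 <= w3.2 -> False.
  move=> e0 e1 e2 e3 y0 y1 y2 y3.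
  have nz (u u' u'' : point) : 0 < det u u' -> 0 < det u' u'' -> 0 <= u.2 -> 0 <= u''.2 ->
      0 <= u'.2 -> 0 < u'.2.
    move=> h h' k k' k''; rewrite lt_neqAle k'' andbT; apply/eqP => z.
    move: h h'; rewrite /det -z => h h'; case: (ltP u'.1 0) => s; nra.
  have p1 := nz _ _ _ e0 e1 y0 y2 y1; have p2 := nz _ _ _ e1 e2 y1 y3 y2.
  have p3 := nz _ _ _ e2 e3 y2 y0 y3; have p0 := nz _ _ _ e3 e0 y3 y1 y0.
  have := dec _ _ e0 (mulr_gt0 p0 p1); have := dec _ _ e1 (mulr_gt0 p1 p2).
  have := dec _ _ e2 (mulr_gt0 p2 p3); have := dec _ _ e3 (mulr_gt0 p3 p0).
  by move: (w0.1 / _) (w1.1 / _) (w2.1 / _) (w3.1 / _) => A B C D; clear; lra.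
have allneg w0 w1 w2 w3 : 0 < det w0 w1 -> 0 < det w1 w2 -> 0 < det w2 w3 -> 0 < det w3 w0 ->
    w0.2 < 0 -> w1.2 < 0 -> w2.2 < 0 -> w3.2 < 0 -> False.
  move=> e0 e1 e2 e3 y0 y1 y2 y3.
  have m (y z : R) : y < 0 -> z < 0 -> 0 < y * z by move=> ? ?; nra.
  have := dec _ _ e0 (m _ _ y0 y1); have := dec _ _ e1 (m _ _ y1 y2).
  have := dec _ _ e2 (m _ _ y2 y3); have := dec _ _ e3 (m _ _ y3 y0).
  by move: (w0.1 / _) (w1.1 / _) (w2.1 / _) (w3.1 / _) => A B C D; clear; lra.
have alternate w0 w1 w2 w3 : 0 < det w0 w1 -> 0 < det w1 w2 -> 0 < det w2 w3 -> 0 < det w3 w0 ->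
    0 <= w0.2 -> w1.2 < 0 -> 0 <= w2.2 -> w3.2 < 0 -> False.
  move=> e0 e1 e2 e3 y0 y1 y2 y3.
  have nz (u u' u'' : point) : 0 < det u u' -> 0 < det u' u'' -> u.2 < 0 -> u''.2 < 0 ->
      0 <= u'.2 -> 0 < u'.2.
    move=> h h' k k' k''; rewrite lt_neqAle k'' andbT; apply/eqP => z.
    move: h h'; rewrite /det -z => h h'; case: (ltP u'.1 0) => s; nra.
  have p0 := nz _ _ _ e3 e0 y3 y1 y0; have p2 := nz _ _ _ e1 e2 y1 y3 y2.
  have m (y z : R) : 0 < y -> z < 0 -> y * z < 0 by move=> ? ?; nra.
  have m' (y z : R) : y < 0 -> 0 < z -> y * z < 0 by move=> ? ?; nra.
  have := inc _ _ e0 (m _ _ p0 y1); have := inc _ _ e1 (m' _ _ y1 p2).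
  have := inc _ _ e2 (m _ _ p2 y3); have := inc _ _ e3 (m' _ _ y3 p0).
  by move: (w0.1 / _) (w1.1 / _) (w2.1 / _) (w3.1 / _) => A B C D; clear; lra.
case: (leP 0 v0.2) => y0; case: (leP 0 v1.2) => y1; case: (leP 0 v2.2) => y2;
  case: (leP 0 v3.2) => y3 //=; exfalso.
- exact: allpos d0 d1 d2 d3 y0 y1 y2 y3.
- exact: alternate d0 d1 d2 d3 y0 y1 y2 y3.
- exact: alternate d1 d2 d3 d0 y1 y2 y3 y0.
- exact: allneg d0 d1 d2 d3 y0 y1 y2 y3.
Qed.

Lemma circuit_neg v0 v1 v2 v3 : det v0 v1 < 0 -> det v1 v2 < 0 -> det v2 v3 < 0 ->
  det v3 v0 < 0 -> circuit v0 v1 v2 v3 = -1.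
Proof.
move=> d0 d1 d2 d3; have := @circuit_pos v0 v3 v2 v1.
rewrite !(detC v1 v2, detC v2 v3, detC v3 v0, detC v0 v1) !oppr_gt0 => /(_ d3 d2 d1 d0) <-.
by rewrite /circuit (ray_crossingC v3 v0) (ray_crossingC v2 v3) (ray_crossingC v1 v2)
  (ray_crossingC v0 v1); ring.
Qed.

Definition sub v w : point := (v.1 - w.1, v.2 - w.2).

(* The winding number around 0 of [a - b] as [(a, b)] runs along the boundary of
   [e * f]: the signed number of crossings of the two segments. *)
Definition edge_crossing e f : int :=
  circuit (sub e.1 f.1) (sub e.2 f.1) (sub e.2 f.2) (sub e.1 f.2).

Definition line_separated e f := exists p q : R, forall a b,
  a = e.1 \/ a = e.2 -> b = f.1 \/ b = f.2 -> 0 < p * (a.1 - b.1) + q * (a.2 - b.2).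

Lemma line_separatedC e f : line_separated e f -> line_separated f e.
Proof.
move=> [p [q H]]; exists (- p), (- q) => a b ha hb.
have := H b a hb ha; lra.
Qed.

Lemma edge_crossing_separated e f : line_separated e f -> edge_crossing e f = 0.
Proof.
move=> [p [q H]]; apply: (@circuit_half p q); apply: H; by [left|right].
Qed.

Implicit Types (alpha beta : seq (int * edge)).

(** The boundary of the chain vanishes, tested against every function on points. *)
Definition is_cycle alpha := forall g : point -> int,
  \sum_(x <- alpha) x.1 * (g x.2.2 - g x.2.1) = 0.

Definition crossing_number alpha beta : int :=
  \sum_(x <- alpha) \sum_(y <- beta) x.1 * y.1 * edge_crossing x.2 y.2.

(** The four sides of the rectangle make [edge_crossing e f] a difference along [f] for fixed [e]
    plus a difference along [e] for fixed [f]. Summation over a cycle kills either part. *)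
Lemma crossing_number_cycles alpha beta : is_cycle alpha -> is_cycle beta ->
  crossing_number alpha beta = 0.
Proof.
move=> ca cb; rewrite /crossing_number.
pose G e b := ray_crossing (sub e.1 b) (sub e.2 b).
pose H f a := ray_crossing (sub a f.1) (sub a f.2).
have E e f : edge_crossing e f = - (G e f.2 - G e f.1) + (H f e.2 - H f e.1).
  rewrite /edge_crossing /circuit /G /H (ray_crossingC (sub e.1 f.2)).
  by rewrite (ray_crossingC (sub e.1 f.1) (sub e.1 f.2)); ring.
transitivity (\sum_(x <- alpha) \sum_(y <- beta)
    (- x.1 * (y.1 * (G x.2 y.2.2 - G x.2 y.2.1)) + y.1 * (x.1 * (H y.2 x.2.2 - H y.2 x.2.1)))).
  by apply: eq_bigr => x _; apply: eq_bigr => y _; rewrite E; ring.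
under eq_bigr => x _ do rewrite big_split /= -mulr_sumr cb mulr0 add0r.
rewrite exchange_big /= big1 // => y _; rewrite -mulr_sumr.
by rewrite (ca (H y.2)) mulr0.
Qed.

End RayCrossing.

(** * Crossing identities for a closed plane curve with transverse double points *)

Section Curve.
Variables (R : realType) (gx gy : R -> R) (N : nat) (tau : nat -> R) (mate : rel nat).
Variables (dx dy : nat -> R).
Implicit Types (p q c r s t : R) (b : bool) (k l m n : nat).

Definition inner m := (0 < m <= N)%N.
Definition jac m n := dx m * dy n - dy m * dx n.

Hypotheses (tau0 : tau 0 = 0) (tauN : tau N.+1 = 1).
Hypothesis tau_lt : forall k, (k <= N)%N -> tau k < tau k.+1.
Hypotheses (cgx : continuous gx) (cgy : continuous gy).
Hypothesis dgx : forall m, inner m -> is_derive (tau m) 1 gx (dx m).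
Hypothesis dgy : forall m, inner m -> is_derive (tau m) 1 gy (dy m).
Hypothesis closed_x : gx 0 = gx 1.
Hypothesis closed_y : gy 0 = gy 1.
Hypothesis mate_sym : symmetric mate.
Hypothesis mate_uniq : forall m n n', mate m n -> mate m n' -> n = n'.
Hypothesis has_mate : forall m, inner m -> exists2 n, inner n & mate m n.
Hypothesis mate_eq : forall m n, inner m -> inner n -> mate m n ->
  [/\ m != n, gx (tau m) = gx (tau n), gy (tau m) = gy (tau n) & jac m n != 0].
Hypothesis coincide : forall s t, 0 <= s -> s < t -> t <= 1 -> gx s = gx t -> gy s = gy t ->
  (s = 0 /\ t = 1) \/ exists m n, [/\ inner m, inner n, mate m n, s = tau m & t = tau n].

Definition point_at t : R * R := (gx t, gy t).
Definition phi p q (P : R * R) := p * P.1 + q * P.2.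
Definition sgb b : R := if b then 1 else -1.

Lemma sep_threshold (e f : (R * R) * (R * R)) p q c :
  (forall x, x = e.1 \/ x = e.2 -> c < phi p q x) ->
  (forall x, x = f.1 \/ x = f.2 -> phi p q x < c) -> line_separated e f.
Proof.
move=> he hf; exists p, q => x y hx hy; have := he x hx; have := hf y hy.
by rewrite /phi; lra.
Qed.

Lemma phi_gt p q c s : c < phi p q (point_at s) ->
  exists r, 0 < r /\ forall s', `|s' - s| < r -> c < phi p q (point_at s').
Proof.
move=> H; have cv : phi p q (point_at s') @[s' --> s] --> phi p q (point_at s).
  by apply: cvgD; (apply: cvgM; first exact: cvg_cst); [exact: cgx|exact: cgy].
have /nbhs_ballP[r /= r0 Hr] : \forall s' \near s, c < phi p q (point_at s').
  exact: (@cvgr_gt _ _ _ _ _ _ cv).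
by exists r; split=> // s' s'r; apply: Hr; rewrite /ball /= distrC.
Qed.

Lemma phiN p q P : phi (- p) (- q) P = - phi p q P.
Proof. by rewrite /phi; ring. Qed.

Lemma phi_lt p q c s : phi p q (point_at s) < c ->
  exists r, 0 < r /\ forall s', `|s' - s| < r -> phi p q (point_at s') < c.
Proof.
rewrite -ltrN2 -phiN => /phi_gt [r [r0 Hr]]; exists r; split=> // s' /Hr.
by rewrite phiN ltrN2.
Qed.

Lemma far_threshold (P Q : R * R) : P <> Q -> exists p q c, c < phi p q P /\ phi p q Q < c.
Proof.
case: P Q => x y [x' y'] nPQ; rewrite /phi /=.
have [xx|xx|exx] := ltrgtP x x'.
- by exists (-1), 0, (- ((x + x') / 2)); lra.
- by exists 1, 0, ((x + x') / 2); lra.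
have [yy|yy|eyy] := ltrgtP y y'.
- by exists 0, (-1), (- ((y + y') / 2)); lra.
- by exists 0, 1, ((y + y') / 2); lra.
by case: nPQ; rewrite exx eyy.
Qed.

Lemma derive_phi p q m : inner m ->
  is_derive (tau m) 1 (fun t => phi p q (point_at t)) (p * dx m + q * dy m).
Proof.
move=> im; have := is_derive_add (is_derive_mul (is_derive_const _ p) (dgx im))
  (is_derive_mul (is_derive_const _ q) (dgy im)).
by congr is_derive; ring.
Qed.

Lemma phi_germ p q m e : inner m -> 0 < e -> exists r, 0 < r /\ forall s, `|s - tau m| < r ->
  `|phi p q (point_at s) - phi p q (point_at (tau m)) - (p * dx m + q * dy m) * (s - tau m)| <= e * `|s - tau m|.
Proof.
move=> im e0; have /is_deriveP/(_ e e0)/nbhs_ballP[r /= r0 Hr] := derive_phi p q im.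
by exists r; split=> // s sr; apply: Hr; rewrite /ball /= distrC.
Qed.

Lemma sgb2 b : sgb b = 1 \/ sgb b = -1. Proof. by case: b; [left|right]. Qed.

Definition on_half m b s := 0 < sgb b * (s - tau m).

Lemma phi_side p q m b : inner m -> p * dx m + q * dy m = sgb b ->
  exists r, 0 < r /\ forall s, `|s - tau m| < r ->
    (on_half m b s -> phi p q (point_at (tau m)) < phi p q (point_at s)) /\
    (on_half m (~~ b) s -> phi p q (point_at s) < phi p q (point_at (tau m))).
Proof.
move=> im d; have h0 : 0 < 2^-1 :> R by lra.
have [r [r0 Hr]] := phi_germ p q im h0; exists r; split=> // s /Hr; rewrite d /on_half.
move: (phi p q (point_at s)) (phi p q (point_at (tau m))) (s - tau m) => x y u.
have [u0|u0] := leP 0 u; rewrite ?(ger0_norm u0) ?(ltr0_norm u0) ler_norml => /andP[h1 h2];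
  by move: h1 h2; case: b {d}; rewrite /sgb /= => h1 h2; split=> h3; lra.
Qed.

Lemma dual_functional m n (a a' : R) : inner m -> inner n -> mate m n -> exists p q,
  p * dx m + q * dy m = a /\ p * dx n + q * dy n = a'.
Proof.
move=> im jn mn; have [_ _ _ j0] := mate_eq im jn mn.
exists ((a * dy n - a' * dy m) / jac m n), ((a' * dx m - a * dx n) / jac m n).
by move: j0; rewrite /jac => j0; split; field.
Qed.

(** The two velocities are independent, so a linear functional can be made to increase along one
    chosen half-branch of each strand; it separates these two half-branches from the other two. *)
Lemma germ_threshold m n b b' : inner m -> inner n -> mate m n -> exists p q c r,
  0 < r /\ forall s,
  [/\ `|s - tau m| < r -> on_half m b s -> c < phi p q (point_at s),
      `|s - tau m| < r -> on_half m (~~ b) s -> phi p q (point_at s) < c,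
      `|s - tau n| < r -> on_half n b' s -> c < phi p q (point_at s) &
      `|s - tau n| < r -> on_half n (~~ b') s -> phi p q (point_at s) < c].
Proof.
move=> im jn mn; have [p [q [d1 d2]]] := dual_functional (sgb b) (sgb b') im jn mn.
have [_ ex ey _] := mate_eq im jn mn.
have [r1 [r10 H1]] := phi_side im d1; have [r2 [r20 H2]] := phi_side jn d2.
exists p, q, (phi p q (point_at (tau m))), (Num.min r1 r2).
rewrite lt_min r10 r20; split=> // s.
have e : phi p q (point_at (tau m)) = phi p q (point_at (tau n)) by rewrite /phi /point_at /= ex ey.
split; rewrite lt_min => /andP[s1 s2].
- exact: (H1 s s1).1.
- exact: (H1 s s1).2.
- by rewrite e; exact: (H2 s s2).1.
- by rewrite e; exact: (H2 s s2).2.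
Qed.

Lemma tau_mono k l : (k <= l)%N -> (l <= N.+1)%N -> tau k <= tau l.
Proof.
move=> kl; elim: l kl => [|l IH]; first by rewrite leqn0 => /eqP ->.
rewrite leq_eqVlt => /orP[/eqP -> //|kl] lN.
by apply: le_trans (ltW (tau_lt lN)); apply: IH => //; exact: ltnW.
Qed.

Lemma tau_smono k l : (k < l)%N -> (l <= N.+1)%N -> tau k < tau l.
Proof.
move=> kl lN; apply: lt_le_trans (tau_mono kl lN).
by apply: tau_lt; rewrite -ltnS; exact: leq_trans lN.
Qed.

Lemma tau_inj k l : (k <= N.+1)%N -> (l <= N.+1)%N -> tau k = tau l -> k = l.
Proof.
move=> kN lN e; have [kl|lk|//] := ltngtP k l.
  by have := tau_smono kl lN; rewrite e ltxx.
by have := tau_smono lk kN; rewrite e ltxx.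
Qed.

Lemma tau_itv k : (k <= N.+1)%N -> 0 <= tau k <= 1.
Proof.
move=> kN; have := tau_mono (leq0n k) kN; have := tau_mono kN (leqnn _).
by rewrite tau0 tauN; lra.
Qed.

Lemma inner_itv m : inner m -> 0 < tau m < 1.
Proof.
move=> /andP[m0 mN]; have := tau_smono m0 (leqW mN).
by have := tau_smono (mN : (m < N.+1)%N) (leqnn _); rewrite tau0 tauN; lra.
Qed.

Lemma tau_block k m : (k <= N)%N -> inner m -> tau k <= tau m <= tau k.+1 ->
  m = k \/ m = k.+1.
Proof.
move=> kN /andP[m0 mN] /andP[km mk].
have h1 : (k <= m)%N.
  by rewrite leqNgt; apply/negP => mk'; move: km; rewrite leNgt tau_smono ?leqW.
have h2 : (m <= k.+1)%N.
  by rewrite leqNgt; apply/negP => mk'; move: mk; rewrite leNgt tau_smono ?leqW.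
by move: h1 h2; lia.
Qed.

(** Blocks are trimmed at double points only, and not at the base point, where the curve closes
    up. *)
Definition block_start k (e : R) := if k == 0%N then 0 else tau k + e.
Definition block_end k (e : R) := if k == N then 1 else tau k.+1 - e.

Lemma block_half k m e s : (k <= N)%N -> inner m -> 0 < e -> block_start k e <= s <= block_end k e ->
  m = k \/ m = k.+1 -> on_half m (m == k) s /\ e <= `|s - tau m|.
Proof.
move=> kN /andP[m0 mN] e0; rewrite /block_start /block_end /on_half => /andP[s1 s2] [emk|emk].
  rewrite emk eqxx /sgb; move: s1; rewrite -emk (gtn_eqF m0) => s1.
  by split; [lra|rewrite ger0_norm; lra].
have -> : (m == k) = false by rewrite emk gtn_eqF.
move: s2; rewrite ltn_eqF -?emk // => s2.
by rewrite /sgb; split; [lra|rewrite ler0_norm; lra].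
Qed.

Lemma same_image s t : 0 <= s <= 1 -> 0 <= t <= 1 -> point_at s = point_at t -> s = t \/
  [\/ s = 0 /\ t = 1, s = 1 /\ t = 0 |
      exists m n, [/\ inner m, inner n, mate m n, s = tau m & t = tau n]].
Proof.
move=> /andP[s0 s1] /andP[t0 t1] [ex ey]; have [st|ts|] := ltrgtP s t; last by left.
  by right; case: (coincide s0 st t1 ex ey) => [?|H]; [constructor 1|constructor 3].
right; case: (coincide t0 ts s1 (esym ex) (esym ey)) => [[? ?]|[m [n [im jn mn es et]]]].
  by constructor 2.
by constructor 3; exists n, m; rewrite mate_sym.
Qed.

Lemma near_cover (K : set R) (P : R -> R -> Prop) : compact K ->
  (forall t, K t -> exists d h, [/\ 0 < d, 0 < h &
     forall t' e, `|t' - t| < d -> 0 < e < h -> P e t']) ->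
  \forall e \near 0^'+, forall t, K t -> P e t.
Proof.
move=> /compact_near_coveringP cK H; have := cK R 0^'+ P _; apply=> t /H [d [h [d0 h0 Hd]]].
exists (ball t d, [set e | 0 < e < h]); first split=> /=.
- exact: nbhsx_ballx.
- by near=> e; apply/andP; split; near: e; [exact: nbhs_right_gt|exact: nbhs_right_lt].
by move=> [t' e] [/= td e0]; apply: Hd => //; rewrite distrC.
Unshelve. all: by end_near. Qed.

Lemma near_cover2 (K L : set R) (P : R -> R -> R -> Prop) : compact K -> compact L ->
  (forall s t, K s -> L t -> exists d h, [/\ 0 < d, 0 < h &
     forall s' t' e, `|s' - s| < d -> `|t' - t| < d -> 0 < e < h -> P e s' t']) ->
  \forall e \near 0^'+, forall s t, K s -> L t -> P e s t.
Proof.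
move=> cK cL H; have /compact_near_coveringP cKL := compact_setX cK cL.
have := cKL R 0^'+ (fun e x => P e x.1 x.2) _.
have HH : \forall e \near 0^'+, K `*` L `<=` (fun x => P e x.1 x.2).
  apply: cKL => -[s t] [/= Ks Lt]; have [d [h [d0 h0 Hd]]] := H s t Ks Lt.
  by apply: (near_box d0 h0) => s' t' e; apply: Hd.
by move=> _; apply: filterS HH => e He s t Ks Lt; exact: (He (s, t)).
Qed.

Lemma block_compact k : compact [set s | tau k <= s <= tau k.+1].
Proof.
exact: (@segment_compact R (tau k) (tau k.+1)).
Qed.

Definition near_edge (e : R) k s s0 s1 :=
  [/\ `|s0 - s| < e, `|s1 - s| < e, block_start k e <= s0 <= block_end k e & block_start k e <= s1 <= block_end k e].

(** By compactness it suffices to separate near each pair of times. Distinct images are separated by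
    continuity, equal images by [germ_threshold]; the excluded pair of blocks shares the base
    point. *)
Lemma separated_blocks k l : (k < l)%N -> (l <= N)%N -> ~~ ((k == 0%N) && (l == N)) ->
  \forall e \near 0^'+, forall s t, tau k <= s <= tau k.+1 -> tau l <= t <= tau l.+1 ->
    forall s0 s1 t0 t1, near_edge e k s s0 s1 -> near_edge e l t t0 t1 ->
    line_separated (point_at s0, point_at s1) (point_at t0, point_at t1).
Proof.
move=> kl lN n0N; have kN : (k <= N)%N by apply: leq_trans lN; exact: ltnW.
apply: (near_cover2 (P := fun e s t => forall s0 s1 t0 t1, near_edge e k s s0 s1 ->
  near_edge e l t t0 t1 -> line_separated (point_at s0, point_at s1) (point_at t0, point_at t1))
  (@block_compact k) (@block_compact l)) => s t /= sk tl.
suff [p [q [c [r [r0 Hr]]]]] : exists p q c r, 0 < r /\ forall s' t' e, 0 < e ->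
    (`|s' - s| < r -> block_start k e <= s' <= block_end k e -> c < phi p q (point_at s')) /\
    (`|t' - t| < r -> block_start l e <= t' <= block_end l e -> phi p q (point_at t') < c).
  exists (r / 2), (r / 2); split; try lra.
  move=> s' t' e ds dt /andP[e0 er] s0 s1 t0 t1 [a1 a2 a3 a4] [b1 b2 b3 b4].
  have tri (x y z : R) : `|x - y| < e -> `|y - z| < r / 2 -> `|x - z| < r.
    by move=> h1 h2; have := ler_distD y x z; lra.
  apply: (@sep_threshold _ _ p q c) => x [] -> /=.
  - by apply: (Hr s0 t e e0).1 => //; apply: tri ds.
  - by apply: (Hr s1 t e e0).1 => //; apply: tri ds.
  - by apply: (Hr s t0 e e0).2 => //; apply: tri dt.
  - by apply: (Hr s t1 e e0).2 => //; apply: tri dt.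
have s01 : 0 <= s <= 1.
  have /andP[h1 _] := tau_itv (leqW kN); have /andP[_ h2] := tau_itv (kN : (k.+1 <= N.+1)%N).
  by move: sk; lra.
have t01 : 0 <= t <= 1.
  have /andP[h1 _] := tau_itv (leqW lN); have /andP[_ h2] := tau_itv (lN : (l.+1 <= N.+1)%N).
  by move: tl; lra.
have [/(@same_image s t s01 t01)|/far_threshold [p [q [c [/phi_gt [r1 [r10 H1]] /phi_lt [r2 [r20 H2]]]]]]] :=
  pselect (point_at s = point_at t); last first.
  exists p, q, c, (Num.min r1 r2); rewrite lt_min r10 r20; split=> // s' t' e e0.
  by rewrite !lt_min; split=> /andP[h1 h2] _; [exact: H1|exact: H2].
have skl := tau_mono kl (leqW lN).
case=> [est|[[s0 t1]|[s1 t0]|[m [n [im jn mn es et]]]]].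
- have els : tau k.+1 = tau l by move: sk tl; rewrite est; lra.
  have el : k.+1 = l by apply: tau_inj els; rewrite ?ltnS // leqW.
  have il : inner l by rewrite /inner lN -el.
  have esl : s = tau l by move: sk tl; rewrite est; lra.
  have [n jn ln] := has_mate il.
  (* Adjacent blocks meet in time at [tau l]: one lies before and the other after it on the same
     strand. *)
  have [p [q [c [r [r0 Hr]]]]] := germ_threshold false false il jn ln.
  exists p, q, c, r; split=> // s' t' e e0; rewrite -est esl; split=> h1 h2.
    have [h3 _] := block_half kN il e0 h2 (or_intror (esym el)).
    rewrite -el gtn_eqF // in h3; rewrite el in h3.
    by have [H _ _ _] := Hr s'; exact: H.
  have [h3 _] := block_half lN il e0 h2 (or_introl erefl).
  by rewrite eqxx in h3; have [_ H _ _] := Hr t'; exact: H.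
- case/negP: n0N; apply/andP; split; apply/eqP.
    apply: (@tau_inj k 0%N) => //; first exact: leqW.
    by rewrite tau0; have := tau_itv (leqW kN); move: sk; rewrite s0; lra.
  apply/eqP; rewrite eqn_leq lN /= -ltnS leqNgt; apply/negP => lN'.
  have := tau_smono (lN' : (l.+1 < N.+1)%N) (leqnn _); rewrite tauN.
  by move: tl; rewrite t1; lra.
- have := tau_smono (ltn0Sn k) (kN : (k.+1 <= N.+1)%N); rewrite tau0.
  by move: sk tl; rewrite s1 t0; lra.
have mk : m = k \/ m = k.+1 by apply: tau_block; rewrite -?es.
have nl : n = l \/ n = l.+1 by apply: tau_block; rewrite -?et.
(* Block [k] leaves [tau m] forwards exactly when [m = k], and that half is put above the threshold;
   the half of block [l] at [tau n] is put below. *)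
have [p [q [c [r [r0 Hr]]]]] := germ_threshold (m == k) (~~ (n == l)) im jn mn.
exists p, q, c, r; split=> // s' t' e e0; rewrite es et; split=> h1 h2.
  have [h3 _] := block_half kN im e0 h2 mk.
  by have [H _ _ _] := Hr s'; exact: H.
have [h3 _] := block_half lN jn e0 h2 nl.
by have [_ _ _ H] := Hr t'; apply: H => //; rewrite negbK.
Qed.

Lemma near_right (P : R -> Prop) : (exists r, 0 < r /\ forall e, 0 < e < r -> P e) ->
  \forall e \near 0^'+, P e.
Proof.
move=> [r [r0 Pr]]; near=> e; apply: Pr; apply/andP; split; near: e.
  exact: nbhs_right_gt.
exact: nbhs_right_lt.
Unshelve. all: by end_near. Qed.

(* [(m, true)] and [(m, false)] are the points shortly after and shortly before
   the time [tau m]. *)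
Definition half_time e (h : nat * bool) := tau h.1 + sgb h.2 * e.
Definition node e h := point_at (half_time e h).

Lemma half_time_dist e h : 0 < e -> `|half_time e h - tau h.1| = e.
Proof.
move=> e0; rewrite /half_time addrC addKr; case: h.2; rewrite /sgb ?mul1r ?mulN1r ?normrN;
  exact: gtr0_norm.
Qed.

Lemma half_timeK e h : 0 < e -> sgb h.2 * (half_time e h - tau h.1) = e.
Proof. by rewrite /half_time /sgb; case: h.2; lra. Qed.

Definition is_link (h h' : nat * bool) :=
  [&& inner h.1, inner h'.1 & ((h.1 == h'.1) && (h.2 != h'.2)) || mate h.1 h'.1].
Definition off_block k (h : nat * bool) := (h != (k, true)) && (h != (k.+1, false)).

Lemma mates_g m n : inner m -> inner n -> mate m n -> point_at (tau m) = point_at (tau n).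
Proof. by move=> im jn mn; have [_ ex ey _] := mate_eq im jn mn; rewrite /point_at ex ey. Qed.

Lemma is_link_g h h' : is_link h h' -> point_at (tau h.1) = point_at (tau h'.1).
Proof. by case/and3P=> im jn /orP[/andP[/eqP -> //]|]; exact: mates_g. Qed.

Lemma same_point t m : inner m -> 0 <= t <= 1 -> point_at t = point_at (tau m) ->
  exists j, [/\ inner j, t = tau j & j = m \/ mate m j].
Proof.
move=> im t01 gt; have m01 := inner_itv im.
have m01' : 0 <= tau m <= 1 by lra.
case: (same_image t01 m01' gt) => [et|[[_ em]|[_ em]|[j [n [ij jn mj et em]]]]].
- by exists m; split=> //; left.
- by move: m01; rewrite em; lra.
- by move: m01; rewrite em; lra.
exists j; split=> //; right.
have -> : m = n by apply: tau_inj em; apply: leqW; case/andP: im => //; case/andP: jn.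
by rewrite mate_sym.
Qed.

(** A half-branch at the double point that is not an end of the link can be made to rise at unit
    speed while neither end of the link rises to first order. *)
Lemma escape_functional h h' j b : is_link h h' -> inner j -> j = h.1 \/ mate h.1 j ->
  (j, b) != h -> (j, b) != h' -> exists p q, [/\ p * dx j + q * dy j = sgb b,
    sgb h.2 * (p * dx h.1 + q * dy h.1) <= 0 & sgb h'.2 * (p * dx h'.1 + q * dy h'.1) <= 0].
Proof.
case: h h' => m b1 [n b2] /and3P[/= im jn mn] ij mj.
rewrite !xpair_eqE.
case/orP: mn => [/andP[/eqP emn b12]|mn].
  case: mj => [->|mj]; first by rewrite -emn eqxx; case: b b1 b2 b12 => -[] [].
  have [p [q [h1 h2]]] := dual_functional 0 (sgb b) im ij mj.
  by exists p, q; rewrite -emn h1 h2 !mulr0.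
have [p [q [h1 h2]]] := dual_functional (- sgb b1) (- sgb b2) im jn mn.
have ss b0 : sgb b0 * - sgb b0 <= 0 by rewrite /sgb; case: b0; lra.
have nb b0 : ~~ (b == b0) -> - sgb b0 = sgb b by rewrite /sgb; case: b b0 => -[] //=; rewrite opprK.
case: mj => [ej|mj].
  rewrite ej eqxx /= => /nb e1 _; exists p, q; split; rewrite ?h1 ?h2 //.
have ej : j = n by apply: mate_uniq mj mn.
rewrite ej eqxx /= => _ /nb e1; exists p, q; split; rewrite ?h1 ?h2 //.
Qed.

Lemma separated_block_link l h h' : (l <= N)%N -> is_link h h' ->
  off_block l h -> off_block l h' ->
  \forall e \near 0^'+, forall t, tau l <= t <= tau l.+1 ->
    forall t0 t1, near_edge e l t t0 t1 -> line_separated (point_at t0, point_at t1) (node e h, node e h').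
Proof.
move=> lN lh hl hl'; have eg := is_link_g lh; have /and3P[im jn _] := lh.
apply: (near_cover (P := fun e t => forall t0 t1, near_edge e l t t0 t1 ->
  line_separated (point_at t0, point_at t1) (node e h, node e h')) (@block_compact l)) => t /= tl.
have t01 : 0 <= t <= 1.
  have /andP[h1 _] := tau_itv (leqW lN); have /andP[_ h2] := tau_itv (lN : (l.+1 <= N.+1)%N).
  by move: tl; lra.
have tri e r (x y z : R) : e < r / 2 -> `|x - y| < e -> `|y - z| < r / 2 -> `|x - z| < r.
  by move=> h0 h1 h2; have := ler_distD y x z; lra.
have [/(same_point im t01) [j [ij et mj]]|/far_threshold [p [q [c [/phi_gt [r1 [r10 H1]] H2]]]]] :=
    pselect (point_at t = point_at (tau h.1)); last first.
  have [r2 [r20 H2m]] := phi_lt H2; rewrite eg in H2; have [r3 [r30 H2n]] := phi_lt H2.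
  exists (r1 / 2), (Num.min (r1 / 2) (Num.min r2 r3)); rewrite !lt_min r20 r30 divr_gt0 //.
  split=> // t' e dt; rewrite !lt_min => /andP[e0 /and3P[e1 e2 e3]] t0 t1 [a1 a2 _ _].
  apply: (@sep_threshold _ _ p q c) => x [] -> /=.
  - by apply: H1; apply: tri e1 a1 dt.
  - by apply: H1; apply: tri e1 a2 dt.
  - by apply: H2m; rewrite half_time_dist.
  - by apply: H2n; rewrite half_time_dist.
have jl : j = l \/ j = l.+1 by apply: tau_block; rewrite -?et.
have off h0 : off_block l h0 -> (j, j == l) != h0.
  case/andP=> n1 n2; rewrite eq_sym; case: jl => ->; rewrite ?eqxx //.
  by rewrite (gtn_eqF (ltnSn l)).
have [p [q [d d1 d2]]] := escape_functional lh ij mj (off _ hl) (off _ hl').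
have q0 : 0 < 4^-1 :> R by lra.
have [r1 [r10 H1]] := phi_germ p q ij q0.
have [r2 [r20 H2]] := phi_germ p q im q0.
have [r3 [r30 H3]] := phi_germ p q jn q0.
exists (r1 / 2), (Num.min (r1 / 2) (Num.min r2 r3)); rewrite !lt_min r20 r30 divr_gt0 //.
split=> // t' e dt; rewrite !lt_min => /andP[e0 /and3P[e1 e2 e3]] t0 t1 [a1 a2 a3 a4].
rewrite et in dt.
have ej : phi p q (point_at (tau j)) = phi p q (point_at (tau h.1)).
  by case: mj => [->//|mj]; rewrite (mates_g im ij mj).
(* With relative error 1/4, a block point at time distance at least [e] rises by at least three
   quarters of [e], a link end by at most a quarter; the threshold is at one half. *)
have block s : `|s - t'| < e -> block_start l e <= s <= block_end l e ->
    phi p q (point_at (tau j)) + e / 2 < phi p q (point_at s).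
  move=> s1 s2; have := H1 s (tri _ _ _ _ _ e1 s1 dt).
  have [] := block_half lN ij e0 s2 jl; rewrite /on_half d.
  move: (phi p q (point_at s)) (phi p q (point_at (tau j))) (s - tau j) => x y u.
  have [u0|u0] := leP 0 u; rewrite ?(ger0_norm u0) ?(ltr0_norm u0) => k1 k2;
    rewrite ler_norml => /andP[k3 k4];
    by move: k1 k3 k4; rewrite /sgb; case: (j == l) => k1 k3 k4; lra.
have link h0 D r : D = p * dx h0.1 + q * dy h0.1 -> e < r -> sgb h0.2 * D <= 0 ->
    phi p q (point_at (tau h0.1)) = phi p q (point_at (tau j)) ->
    (forall s, `|s - tau h0.1| < r -> `|phi p q (point_at s) - phi p q (point_at (tau h0.1)) -
      (p * dx h0.1 + q * dy h0.1) * (s - tau h0.1)| <= 4^-1 * `|s - tau h0.1|) ->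
    phi p q (node e h0) < phi p q (point_at (tau j)) + e / 2.
  move=> eD er D0 -> /(_ (half_time e h0)); rewrite half_time_dist // -eD => /(_ er).
  rewrite /node ler_norml => /andP[_].
  have -> : half_time e h0 - tau h0.1 = sgb h0.2 * e by rewrite /half_time; ring.
  rewrite mulrA (mulrC D) => k1.
  have : sgb h0.2 * D * e <= 0 by rewrite pmulr_lle0.
  by lra.
apply: (@sep_threshold _ _ p q (phi p q (point_at (tau j)) + e / 2)) => x [] -> /=.
- exact: block.
- exact: block.
- by apply: link d1 _ H2.
- by apply: link d2 _ H3 => //; rewrite -eg.
Qed.

Lemma separated_links h1 h1' h2 h2' : is_link h1 h1' -> is_link h2 h2' ->
  h1.1 != h2.1 -> ~~ mate h1.1 h2.1 ->
  \forall e \near 0^'+, line_separated (node e h1, node e h1') (node e h2, node e h2').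
Proof.
move=> l1 l2 n12 nm12; have /and3P[i1 i1' _] := l1; have /and3P[i2 i2' _] := l2.
have eg1 := is_link_g l1; have eg2 := is_link_g l2.
have : point_at (tau h1.1) <> point_at (tau h2.1).
  have i01 : 0 <= tau h2.1 <= 1 by have := inner_itv i2; lra.
  move=> /esym /(same_point i1 i01) [j [ij et [ej|mj]]].
    case/eqP: n12; apply: tau_inj; rewrite -?ej //; apply: leqW; first by case/andP: ij.
    by case/andP: i2.
  case/negP: nm12; suff -> : h2.1 = j by [].
  by apply: tau_inj et; apply: leqW; [case/andP: i2|case/andP: ij].
move=> /far_threshold [p [q [c [H1 H2]]]].
have [r1 [r10 K1]] := phi_gt H1; rewrite eg1 in H1; have [r2 [r20 K2]] := phi_gt H1.
have [r3 [r30 K3]] := phi_lt H2; rewrite eg2 in H2; have [r4 [r40 K4]] := phi_lt H2.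
apply: near_right; exists (Num.min (Num.min r1 r2) (Num.min r3 r4)).
rewrite !lt_min r10 r20 r30 r40; split=> // e; rewrite !lt_min => /andP[e0 /andP[/andP[e1 e2] /andP[e3 e4]]].
apply: (@sep_threshold _ _ p q c) => x [] -> /=.
- by apply: K1; rewrite half_time_dist.
- by apply: K2; rewrite half_time_dist.
- by apply: K3; rewrite half_time_dist.
- by apply: K4; rewrite half_time_dist.
Qed.

Lemma separated_corners m n b b' : inner m -> inner n -> mate m n ->
  \forall e \near 0^'+, line_separated (node e (m, b), node e (n, b'))
    (node e (n, ~~ b'), node e (m, ~~ b)).
Proof.
move=> im jn mn; have [p [q [c [r [r0 Hr]]]]] := germ_threshold b b' im jn mn.
apply: near_right; exists r; split=> // e /andP[e0 er].
have half h : on_half h.1 h.2 (half_time e h) by rewrite /on_half half_timeK.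
apply: (@sep_threshold _ _ p q c) => x [] -> /=.
- have [H _ _ _] := Hr (half_time e (m, b)).
  by apply: H (half (m, b)); rewrite (half_time_dist (m, b)).
- have [_ _ H _] := Hr (half_time e (n, b')).
  by apply: H (half (n, b')); rewrite (half_time_dist (n, b')).
- have [_ _ _ H] := Hr (half_time e (n, ~~ b')).
  by apply: H (half (n, ~~ b')); rewrite (half_time_dist (n, ~~ b')).
- have [_ H _ _] := Hr (half_time e (m, ~~ b)).
  by apply: H (half (m, ~~ b)); rewrite (half_time_dist (m, ~~ b)).
Qed.

(** The sign is opposite to that of [jac] because [edge_crossing] follows [a - b], in which the
    second velocity enters negatively. *)
Definition strand_sign m n : int := if mate m n then (if 0 < jac m n then -1 else 1) else 0.

Lemma strand_signC m n : inner m -> inner n -> strand_sign n m = - strand_sign m n.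
Proof.
move=> im jn; rewrite /strand_sign mate_sym; have [mn|] := boolP (mate m n); last by rewrite oppr0.
have [_ _ _] := mate_eq im jn mn.
have -> : jac n m = - jac m n by rewrite /jac; ring.
rewrite oppr_gt0; have [] := ltrgtP (jac m n) 0 => //= _ _; by rewrite opprK.
Qed.

(** In coordinates dual to the two velocities the four differences are, up to errors of at most
    [e / 2], the corners of a square of half-side [e] around 0, so they turn once around it. *)
Lemma strand_crossing m n : inner m -> inner n -> mate m n -> \forall e \near 0^'+,
  edge_crossing (node e (m, false), node e (m, true)) (node e (n, false), node e (n, true)) =
  strand_sign m n.
Proof.
move=> im jn mn; have [_ _ _ j0] := mate_eq im jn mn; have eg := mates_g im jn mn.
have [p [q [a1 a2]]] := dual_functional 1 0 im jn mn.
have [p' [q' [b1 b2]]] := dual_functional 0 1 im jn mn.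
have q0 : 0 < 4^-1 :> R by lra.
have [r1 [r10 H1]] := phi_germ p q im q0; have [r2 [r20 H2]] := phi_germ p q jn q0.
have [r3 [r30 H3]] := phi_germ p' q' im q0; have [r4 [r40 H4]] := phi_germ p' q' jn q0.
apply: near_right; exists (Num.min (Num.min r1 r2) (Num.min r3 r4)).
rewrite !lt_min r10 r20 r30 r40; split=> // e.
rewrite !lt_min => /andP[e0 /andP[/andP[e1 e2] /andP[e3 e4]]].
have dist m0 b r : e < r -> `|half_time e (m0, b) - tau m0| < r.
  by move=> er; rewrite (half_time_dist (m0, b) e0).
have diff m0 b : half_time e (m0, b) - tau m0 = sgb b * e by rewrite /half_time /=; ring.
have A1 b := H1 _ (dist m b _ e1); have A2 b := H2 _ (dist n b _ e2).
have A3 b := H3 _ (dist m b _ e3); have A4 b := H4 _ (dist n b _ e4).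
have aux (x y : R) D b : D = 0 -> `|x - y - D * (sgb b * e)| <= 4^-1 * `|sgb b * e| ->
    - (4^-1 * e) <= x - y <= 4^-1 * e.
  by move=> ->; rewrite mul0r subr0 ler_norml /sgb; case: b; rewrite ?mulN1r ?mul1r ?normrN (gtr0_norm e0).
have aux1 (x y : R) D b : D = 1 -> `|x - y - D * (sgb b * e)| <= 4^-1 * `|sgb b * e| ->
    - (4^-1 * e) <= x - y - sgb b * e <= 4^-1 * e.
  by move=> ->; rewrite mul1r ler_norml /sgb; case: b; rewrite ?mulN1r ?mul1r ?normrN (gtr0_norm e0).
move: (fun b => aux1 _ _ _ b a1 (eq_ind _ (fun z => `|_ - _ - _ * z| <= _ * `|z|) (A1 b) _ (diff m b))).
move: (fun b => aux _ _ _ b a2 (eq_ind _ (fun z => `|_ - _ - _ * z| <= _ * `|z|) (A2 b) _ (diff n b))).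
move: (fun b => aux _ _ _ b b1 (eq_ind _ (fun z => `|_ - _ - _ * z| <= _ * `|z|) (A3 b) _ (diff m b))).
move: (fun b => aux1 _ _ _ b b2 (eq_ind _ (fun z => `|_ - _ - _ * z| <= _ * `|z|) (A4 b) _ (diff n b))).
rewrite -/(node e (m, true)) -eg => B4 B3 B2 B1 {A1 A2 A3 A4 H1 H2 H3 H4 aux aux1 dist diff}.
(* The matrix of the dual functionals inverts the matrix of the velocities, so the change of
   coordinates multiplies [det] by [jac m n]. *)
have J : jac m n * (p * q' - q * p') = 1.
  transitivity ((p * dx m + q * dy m) * (p' * dx n + q' * dy n) -
    (p * dx n + q * dy n) * (p' * dx m + q' * dy m)); first by rewrite /jac; ring.
  by rewrite a1 a2 b1 b2; ring.
have detE v w : det v w = jac m n * (phi p q v * phi p' q' w - phi p' q' v * phi p q w).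
  by rewrite -[LHS]mul1r -J /det /phi; ring.
have S00 := B1 false; have S01 := B1 true; have S10 := B2 false; have S11 := B2 true.
have S20 := B3 false; have S21 := B3 true; have S30 := B4 false; have S31 := B4 true.
move: S00 S01 S10 S11 S20 S21 S30 S31; rewrite /sgb -/(node e (m, true)) -/(node e (m, false)).
rewrite -/(node e (n, true)) -/(node e (n, false)).
move=> {B1 B2 B3 B4} S00 S01 S10 S11 S20 S21 S30 S31.
have phiB p0 q0' v w : phi p0 q0' (sub v w) = phi p0 q0' v - phi p0 q0' w.
  by rewrite /phi /sub /=; ring.
rewrite /edge_crossing /strand_sign mn /=.
have sgn v w : phi p q v * phi p' q' w < 0 -> 0 < phi p' q' v * phi p q w ->
    jac m n * det v w < 0.
  move=> k1 k2; rewrite detE mulrA pmulr_rlt0; first by lra.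
  by rewrite -expr2 exprn_even_gt0.
have D0 : jac m n * det (sub (node e (m, false)) (node e (n, false)))
    (sub (node e (m, true)) (node e (n, false))) < 0.
  apply: sgn; rewrite !phiB; [rewrite nmulr_rlt0; lra|rewrite pmulr_rgt0; lra].
have D1 : jac m n * det (sub (node e (m, true)) (node e (n, false)))
    (sub (node e (m, true)) (node e (n, true))) < 0.
  apply: sgn; rewrite !phiB; [rewrite pmulr_rlt0; lra|rewrite pmulr_rgt0; lra].
have D2 : jac m n * det (sub (node e (m, true)) (node e (n, true)))
    (sub (node e (m, false)) (node e (n, true))) < 0.
  apply: sgn; rewrite !phiB; [rewrite pmulr_rlt0; lra|rewrite nmulr_rgt0; lra].
have D3 : jac m n * det (sub (node e (m, false)) (node e (n, true)))
    (sub (node e (m, false)) (node e (n, false))) < 0.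
  apply: sgn; rewrite !phiB; [rewrite nmulr_rlt0; lra|rewrite nmulr_rgt0; lra].
have [jp|jn'|j0'] := ltrgtP (jac m n) 0; last by rewrite j0' eqxx in j0.
  by rewrite !(nmulr_rlt0 _ jp) in D0 D1 D2 D3; exact: circuit_pos.
by rewrite !(pmulr_rlt0 _ jn') in D0 D1 D2 D3; exact: circuit_neg.
Qed.

(* A piece [inl k] is the part of the curve between the [k]th and the [k+1]st of
   the times [tau], with its ends cut off; [inr (h, h')] is a segment joining two
   of the four points cut out near a double point. *)
Definition piece := (nat + (nat * bool) * (nat * bool))%type.
Implicit Types (P Q : piece) (e : R) (M : nat).

Definition valid P :=
  match P with inl k => (k <= N)%N | inr (h, h') => inner h.1 && inner h'.1 end.
Definition source P := match P with inl k => (k, true) | inr (h, _) => h end.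
Definition target P := match P with inl k => (k.+1, false) | inr (_, h') => h' end.
Definition strand m : piece := inr ((m, false), (m, true)).

Definition mesh_time e M k j := block_start k e + (block_end k e - block_start k e) * (j%:R / M%:R).
Definition mesh e M P : seq ((R * R) * (R * R)) :=
  match P with
  | inl k => [seq (point_at (mesh_time e M k j), point_at (mesh_time e M k j.+1)) | j <- iota 0 M]
  | inr (h, h') => [:: (node e h, node e h')]
  end.

Lemma mesh_block e M k E : 0 < e -> (k <= N)%N -> block_start k e <= block_end k e -> e^-1 < M%:R ->
  E \in mesh e M (inl k) -> exists s s0 s1, [/\ tau k <= s <= tau k.+1, near_edge e k s s0 s1 &
    E = (point_at s0, point_at s1)].
Proof.
move=> e0 kN lh eM /mapP[j]; rewrite mem_iota add0n => /= jM ->.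
have M0 : 0 < M%:R :> R by apply: lt_trans eM; rewrite invr_gt0.
have eM' : M%:R^-1 < e by rewrite -(invrK e) ltf_pV2 // posrE invr_gt0.
have /andP[k0 k1] := tau_itv (leqW kN).
have /andP[k2 k3] := tau_itv (kN : (k.+1 <= N.+1)%N).
have lo_ge : tau k <= block_start k e by rewrite /block_start; case: eqP => [->|_]; rewrite ?tau0; lra.
have hi_le : block_end k e <= tau k.+1 by rewrite /block_end; case: eqP => [->|_]; rewrite ?tauN; lra.
have frac i : (i <= M)%N -> block_start k e <= mesh_time e M k i <= block_end k e.
  move=> iM; have x0 : 0 <= i%:R / M%:R :> R by rewrite divr_ge0 // ler0n.
  have x1 : i%:R / M%:R <= 1 :> R by rewrite ler_pdivrMr // mul1r ler_nat.
  by rewrite /mesh_time; move: (i%:R / M%:R) x0 x1 => x x0 x1; apply/andP; split; nra.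
exists (mesh_time e M k j), (mesh_time e M k j), (mesh_time e M k j.+1).
have fj := frac j (ltnW jM); have fj1 := frac j.+1 jM.
split=> //; first by case/andP: fj => a1 a2; rewrite (le_trans lo_ge a1) (le_trans a2 hi_le).
split=> //; first by rewrite subrr normr0.
have -> : mesh_time e M k j.+1 - mesh_time e M k j = (block_end k e - block_start k e) * M%:R^-1.
  by rewrite /mesh_time -natr1; ring.
have i0 : 0 < M%:R^-1 :> R by rewrite invr_gt0.
rewrite ger0_norm ?mulr_ge0 ?subr_ge0 ?(ltW i0) //.
have d1 : block_end k e - block_start k e <= 1 by lra.
apply: le_lt_trans eM'; rewrite ler_piMl ?(ltW i0) //.
Qed.

Lemma near_lo_hi k : (k <= N)%N -> \forall e \near 0^'+, block_start k e <= block_end k e.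
Proof.
move=> kN; apply: near_right; exists ((tau k.+1 - tau k) / 2).
have := tau_lt kN; have /andP[k0 k1] := tau_itv (leqW kN).
have /andP[k2 k3] := tau_itv (kN : (k.+1 <= N.+1)%N).
rewrite /block_start /block_end => h; split; first lra.
by move=> e /andP[e0 eh]; case: eqP; case: eqP; lra.
Qed.

(** Pairs of pieces that stay separated when [e] is small: blocks not sharing the base point, a
    block and a link with no common end, links at different double points, and the two complementary
    corners at one double point. *)
Definition apart P Q := match P, Q with
  | inl k, inl l => [&& k != l, (k <= N)%N, (l <= N)%N, ~~ ((k == 0%N) && (l == N)) &
      ~~ ((l == 0%N) && (k == N))]
  | inl k, inr (h, h') | inr (h, h'), inl k =>
      [&& (k <= N)%N, is_link h h', off_block k h & off_block k h']
  | inr (h1, h1'), inr (h2, h2') => [&& is_link h1 h1', is_link h2 h2' &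
      ((h1.1 != h2.1) && ~~ mate h1.1 h2.1) ||
      [&& mate h1.1 h1'.1, h2 == (h1'.1, ~~ h1'.2) & h2' == (h1.1, ~~ h1.2)]]
  end.

Lemma separated_pieces P Q : apart P Q -> \forall e \near 0^'+, forall M, e^-1 < M%:R ->
  forall E F, E \in mesh e M P -> F \in mesh e M Q -> line_separated E F.
Proof.
have block_link k h h' : (k <= N)%N -> is_link h h' -> off_block k h -> off_block k h' ->
    \forall e \near 0^'+, forall M, e^-1 < M%:R ->
    forall E F, E \in mesh e M (inl k) -> F \in mesh e M (inr (h, h')) -> line_separated E F.
  move=> kN lh o o'; near=> e => M eM E F.
  have e0 : 0 < e by near: e; exact: nbhs_right_gt.
  have lk : block_start k e <= block_end k e by near: e; exact: near_lo_hi.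
  move=> /(mesh_block e0 kN lk eM) [s [s0 [s1 [sk ne ->]]]].
  rewrite /= inE => /eqP ->; move: s sk s0 s1 ne; near: e.
  exact: separated_block_link.
have blocks k l : (k < l)%N -> (l <= N)%N -> ~~ ((k == 0%N) && (l == N)) ->
    \forall e \near 0^'+, forall M, e^-1 < M%:R ->
    forall E F, E \in mesh e M (inl k) -> F \in mesh e M (inl l) -> line_separated E F.
  move=> kl lN n0; have kN : (k <= N)%N by apply: leq_trans lN; exact: ltnW.
  near=> e => M eM E F.
  have e0 : 0 < e by near: e; exact: nbhs_right_gt.
  have lk : block_start k e <= block_end k e by near: e; exact: near_lo_hi.
  have ll : block_start l e <= block_end l e by near: e; exact: near_lo_hi.
  move=> /(mesh_block e0 kN lk eM) [s [s0 [s1 [sk ne ->]]]].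
  move=> /(mesh_block e0 lN ll eM) [t [t0 [t1 [tl ne' ->]]]].
  move: s t sk tl s0 s1 t0 t1 ne ne'; near: e.
  exact: separated_blocks.
case: P Q => [k|[h1 h1']] [l|[h2 h2']] /=.
- move=> /and5P[kl kN lN n1 n2]; have [lk|lk|ekl] := ltngtP k l.
  + exact: blocks.
  + have := blocks _ _ lk kN n2; apply: filterS => e H M eM E F hE hF.
    by apply: line_separatedC; exact: H hF hE.
  + by rewrite ekl eqxx in kl.
- by move=> /and4P[]; exact: block_link.
- move=> /and4P[lN lh o o']; have := block_link _ _ _ lN lh o o'.
  apply: filterS => e H M eM E F hE hF.
  by apply: line_separatedC; exact: H hF hE.
move=> /and3P[l1 l2 /orP[/andP[n12 nm]|/and3P[mh /eqP e2 /eqP e2']]].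
  have := separated_links l1 l2 n12 nm; apply: filterS => e H M _ E F.
  by rewrite !inE => /eqP -> /eqP ->.
have /and3P[i1 i1' _] := l1.
have := separated_corners h1.2 h1'.2 i1 i1' mh; apply: filterS => e H M _ E F.
rewrite !inE => /eqP -> /eqP ->; rewrite e2 e2'.
by move: H; rewrite -!surjective_pairing.
Unshelve. all: by end_near. Qed.

Definition piece_crossing P Q : int := match P, Q with
  | inr (h1, h1'), inr (h2, h2') =>
      if (h1.1 == h1'.1) && (h2.1 == h2'.1) then strand_sign h1.1 h2.1 else 0
  | _, _ => 0
  end.

Definition admissible P Q := apart P Q \/
  exists m n, [/\ inner m, inner n, mate m n, P = strand m & Q = strand n].

Lemma mesh_crossing P Q : admissible P Q -> \forall e \near 0^'+, forall M, e^-1 < M%:R ->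
  \sum_(E <- mesh e M P) \sum_(F <- mesh e M Q) edge_crossing E F = piece_crossing P Q.
Proof.
move=> [aPQ|[m [n [im jn mn -> ->]]]].
  have := separated_pieces aPQ; apply: filterS => e H M eM.
  rewrite big_seq big1 => [|E hE]; last first.
    by rewrite big_seq big1 // => F hF; apply: edge_crossing_separated; exact: H hE hF.
  case: P Q aPQ {H} => [k|[h1 h1']] [l|[h2 h2']] //= /and3P[l1 l2 h].
  case: ifP => // /andP[/eqP e1 /eqP e2]; rewrite /strand_sign.
  case/orP: h => [/andP[_ /negbTE -> //]|/and3P[mm _ _]].
  have /and3P[i1 i1' _] := l1; have [] := mate_eq i1 i1' mm.
  by rewrite e1 eqxx.
have := strand_crossing im jn mn; apply: filterS => e H M _.
by rewrite /= !big_seq1 H !eqxx.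
Qed.

(** The nodes [(0, true)] and [(N.+1, false)] are both the base point, as the curve closes there
    without trimming. *)
Definition node_position e (h : nat * bool) :=
  if (h == (0%N, true)) || (h == (N.+1, false)) then point_at 0 else node e h.

Lemma mesh_boundary e M P (G : R * R -> int) : (0 < M)%N -> valid P ->
  \sum_(E <- mesh e M P) (G E.2 - G E.1) = G (node_position e (target P)) - G (node_position e (source P)).
Proof.
move=> M0; case: P => [k|[h h']] /= => [kN|/andP[ih ih']].
  have := telescope_sumr (fun j => G (point_at (mesh_time e M k j))) (leq0n M).
  rewrite /index_iota subn0 big_map /= => ->.
  rewrite /mesh_time mul0r mulr0 addr0 divff ?pnatr_eq0 -?lt0n // mulr1 [block_start _ _ + _]addrC subrK.
  congr (G _ - G _).
    rewrite /node_position xpair_eqE /= xpair_eqE eqSS andbT /block_end; case: eqP => _.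
      by rewrite /point_at -closed_x -closed_y.
    by rewrite /node /half_time /sgb /= mulN1r.
  rewrite /node_position !xpair_eqE andbT andbF orbF /block_start; case: eqP => // _.
  by rewrite /node /half_time /sgb /= mul1r.
have pos h0 : inner h0.1 -> node_position e h0 = node e h0.
  case: h0 => m b /andP[m0 mN]; rewrite /node_position !xpair_eqE /= in m0 mN *.
  by rewrite gtn_eqF // ltn_eqF.
by rewrite big_seq1 /= !pos.
Qed.

Implicit Types (alpha beta : seq (int * piece)).

Definition balanced alpha := forall G : nat * bool -> int,
  G (0%N, true) = G (N.+1, false) ->
  \sum_(a <- alpha) a.1 * (G (target a.2) - G (source a.2)) = 0.

Definition mesh_chain e M alpha :=
  flatten [seq [seq (a.1, E) | E <- mesh e M a.2] | a <- alpha].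

Lemma near_all_seq (T : eqType) (s : seq T) (Q : T -> R -> Prop) :
  (forall x, x \in s -> \forall e \near 0^'+, Q x e) ->
  \forall e \near 0^'+, forall x, x \in s -> Q x e.
Proof.
elim: s => [|x s IH] H; first by near=> e.
near=> e => y; rewrite inE => /orP[/eqP ->|].
  by near: e; apply: H; rewrite inE eqxx.
move: y; near: e; apply: IH => y ys; apply: H.
by rewrite inE ys orbT.
Unshelve. all: by end_near. Qed.

(** Finitely many pairs of pieces occur, so one [e] serves them all, and a mesh finer than [e]
    follows. The mesh chains are cycles in the plane, and only pairs of strands at one double point
    contribute to their crossing number. *)
Theorem balanced_crossing alpha beta :
  {in alpha, forall a, valid a.2} -> {in beta, forall a, valid a.2} ->
  balanced alpha -> balanced beta ->
  {in alpha & beta, forall a a', admissible a.2 a'.2} ->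
  \sum_(a <- alpha) \sum_(a' <- beta) a.1 * a'.1 * piece_crossing a.2 a'.2 = 0.
Proof.
move=> va vb ba bb ad.
have [e [e0 He]] : exists e, 0 < e /\ forall a, a \in alpha -> forall a', a' \in beta ->
    forall M, e^-1 < M%:R -> \sum_(E <- mesh e M a.2) \sum_(F <- mesh e M a'.2)
      edge_crossing E F = piece_crossing a.2 a'.2.
  have := @near_all_seq _ alpha (fun a e => forall a', a' \in beta -> forall M,
    e^-1 < M%:R -> \sum_(E <- mesh e M a.2) \sum_(F <- mesh e M a'.2)
      edge_crossing E F = piece_crossing a.2 a'.2) _.
  case/(_ _)/(filterI (nbhs_right_gt 0))/filter_ex => [a aA|e [e0 He]]; last by exists e.
  by apply: near_all_seq => a' a'B; apply: mesh_crossing; exact: ad.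
pose M := Num.bound e^-1.
have eM : e^-1 < M%:R by apply: archi_boundP; rewrite invr_ge0 ltW.
have M0 : (0 < M)%N by rewrite -(ltr_nat R); apply: lt_trans eM; rewrite invr_gt0.
have cyc gamma : {in gamma, forall a, valid a.2} -> balanced gamma ->
    is_cycle (mesh_chain e M gamma).
  move=> vg bg G; rewrite big_flatten big_map /=.
  rewrite -[RHS](bg (fun h => G (node_position e h))); last by rewrite /node_position !eqxx ?orbT.
  apply: eq_big_seq => a ag; rewrite big_map /= -mulr_sumr.
  by rewrite mesh_boundary //; exact: vg.
rewrite -[RHS](crossing_number_cycles (cyc _ va ba) (cyc _ vb bb)).
rewrite /crossing_number big_flatten big_map; apply: eq_big_seq => a aA; rewrite big_map /=.
rewrite exchange_big big_flatten big_map /=; apply: eq_big_seq => a' a'B.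
rewrite big_map exchange_big /= -(He a aA a' a'B M eM) mulr_sumr; apply: eq_bigr => E _.
by rewrite mulr_sumr.
Qed.

(** The arc from just after [tau i] to just before [tau j], with multiplicity [z]: its blocks, and
    the strands through the double points strictly between. *)
Definition arc_chain (z : int) i j : seq (int * piece) :=
  locked ([seq (z, inl k) | k <- index_iota i j] ++ [seq (z, strand m) | m <- index_iota i.+1 j]).

Lemma arcE z i j : arc_chain z i j =
  [seq (z, inl k) | k <- index_iota i j] ++ [seq (z, strand m) | m <- index_iota i.+1 j].
Proof. by rewrite /arc_chain -lock. Qed.

Definition crossing alpha beta :=
  \sum_(a <- alpha) \sum_(a' <- beta) a.1 * a'.1 * piece_crossing a.2 a'.2.

Definition arc_crossing i j i' j' :=
  \sum_(i.+1 <= m < j) \sum_(i'.+1 <= m' < j') strand_sign m m'.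

Lemma crossing_catl alpha1 alpha2 beta :
  crossing (alpha1 ++ alpha2) beta = crossing alpha1 beta + crossing alpha2 beta.
Proof. exact: big_cat. Qed.

Lemma crossing_catr alpha beta1 beta2 :
  crossing alpha (beta1 ++ beta2) = crossing alpha beta1 + crossing alpha beta2.
Proof. by rewrite /crossing -big_split /=; apply: eq_bigr => a _; rewrite big_cat. Qed.

(** Used to switch from one strand to the other near a double point; it contributes no crossing. *)
Definition corner_piece (z : int) (h h' : nat * bool) : seq (int * piece) := [:: (z, inr (h, h'))].

Lemma crossing_cornerl z h h' beta : h.1 != h'.1 -> crossing (corner_piece z h h') beta = 0.
Proof.
move=> /negbTE n; rewrite /crossing big_seq1 big1 // => -[z' [k|[h1 h1']]] _ /=.
  by rewrite mulr0.
by rewrite n mulr0.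
Qed.

Lemma crossing_cornerr z h h' alpha : h.1 != h'.1 -> crossing alpha (corner_piece z h h') = 0.
Proof.
move=> /negbTE n; rewrite /crossing big1 // => -[z' [k|[h1 h1']]] _; rewrite big_seq1 /=.
  by rewrite mulr0.
by rewrite n andbF mulr0.
Qed.

Lemma crossing_arcs z i j z' i' j' :
  crossing (arc_chain z i j) (arc_chain z' i' j') = z * z' * arc_crossing i j i' j'.
Proof.
rewrite !arcE crossing_catl [X in X + _](_ : _ = 0) ?add0r; last first.
  by rewrite /crossing big_map big1 // => k _; rewrite big1 // => -[d P] _; rewrite mulr0.
rewrite crossing_catr [X in X + _](_ : _ = 0) ?add0r; last first.
  by rewrite /crossing big_map big1 // => k _; rewrite big_map big1 // => l _; rewrite mulr0.
rewrite /crossing big_map /arc_crossing mulr_sumr; apply: eq_bigr => m _.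
rewrite big_map mulr_sumr; apply: eq_bigr => m' _.
by rewrite /= !eqxx.
Qed.

Definition boundary alpha (G : nat * bool -> int) :=
  \sum_(a <- alpha) a.1 * (G (target a.2) - G (source a.2)).

Lemma boundary_cat alpha beta G : boundary (alpha ++ beta) G = boundary alpha G + boundary beta G.
Proof. exact: big_cat. Qed.

Lemma boundary_corner z h h' G : boundary (corner_piece z h h') G = z * (G h' - G h).
Proof. exact: big_seq1. Qed.

Lemma boundary_arc z i j G : (i < j)%N -> boundary (arc_chain z i j) G = z * (G (j, false) - G (i, true)).
Proof.
move=> ij; rewrite arcE boundary_cat /boundary !big_map /= -!mulr_sumr -mulrDr; congr (_ * _).
elim: j ij => // j IH; rewrite ltnS leq_eqVlt => /orP[/eqP <-|ij].
  by rewrite big_nat1 big_geq // addr0.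
rewrite big_nat_recr /= ?(ltnW ij) // [X in _ + X]big_nat_recr //=.
by move: (IH ij); lra.
Qed.

Definition valid_chain alpha := {in alpha, forall a, valid a.2}.
Definition compatible alpha beta := {in alpha & beta, forall a a', admissible a.2 a'.2}.

Lemma valid_cat alpha beta : valid_chain alpha -> valid_chain beta -> valid_chain (alpha ++ beta).
Proof. by move=> va vb a; rewrite mem_cat => /orP[/va|/vb]. Qed.

Lemma valid_arc z i j : (j <= N.+1)%N -> valid_chain (arc_chain z i j).
Proof.
move=> jN a; rewrite arcE mem_cat => /orP[] /mapP[k]; rewrite mem_index_iota => /andP[k1 k2] -> /=.
  by rewrite -ltnS; exact: leq_trans jN.
by rewrite andbb /inner (leq_trans _ k1) //= -ltnS; exact: leq_trans jN.
Qed.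

Lemma valid_corner z h h' : inner h.1 -> inner h'.1 -> valid_chain (corner_piece z h h').
Proof. by move=> i i' a; rewrite inE => /eqP -> /=; rewrite i i'. Qed.

Lemma compatible_catl alpha1 alpha2 beta : compatible alpha1 beta -> compatible alpha2 beta ->
  compatible (alpha1 ++ alpha2) beta.
Proof. by move=> h1 h2 a a'; rewrite mem_cat => /orP[/h1|/h2]; apply. Qed.

Lemma compatible_catr alpha beta1 beta2 : compatible alpha beta1 -> compatible alpha beta2 ->
  compatible alpha (beta1 ++ beta2).
Proof.
by move=> h1 h2 a a' aa; rewrite mem_cat => /orP[]; [exact: h1|exact: h2].
Qed.

Lemma strand_link m : inner m -> is_link (m, false) (m, true).
Proof. by move=> im; rewrite /is_link /= im eqxx. Qed.

Lemma compatible_arcs z i j z' i' j' : (j <= N.+1)%N -> (j' <= N.+1)%N ->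
  (j <= i')%N || (j' <= i)%N -> ~~ ((i == 0%N) && (j' == N.+1)) -> ~~ ((i' == 0%N) && (j == N.+1)) ->
  compatible (arc_chain z i j) (arc_chain z' i' j').
Proof.
move=> jN jN' D n1 n2 a a'; rewrite !arcE !mem_cat => /orP[] /mapP[k]; rewrite mem_index_iota => Hk -> /orP[]
  /mapP[l]; rewrite mem_index_iota => Hl -> /=.
- by left=> /=; move: D n1 n2 Hk Hl jN jN'; lia.
- left; apply/and4P; split; rewrite /off_block ?xpair_eqE /=.
  + by move: Hk jN; lia.
  + by apply: strand_link; rewrite /inner; move: Hl jN'; lia.
  + by move: D Hk Hl; lia.
  + by move: D Hk Hl; lia.
- left; apply/and4P; split; rewrite /off_block ?xpair_eqE /=.
  + by move: Hl jN'; lia.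
  + by apply: strand_link; rewrite /inner; move: Hk jN; lia.
  + by move: D Hk Hl; lia.
  + by move: D Hk Hl; lia.
have ik : inner k by rewrite /inner; move: Hk jN; lia.
have il : inner l by rewrite /inner; move: Hl jN'; lia.
have [kl|kl] := boolP (mate k l); first by right; exists k, l.
left; rewrite /= !strand_link //= kl andbT; apply/orP; left.
by move: D Hk Hl; lia.
Qed.

Definition clear_of i j (h : nat * bool) :=
  [&& ~~ (i < h.1 < j)%N, h != (i, true) & h != (j, false)].

Lemma compatible_corner_arc z h h' z' i j : (j <= N.+1)%N -> inner h.1 -> inner h'.1 ->
  mate h.1 h'.1 -> clear_of i j h -> clear_of i j h' ->
  compatible (corner_piece z h h') (arc_chain z' i j) /\ compatible (arc_chain z' i j) (corner_piece z h h').
Proof.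
case: h h' => m b [n b'] jN /= im jn mn /and3P[/= m1 m2 m3] /and3P[/= n1 n2 n3].
have lh : is_link (m, b) (n, b') by rewrite /is_link /= im jn mn orbT.
rewrite !xpair_eqE in m2 m3 n2 n3.
have off k : (i <= k < j)%N -> off_block k (m, b) && off_block k (n, b').
  by rewrite /off_block !xpair_eqE; move: m1 m2 m3 n1 n2 n3; case: b {lh}; case: b'; lia.
have bl k : (i <= k < j)%N -> [&& (k <= N)%N, is_link (m, b) (n, b'),
    off_block k (m, b) & off_block k (n, b')].
  by move=> kij; rewrite lh off // andbT; lia.
have st k : (i < k < j)%N -> inner k /\ (m != k) && ~~ mate m k.
  move=> kij; split; first by rewrite /inner; lia.
  have km : m != k by apply: contra m1 => /eqP ->.
  rewrite km; apply/negP => mk; move: n1; rewrite (mate_uniq mn mk) kij //.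
split=> a a'.
  rewrite inE => /eqP -> /=; rewrite arcE mem_cat => /orP[] /mapP[k]; rewrite mem_index_iota => /= Hk ->.
    by left; exact: bl.
  have [ik /= /andP[mk nm]] := st k Hk; left; rewrite /= lh strand_link //= mk nm //.
move=> + /[!inE] /eqP -> /=; rewrite arcE mem_cat => /orP[] /mapP[k]; rewrite mem_index_iota => /= Hk ->.
  by left; exact: bl.
have [ik /= /andP[mk nm]] := st k Hk; left; rewrite /= lh strand_link //= eq_sym mk mate_sym nm //.
Qed.

Lemma compatible_corners z z' m n b b' : inner m -> inner n -> mate m n ->
  compatible (corner_piece z (m, b) (n, b')) (corner_piece z' (n, ~~ b') (m, ~~ b)).
Proof.
move=> im jn mn a a'; rewrite !inE => /eqP -> /eqP ->; left.
by rewrite /= /is_link /= im jn (mate_sym n m) mn !eqxx !orbT.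
Qed.

Lemma compatible_far_corners z z' h1 h1' h2 h2' : is_link h1 h1' -> is_link h2 h2' ->
  h1.1 != h2.1 -> ~~ mate h1.1 h2.1 -> compatible (corner_piece z h1 h1') (corner_piece z' h2 h2').
Proof.
by move=> l1 l2 n12 nm a a'; rewrite !inE => /eqP -> /eqP ->; left; rewrite /= l1 l2 n12 nm.
Qed.

Lemma compatible_crossing alpha beta : valid_chain alpha -> valid_chain beta ->
  (forall G, boundary alpha G = 0) ->
  (forall G, G (0%N, true) = G (N.+1, false) -> boundary beta G = 0) ->
  compatible alpha beta -> crossing alpha beta = 0.
Proof. by move=> va vb ba bb; apply: balanced_crossing => // G _; exact: ba. Qed.

Lemma corner_link m n b b' : inner m -> inner n -> mate m n -> is_link (m, b) (n, b').
Proof. by move=> im jn mn; rewrite /is_link /= im jn mn orbT. Qed.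

(** Cutting the curve at one double point and rounding both corners yields two closed curves: the
    loop from [i] to [j] and the rest. *)
Theorem crossing_self i j : (0 < i < j)%N -> (j <= N)%N -> mate i j ->
  arc_crossing i j j N.+1 + arc_crossing i j 0 i = 0.
Proof.
move=> ij jN mij; have order := conj ij jN.
have ii : inner i by rewrite /inner; order_lia.
have ji : inner j by rewrite /inner; order_lia.
have mji : mate j i by rewrite mate_sym.
pose alpha := arc_chain 1 i j ++ corner_piece 1 (j, false) (i, true).
pose beta := (arc_chain 1 j N.+1 ++ arc_chain 1 0 i) ++ corner_piece 1 (i, false) (j, true).
have : crossing alpha beta = 0.
  apply: compatible_crossing.
  - by apply: valid_cat; [apply: valid_arc; order_lia|apply: valid_corner].
  - by do 2?apply: valid_cat; [apply: valid_arc; order_lia|apply: valid_arc; order_lia|apply: valid_corner].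
  - by move=> G; rewrite /alpha boundary_cat boundary_arc ?boundary_corner; [ring|order_lia].
  - move=> G eG; rewrite /beta !boundary_cat boundary_corner !boundary_arc; [|order_lia|order_lia].
    by rewrite eG; ring.
  apply: compatible_catl; (apply: compatible_catr; first apply: compatible_catr).
  - by apply: compatible_arcs; order_lia.
  - by apply: compatible_arcs; order_lia.
  - by apply: (compatible_corner_arc _ _ _ _ _ _ _ _).2 => //; rewrite /clear_of /= ?xpair_eqE; order_lia.
  - by apply: (compatible_corner_arc _ _ _ _ _ _ _ _).1 => //; rewrite /clear_of /= ?xpair_eqE; order_lia.
  - by apply: (compatible_corner_arc _ _ _ _ _ _ _ _).1 => //; rewrite /clear_of /= ?xpair_eqE; order_lia.
  - exact: (@compatible_corners _ _ j i false true).
rewrite /alpha /beta crossing_catl crossing_cornerl; last by rewrite /=; order_lia.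
rewrite !crossing_catr crossing_cornerr; last by rewrite /=; order_lia.
by rewrite !crossing_arcs; lra.
Qed.

(** The two cycles are the loops at two double points, which have no time in common. *)
Theorem crossing_disjoint i j i' j' : (0 < i < j)%N -> (j < i')%N -> (i' < j')%N -> (j' <= N)%N ->
  mate i j -> mate i' j' -> arc_crossing i j i' j' = 0.
Proof.
move=> ij ji ij' jN mij mij'; have order := conj (conj ij ji) (conj ij' jN).
have ii : inner i by rewrite /inner; order_lia.
have ji1 : inner j by rewrite /inner; order_lia.
have ii' : inner i' by rewrite /inner; order_lia.
have ji' : inner j' by rewrite /inner; order_lia.
have mji : mate j i by rewrite mate_sym.
have mji' : mate j' i' by rewrite mate_sym.
have njj : ~~ mate j j' by apply/negP => /(mate_uniq mji) ?; lia.
pose alpha := arc_chain 1 i j ++ corner_piece 1 (j, false) (i, true).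
pose beta := arc_chain 1 i' j' ++ corner_piece 1 (j', false) (i', true).
have : crossing alpha beta = 0.
  apply: compatible_crossing.
  - by apply: valid_cat; [apply: valid_arc; order_lia|apply: valid_corner].
  - by apply: valid_cat; [apply: valid_arc; order_lia|apply: valid_corner].
  - by move=> G; rewrite /alpha boundary_cat boundary_arc ?boundary_corner; [ring|order_lia].
  - by move=> G _; rewrite /beta boundary_cat boundary_arc ?boundary_corner; [ring|order_lia].
  apply: compatible_catl; apply: compatible_catr.
  - by apply: compatible_arcs; order_lia.
  - by apply: (compatible_corner_arc _ _ _ _ _ _ _ _).2 => //; rewrite /clear_of /= ?xpair_eqE; order_lia.
  - by apply: (compatible_corner_arc _ _ _ _ _ _ _ _).1 => //; rewrite /clear_of /= ?xpair_eqE; order_lia.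
  - by apply: compatible_far_corners; rewrite ?corner_link //=; order_lia.
rewrite /alpha /beta crossing_catl crossing_cornerl; last by rewrite /=; order_lia.
rewrite !crossing_catr crossing_cornerr; last by rewrite /=; order_lia.
by rewrite !crossing_arcs; lra.
Qed.

(** The two cycles are the inner loop and the complement of the outer one. *)
Theorem crossing_nested i j i' j' : (0 < i < i')%N -> (i' < j')%N -> (j' < j)%N -> (j <= N)%N ->
  mate i j -> mate i' j' -> arc_crossing i' j' j N.+1 + arc_crossing i' j' 0 i = 0.
Proof.
move=> ij ji ij' jN mij mij'; have order := conj (conj ij ji) (conj ij' jN).
have ii : inner i by rewrite /inner; order_lia.
have ji1 : inner j by rewrite /inner; order_lia.
have ii' : inner i' by rewrite /inner; order_lia.
have ji' : inner j' by rewrite /inner; order_lia.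
have mji : mate j i by rewrite mate_sym.
have mji' : mate j' i' by rewrite mate_sym.
have njj : ~~ mate j' i by rewrite mate_sym; apply/negP => /(mate_uniq mij) ?; lia.
pose alpha := arc_chain 1 i' j' ++ corner_piece 1 (j', false) (i', true).
pose beta := (arc_chain 1 j N.+1 ++ arc_chain 1 0 i) ++ corner_piece 1 (i, false) (j, true).
have : crossing alpha beta = 0.
  apply: compatible_crossing.
  - by apply: valid_cat; [apply: valid_arc; order_lia|apply: valid_corner].
  - by do 2?apply: valid_cat; [apply: valid_arc; order_lia|apply: valid_arc; order_lia|apply: valid_corner].
  - by move=> G; rewrite /alpha boundary_cat boundary_arc ?boundary_corner; [ring|order_lia].
  - move=> G eG; rewrite /beta !boundary_cat boundary_corner !boundary_arc; [|order_lia|order_lia].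
    by rewrite eG; ring.
  apply: compatible_catl; (apply: compatible_catr; first apply: compatible_catr).
  - by apply: compatible_arcs; order_lia.
  - by apply: compatible_arcs; order_lia.
  - by apply: (compatible_corner_arc _ _ _ _ _ _ _ _).2 => //; rewrite /clear_of /= ?xpair_eqE; order_lia.
  - by apply: (compatible_corner_arc _ _ _ _ _ _ _ _).1 => //; rewrite /clear_of /= ?xpair_eqE; order_lia.
  - by apply: (compatible_corner_arc _ _ _ _ _ _ _ _).1 => //; rewrite /clear_of /= ?xpair_eqE; order_lia.
  - by apply: compatible_far_corners; rewrite ?corner_link //=; order_lia.
rewrite /alpha /beta crossing_catl crossing_cornerl; last by rewrite /=; order_lia.
rewrite !crossing_catr crossing_cornerr; last by rewrite /=; order_lia.
by rewrite !crossing_arcs; lra.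
Qed.

(** The two double points cut the curve into four arcs. One cycle runs along the first arc and
    backwards along the third, the other along the second and backwards along the fourth, which
    passes the base point; strands are switched at both double points. *)
Theorem crossing_interlaced i j i' j' : (0 < i < i')%N -> (i' < j)%N -> (j < j')%N -> (j' <= N)%N ->
  mate i j -> mate i' j' -> arc_crossing i i' i' j -
    (arc_crossing i i' j' N.+1 + arc_crossing i i' 0 i) - arc_crossing j j' i' j +
    (arc_crossing j j' j' N.+1 + arc_crossing j j' 0 i) = 0.
Proof.
move=> ij ji ij' jN mij mij'; have order := conj (conj ij ji) (conj ij' jN).
have ii : inner i by rewrite /inner; order_lia.
have ji1 : inner j by rewrite /inner; order_lia.
have ii' : inner i' by rewrite /inner; order_lia.
have ji' : inner j' by rewrite /inner; order_lia.
have mji : mate j i by rewrite mate_sym.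
have mji' : mate j' i' by rewrite mate_sym.
have n1 : ~~ mate i' j by rewrite mate_sym; apply/negP => /(mate_uniq mji) ?; lia.
have n2 : ~~ mate i j' by apply/negP => /(mate_uniq mij) ?; lia.
pose alpha := (arc_chain 1 i i' ++ arc_chain (-1) j j') ++
  (corner_piece 1 (i', false) (j', false) ++ corner_piece (-1) (i, true) (j, true)).
pose beta := (arc_chain 1 i' j ++ (arc_chain (-1) j' N.+1 ++ arc_chain (-1) 0 i)) ++
  (corner_piece 1 (j, false) (i, false) ++ corner_piece 1 (j', true) (i', true)).
have : crossing alpha beta = 0.
  apply: compatible_crossing.
  - by apply: valid_cat; apply: valid_cat; [apply: valid_arc; order_lia|apply: valid_arc; order_lia|
      apply: valid_corner|apply: valid_corner].
  - apply: valid_cat; first apply: valid_cat; last by apply: valid_cat; apply: valid_corner.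
      by apply: valid_arc; order_lia.
    by apply: valid_cat; apply: valid_arc; order_lia.
  - move=> G; rewrite /alpha !boundary_cat !boundary_corner !boundary_arc; [ring|order_lia|order_lia].
  - move=> G eG; rewrite /beta !boundary_cat !boundary_corner !boundary_arc; [|order_lia|order_lia|order_lia].
    by rewrite eG; ring.
  have C h h' z i0 j0 z' : inner h.1 -> inner h'.1 -> mate h.1 h'.1 -> (j0 <= N.+1)%N ->
      clear_of i0 j0 h -> clear_of i0 j0 h' -> compatible (corner_piece z h h') (arc_chain z' i0 j0).
    by move=> ? ? ? ? ? ?; apply: (compatible_corner_arc _ _ _ _ _ _ _ _).1.
  have C' h h' z i0 j0 z' : inner h.1 -> inner h'.1 -> mate h.1 h'.1 -> (j0 <= N.+1)%N ->
      clear_of i0 j0 h -> clear_of i0 j0 h' -> compatible (arc_chain z' i0 j0) (corner_piece z h h').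
    by move=> ? ? ? ? ? ?; apply: (compatible_corner_arc _ _ _ _ _ _ _ _).2.
  apply: compatible_catl; apply: compatible_catr.
  - apply: compatible_catl; apply: compatible_catr; try apply: compatible_catr;
      by apply: compatible_arcs; order_lia.
  - apply: compatible_catl; apply: compatible_catr;
      by apply: C' => //; rewrite /clear_of /= ?xpair_eqE; order_lia.
  - apply: compatible_catl; apply: compatible_catr; try apply: compatible_catr;
      by apply: C => //; rewrite /clear_of /= ?xpair_eqE; order_lia.
  apply: compatible_catl; apply: compatible_catr.
  - by apply: compatible_far_corners; rewrite ?corner_link //=; order_lia.
  - exact: (@compatible_corners _ _ i' j' false false).
  - exact: (@compatible_corners _ _ i j true true).
  - by apply: compatible_far_corners; rewrite ?corner_link //=; order_lia.
rewrite /alpha /beta crossing_catl [X in _ + X]crossing_catl !crossing_cornerl;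
  try by rewrite /=; order_lia.
rewrite crossing_catl crossing_catr [X in _ + X + _ + _]crossing_catr.
rewrite !crossing_cornerr; try by rewrite /=; order_lia.
rewrite !crossing_catr !crossing_arcs.
by rewrite !crossing_cornerr; try (by rewrite /=; order_lia); lra.
Qed.

End Curve.

(** * From signed crossing sums to the parity conditions *)

Section Parity.
Variables (T : choiceType) (x0 : T) (S : seq T) (x : nat -> nat -> int).
Hypothesis dS : double_occurrence_word S.
Implicit Types (u v w : T) (i j k m n : nat).

Definition letter m := nth x0 S m.-1.
Definition same_letter m n :=
  [&& (0 < m <= size S)%N, (0 < n <= size S)%N, m != n & letter m == letter n].
Definition arc_sum i j i' j' := \sum_(i.+1 <= m < j) \sum_(i'.+1 <= m' < j') x m m'.

Hypothesis xC : forall m n, (0 < m <= size S)%N -> (0 < n <= size S)%N -> x n m = - x m n.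
Hypothesis x_mate : forall m n, same_letter m n -> x m n = 1 \/ x m n = -1.
Hypothesis x_other : forall m n, ~~ same_letter m n -> x m n = 0.
Hypothesis sum_self : forall i j, (0 < i < j)%N -> (j <= size S)%N -> same_letter i j ->
  arc_sum i j j (size S).+1 + arc_sum i j 0 i = 0.
Hypothesis sum_disjoint : forall i j i' j', (0 < i < j)%N -> (j < i')%N -> (i' < j')%N ->
  (j' <= size S)%N -> same_letter i j -> same_letter i' j' -> arc_sum i j i' j' = 0.
Hypothesis sum_nested : forall i j i' j', (0 < i < i')%N -> (i' < j')%N -> (j' < j)%N ->
  (j <= size S)%N -> same_letter i j -> same_letter i' j' ->
  arc_sum i' j' j (size S).+1 + arc_sum i' j' 0 i = 0.
Hypothesis sum_interlaced : forall i j i' j', (0 < i < i')%N -> (i' < j)%N -> (j < j')%N ->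
  (j' <= size S)%N -> same_letter i j -> same_letter i' j' -> arc_sum i i' i' j -
    (arc_sum i i' j' (size S).+1 + arc_sum i i' 0 i) - arc_sum j j' i' j +
    (arc_sum j j' j' (size S).+1 + arc_sum j j' 0 i) = 0.

Definition pos1 u := (index u S).+1.
Definition pos2 u := (index u S + index u (drop (index u S).+1 S)).+2.

Lemma pos_split u : u \in S -> exists P Q R, [/\ S = P ++ u :: Q ++ u :: R,
  [/\ u \notin P, u \notin Q & u \notin R],
  pos1 u = (size P).+1 & pos2 u = (size P + size Q).+2].
Proof.
move=> uS; have [P [Q [R [eS nP nQ nR]]]] := double_split (dS uS).
exists P, Q, R; have e1 : index u S = size P by rewrite eS index_cat (negbTE nP) /= eqxx addn0.
split=> //; first by rewrite /pos1 e1.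
rewrite /pos2 e1 {1}eS -cat_rcons drop_size_cat ?size_rcons // index_cat (negbTE nQ) /= eqxx.
by rewrite addn0.
Qed.

Lemma pos_bounds u : u \in S -> [/\ (0 < pos1 u)%N, (pos1 u < pos2 u)%N & (pos2 u <= size S)%N].
Proof.
move=> /pos_split [P [Q [R [eS _ -> ->]]]]; rewrite eS !size_cat /= size_cat /=.
by split; lia.
Qed.

Lemma letter_pos u m : u \in S -> (0 < m <= size S)%N ->
  (letter m == u) = (m == pos1 u) || (m == pos2 u).
Proof.
move=> /pos_split [P [Q [R [eS [nP nQ nR] -> ->]]]] /andP[m0].
have notin (s : seq T) k : u \notin s -> (k < size s)%N -> (nth x0 s k == u) = false.
  by move=> ns ks; apply: contraNF ns => /eqP <-; exact: mem_nth.
rewrite /letter eS size_cat /= size_cat /= => mS; rewrite nth_cat.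
case: ltnP => mP; first by rewrite notin //; lia.
case em : (m.-1 - size P)%N => [|k] /=; first by rewrite eqxx; lia.
rewrite nth_cat; case: ltnP => kQ; first by rewrite notin //; lia.
case ek : (k - size Q)%N => [|l] /=; first by rewrite eqxx; lia.
by rewrite notin //; lia.
Qed.

Lemma same_letter_pos u : u \in S -> same_letter (pos1 u) (pos2 u).
Proof.
move=> uS; have [h1 h2 h3] := pos_bounds uS.
have i1 : (0 < pos1 u <= size S)%N by lia.
have i2 : (0 < pos2 u <= size S)%N by lia.
rewrite /same_letter i1 i2 (ltn_eqF h2) /=.
have /eqP -> : letter (pos1 u) == u by rewrite letter_pos // eqxx.
by rewrite eq_sym letter_pos // eqxx orbT.
Qed.

Lemma same_letter_uniq u m : u \in S -> (same_letter (pos1 u) m -> m = pos2 u) /\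
  (same_letter (pos2 u) m -> m = pos1 u).
Proof.
move=> uS; have [h1 h2 h3] := pos_bounds uS.
have i1 : (0 < pos1 u <= size S)%N by lia.
have i2 : (0 < pos2 u <= size S)%N by lia.
have /eqP e1 : letter (pos1 u) == u by rewrite letter_pos // eqxx.
have /eqP e2 : letter (pos2 u) == u by rewrite letter_pos // eqxx orbT.
split=> /and4P[_ im n]; rewrite ?e1 ?e2 eq_sym letter_pos // => /orP[] /eqP em //;
  by rewrite em eqxx in n.
Qed.

Local Notation "\xor_ ( m <= i < n ) F" := (\big[addb/false]_(m <= i < n) F%B)
  (at level 41, F at level 41, i, m, n at level 50).
Local Notation U := (undup S).

Definition occ i j w := \xor_(i.+1 <= m < j) (letter m == w).

Lemma occ_split i k j w : (i < k < j)%N -> occ i j w = occ i k w (+) (letter k == w) (+) occ k j w.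
Proof.
move=> /andP[ik kj]; rewrite /occ (big_cat_nat ik (ltnW kj)) /=.
by rewrite [X in _ (+) X]big_ltn // addbA.
Qed.

Lemma odd_count (s : seq T) w : odd (count_mem w s) = \xor_(0 <= m < size s) (nth x0 s m == w).
Proof.
rewrite -(big_nth x0 predT (fun z => z == w)).
elim: s => [|z s IH]; first by rewrite big_nil.
by rewrite big_cons /= oddD IH oddb.
Qed.

Lemma occ_total w : w \in S -> occ 0 (size S).+1 w = false.
Proof.
move=> wS; transitivity (odd (count_mem w S)); last by rewrite dS.
by rewrite odd_count /occ big_add1 /=; apply: eq_bigr.
Qed.

Lemma interlace_occ u w : u \in S -> u != w -> interlace S u w = occ (pos1 u) (pos2 u) w.
Proof.
move=> uS nuw; have [P [Q [R [eS [nP nQ nR] e1 e2]]]] := pos_split uS.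
rewrite {1}eS interlace_splitE // odd_count /occ e1 e2.
rewrite -[(size P).+2]add0n big_addn; have -> : ((size P + size Q).+2 - (size P).+2 = size Q)%N by lia.
rewrite big_nat [RHS]big_nat; apply: eq_bigr => m /andP[_ mQ].
rewrite /letter eS nth_cat; have -> : ((m + (size P).+2).-1 < size P)%N = false by lia.
have -> : ((m + (size P).+2).-1 - size P = m.+1)%N by lia.
by rewrite /= nth_cat mQ.
Qed.

Lemma occ_self i j u : u \in S -> (j <= (size S).+1)%N -> ~~ (i < pos1 u < j)%N ->
  ~~ (i < pos2 u < j)%N -> occ i j u = false.
Proof.
move=> uS jN n1 n2; rewrite /occ big_nat big1 // => m /andP[im mj].
rewrite letter_pos //; last by lia.
by apply/negP => /orP[] /eqP em; [move: n1|move: n2]; rewrite -em im mj.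
Qed.

Definition oddz (z : int) := odd `|z|%N.

Lemma oddzD z z' : oddz (z + z') = oddz z (+) oddz z'.
Proof. by rewrite /oddz; lia. Qed.

Lemma oddz_sum m n (F : nat -> int) :
  oddz (\sum_(m <= k < n) F k) = \xor_(m <= k < n) oddz (F k).
Proof. exact: (big_morph oddz oddzD). Qed.

Lemma xor_letter z : z \in S -> forall F : T -> bool,
  \big[addb/false]_(w <- U) ((z == w) && F w) = F z.
Proof.
move=> zS F; rewrite (bigD1_seq z) ?mem_undup ?undup_uniq //= eqxx big1 ?addbF //.
by move=> w /negbTE; rewrite eq_sym => ->.
Qed.

Lemma letter_in m : (0 < m <= size S)%N -> letter m \in S.
Proof. by case: m => // m im; exact: mem_nth. Qed.

(** Every sign is odd, so for disjoint arcs the signed sum counts modulo 2 the pairs of equal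
    letters, one on each arc. *)
Lemma odd_arc_sum i j i' j' : (j <= (size S).+1)%N -> (j' <= (size S).+1)%N ->
  (j <= i')%N || (j' <= i)%N ->
  oddz (arc_sum i j i' j') = \big[addb/false]_(w <- U) (occ i j w && occ i' j' w).
Proof.
move=> jN jN' D; rewrite /arc_sum oddz_sum.
transitivity (\xor_(i.+1 <= m < j) \xor_(i'.+1 <= m' < j')
    \big[addb/false]_(w <- U) ((letter m == w) && (letter m' == w))).
  rewrite big_nat [RHS]big_nat; apply: eq_bigr => m hm.
  rewrite oddz_sum big_nat [RHS]big_nat; apply: eq_bigr => m' hm'.
  have im : (0 < m <= size S)%N by move: hm jN; clear; lia.
  have im' : (0 < m' <= size S)%N by move: hm' jN'; clear; lia.
  rewrite (xor_letter (letter_in im) (fun w => letter m' == w)) [_ == letter m]eq_sym.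
  have nmm : m != m' by move: D hm hm'; clear; lia.
  have [e|n] := boolP (letter m == letter m').
    have /x_mate : same_letter m m' by rewrite /same_letter im im' nmm.
    by case=> ->.
  by rewrite x_other // /same_letter (negbTE n) !andbF.
under eq_bigr => m _ do rewrite exchange_big.
rewrite exchange_big; apply: eq_bigr => w _ /=.
by rewrite /occ big_distrlr.
Qed.

Definition row_sum k i j := \sum_(i.+1 <= m < j) x k m.

Lemma arc_sum_splitl i k j i' j' : (i < k < j)%N ->
  arc_sum i j i' j' = arc_sum i k i' j' + row_sum k i' j' + arc_sum k j i' j'.
Proof.
move=> /andP[ik kj]; rewrite /arc_sum (big_cat_nat ik (ltnW kj)) /=.
by rewrite [X in _ + X]big_ltn // addrA.
Qed.

Lemma arc_sumC i j i' j' : (j <= (size S).+1)%N -> (j' <= (size S).+1)%N ->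
  arc_sum i' j' i j = - arc_sum i j i' j'.
Proof.
move=> jN jN'; rewrite /arc_sum exchange_big /= -sumrN big_nat [RHS]big_nat.
apply: eq_bigr => m hm; rewrite -sumrN big_nat [RHS]big_nat; apply: eq_bigr => m' hm'.
by apply: xC; lia.
Qed.

Lemma row_mate k k' i j : (forall m, same_letter k m -> m = k') -> row_sum k i j =
  if (i < k' < j)%N then x k k' else 0.
Proof.
move=> h; have z m : m != k' -> x k m = 0.
  by move=> n; apply: x_other; apply: contra n => /h ->.
case: ifP => [/andP[ik kj]|n]; last first.
  by rewrite /row_sum big_nat big1 // => m hm; apply: z; apply: contraFneq n => <-.
rewrite /row_sum (big_cat_nat ik (ltnW kj)) /= [X in _ + X]big_ltn //.
rewrite big_nat big1 ?add0r => [|m hm]; last by apply: z; lia.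
by rewrite big_nat big1 ?addr0 // => m hm; apply: z; lia.
Qed.

Lemma arc_sum_splitr i j i' k j' : (j <= (size S).+1)%N -> (j' <= (size S).+1)%N ->
  (i' < k < j')%N -> arc_sum i j i' j' = arc_sum i j i' k - row_sum k i j + arc_sum i j k j'.
Proof.
move=> jN jN' hk; have kN : (k <= (size S).+1)%N by lia.
rewrite (arc_sumC i' i jN' jN) (arc_sumC i' i kN jN) (arc_sumC k i jN' jN).
by rewrite (arc_sum_splitl _ _ hk); ring.
Qed.

(** The sign at the first visit corrected by the parity of that position; the correction comes from
    the length of an arc in [gauss_interlaced]. *)
Definition gauss_diagonal u := (x (pos1 u) (pos2 u) == 1) (+) odd (pos1 u).

Lemma interlace_symS u v : u \in S -> interlace S u v = interlace S v u.
Proof. by move=> uS; apply: interlace_sym; exact: dS. Qed.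

(** A letter is interlaced with [u] when it lies once on the loop at [u] and once off it, so
    [sum_self] modulo 2 counts the neighbours of [u]. *)
Lemma xor_interlace_self u : u \in S -> \big[addb/false]_(w <- U) interlace S u w = false.
Proof.
move=> uS; have [h1 h2 h3] := pos_bounds uS.
have /(congr1 oddz) := sum_self (introT andP (conj h1 h2)) h3 (same_letter_pos uS).
rewrite oddzD !odd_arc_sum //; try lia.
rewrite -big_split /= => H; apply: etrans H; apply: eq_xor => w; rewrite mem_undup => wS.
have [<-|nuw] := eqVneq u w.
  by rewrite interlacexx (@occ_self (pos1 u)) //; lia.
rewrite interlace_occ //; have := occ_total wS.
have lu m : m = pos1 u \/ m = pos2 u -> letter m == w = false.
  move=> em; have /eqP -> : letter m == u by rewrite letter_pos; [case: em; lia| |case: em; lia].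
  exact: negbTE.
rewrite (@occ_split 0 (pos1 u)); last by lia.
rewrite (@occ_split (pos1 u) (pos2 u)); last by lia.
rewrite !lu; try by [left|right].
by case: (occ 0 _ _); case: (occ (pos1 u) _ _); case: (occ (pos2 u) _ _).
Qed.

Lemma letter_pos1 u : u \in S -> letter (pos1 u) = u.
Proof.
by move=> uS; have [h1 h2 h3] := pos_bounds uS; apply/eqP; rewrite letter_pos ?eqxx //; lia.
Qed.

Lemma letter_pos2 u : u \in S -> letter (pos2 u) = u.
Proof.
by move=> uS; have [h1 h2 h3] := pos_bounds uS; apply/eqP; rewrite letter_pos ?eqxx ?orbT //; lia.
Qed.

Lemma pos_neq u v : u \in S -> v \in S -> u != v ->
  [/\ pos1 u != pos1 v, pos1 u != pos2 v, pos2 u != pos1 v & pos2 u != pos2 v].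
Proof.
move=> uS vS nuv; split; apply: contra nuv => /eqP e; apply/eqP.
- by rewrite -(letter_pos1 uS) e letter_pos1.
- by rewrite -(letter_pos1 uS) e letter_pos2.
- by rewrite -(letter_pos2 uS) e letter_pos1.
- by rewrite -(letter_pos2 uS) e letter_pos2.
Qed.

Definition common_neighbours u v := \big[addb/false]_(w <- U) (interlace S u w && interlace S w v).

Lemma gauss_disjoint u v : u \in S -> v \in S -> (pos2 u < pos1 v)%N ->
  common_neighbours u v = false /\ interlace S u v = false.
Proof.
move=> uS vS uv; have [h1 h2 h3] := pos_bounds uS; have [k1 k2 k3] := pos_bounds vS.
have nuv : u != v by apply: contraTneq uv => ->; lia.
split; last by rewrite interlace_occ // occ_self //; lia.
have := sum_disjoint (introT andP (conj h1 h2)) uv k2 k3 (same_letter_pos uS) (same_letter_pos vS).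
move=> /(congr1 oddz); rewrite odd_arc_sum; [|lia|lia|lia] => H.
apply: etrans H; apply: eq_xor => w; rewrite mem_undup => wS.
have [<-|nuw] := eqVneq u w.
  by rewrite interlacexx [occ _ _ u]occ_self //; lia.
have [<-|nvw] := eqVneq v w.
  by rewrite interlacexx [occ (pos1 v) _ v]occ_self ?andbF //; lia.
by rewrite interlace_occ // (interlace_symS _ wS) interlace_occ.
Qed.

Lemma occ_outside u w : u \in S -> w \in S -> u != w ->
  occ (pos1 u) (pos2 u) w = occ (pos2 u) (size S).+1 w (+) occ 0 (pos1 u) w.
Proof.
move=> uS wS nuw; have [h1 h2 h3] := pos_bounds uS; have := occ_total wS.
rewrite (@occ_split 0 (pos1 u)); last by lia.
rewrite (@occ_split (pos1 u) (pos2 u)); last by lia.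
rewrite letter_pos1 // letter_pos2 // (negbTE nuw).
by case: (occ 0 _ _); case: (occ (pos1 u) _ _); case: (occ (pos2 u) _ _).
Qed.

Lemma gauss_nested u v : u \in S -> v \in S -> (pos1 u < pos1 v)%N -> (pos2 v < pos2 u)%N ->
  common_neighbours u v = false /\ interlace S u v = false.
Proof.
move=> uS vS uv vu; have [h1 h2 h3] := pos_bounds uS; have [k1 k2 k3] := pos_bounds vS.
have nuv : u != v by apply: contraTneq uv => ->; lia.
split; last by rewrite interlace_symS // interlace_occ // 1?eq_sym // occ_self //; lia.
have := sum_nested (introT andP (conj h1 uv)) k2 vu h3 (same_letter_pos uS) (same_letter_pos vS).
move=> /(congr1 oddz); rewrite oddzD !odd_arc_sum; [|lia|lia|lia|lia|lia|lia].
rewrite -big_split /= => H; apply: etrans H; apply: eq_xor => w; rewrite mem_undup => wS.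
have [<-|nuw] := eqVneq u w.
  by rewrite interlacexx [occ (pos1 v) _ u]occ_self //; lia.
have [<-|nvw] := eqVneq v w.
  by rewrite interlacexx [occ (pos1 v) _ v]occ_self ?andbF //; lia.
rewrite interlace_occ // (interlace_symS _ wS) interlace_occ // occ_outside //.
by case: (occ (pos1 v) _ _); rewrite ?andbT ?andbF.
Qed.

(** Subtracting the first two relations and inserting the third leaves a sum of even terms; half of
    it determines the parity of [AC + AD - CD] by whether the two signs agree. The halving needs
    integers, so the relations cannot be reduced modulo 2 beforehand. *)
Lemma parity_arithmetic (AB AC AD BC BD CD xu xv : int) :
  AC + AD + BC + BD + xv = 0 -> BD - AB + CD - AC - xu = 0 -> AB - AD + BC + CD = 0 ->
  xu = 1 \/ xu = -1 -> xv = 1 \/ xv = -1 ->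
  oddz AC (+) oddz BD = (xu == 1) (+) (xv == 1) (+) (oddz AB (+) oddz AC (+) oddz AD).
Proof.
move=> e1 e2 e3 [] eu [] ev; rewrite eu ev in e1 e2 *; rewrite -!oddzD /= /oddz; lia.
Qed.

(** [A], [B], [C], [D] are the four arcs between consecutive visits to the two double points, [D]
    passing the base point. The relations are [sum_self] for either letter and [sum_interlaced],
    written in these arcs. *)
Lemma interlaced_sums i j i' j' (N1 := (size S).+1) : (0 < i < i')%N -> (i' < j)%N ->
  (j < j')%N -> (j' <= size S)%N -> same_letter i j -> same_letter i' j' ->
  (forall m, same_letter i m -> m = j) -> (forall m, same_letter j m -> m = i) ->
  (forall m, same_letter i' m -> m = j') -> (forall m, same_letter j' m -> m = i') ->
  let AB := arc_sum i i' i' j in let AC := arc_sum i i' j j' in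
  let AD := arc_sum i i' j' N1 + arc_sum i i' 0 i in
  let BC := arc_sum i' j j j' in let BD := arc_sum i' j j' N1 + arc_sum i' j 0 i in
  let CD := arc_sum j j' j' N1 + arc_sum j j' 0 i in
  [/\ AC + AD + BC + BD + x i' j' = 0, BD - AB + CD - AC - x i j = 0 &
    AB - AD + BC + CD = 0].
Proof.
move=> /andP[i0 ii'] i'j jj' j'N lu lv ui uj ui' uj' AB AC AD BC BD CD.
have ijN : (0 < i < j)%N by lia.
have jN : (j <= size S)%N by lia.
have i'j'N : (0 < i' < j')%N by lia.
have b1 : (i' <= N1)%N by lia.
have b2 : (j <= N1)%N by lia.
have b3 : (j' <= N1)%N by lia.
have s1 : (i < i' < j)%N by lia.
have s2 : (i' < j < j')%N by lia.
have s3 : (j < j' < N1)%N by lia.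
have s4 : (0 < i < i')%N by lia.
have r1 a b := @row_mate i' j' a b ui'; have r2 a b := @row_mate j' i' a b uj'.
have r3 a b := @row_mate j i a b uj; have r4 a b := @row_mate i j a b ui.
split.
- have := sum_self ijN jN lu; rewrite -/N1 !(arc_sum_splitl _ _ s1).
  rewrite (@arc_sum_splitr i i' j j' N1) // (@arc_sum_splitr i' j j j' N1) //.
  rewrite !r1 !r2 s3 ltnn andbF /=.
  have -> : (0 < j' < i)%N = false by lia.
  by rewrite /AC /AD /BC /BD; lra.
- have := sum_self i'j'N j'N lv; rewrite -/N1 !(arc_sum_splitl _ _ s2).
  rewrite (@arc_sum_splitr i' j 0 i i') // (@arc_sum_splitr j j' 0 i i') //.
  have s5 : (0 < i < i')%N by lia.
  rewrite !r3 !r4 s5 ltnn andbF /=.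
  have -> : (j' < i < N1)%N = false by lia.
  rewrite (@arc_sumC i i' i' j) // (@arc_sumC i i' j j') // (@xC i j); [|lia|lia].
  by rewrite /AB /AC /BD /CD; lra.
have := sum_interlaced (introT andP (conj i0 ii')) i'j jj' j'N lu lv.
by rewrite -/N1 (@arc_sumC i' j j j') // /AB /AD /BC /CD; lra.
Qed.

Lemma odd_interval i j : (j <= (size S).+1)%N -> odd (j - i.+1) = \big[addb/false]_(w <- U) occ i j w.
Proof.
move=> jN; rewrite exchange_big /=.
transitivity (oddz (\sum_(i.+1 <= m < j) 1)).
  by rewrite sumr_const_nat natz /oddz absz_nat.
rewrite oddz_sum big_nat [RHS]big_nat; apply: eq_bigr => m hm.
have im : (0 < m <= size S)%N by lia.
apply: etrans (esym (xor_letter (letter_in im) xpredT)) _.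
by apply: eq_bigr => w _; rewrite andbT.
Qed.

(** The common neighbours are counted by [AC + BD] modulo 2, which [parity_arithmetic] expresses by
    the two signs and [AB + AC + AD]; the latter is the parity of the length of arc [A]. *)
Lemma gauss_interlaced u v : u \in S -> v \in S -> (pos1 u < pos1 v)%N ->
  (pos1 v < pos2 u)%N -> (pos2 u < pos2 v)%N ->
  common_neighbours u v = ~~ (gauss_diagonal u (+) gauss_diagonal v) /\ interlace S u v.
Proof.
move=> uS vS uv vu uv2; have [h1 h2 h3] := pos_bounds uS; have [k1 k2 k3] := pos_bounds vS.
have nuv : u != v by apply: contraTneq uv => ->; lia.
have order := conj (conj uv (conj vu uv2)) (conj h1 k3).
have lu := same_letter_pos uS; have lv := same_letter_pos vS.
split; last first.
  rewrite interlace_occ // (@occ_split _ (pos1 v)); last by lia.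
  by rewrite letter_pos1 // eqxx !occ_self //; lia.
have [] := interlaced_sums (introT andP (conj h1 uv)) vu uv2 k3 lu lv
  (fun m => (same_letter_uniq m uS).1) (fun m => (same_letter_uniq m uS).2)
  (fun m => (same_letter_uniq m vS).1) (fun m => (same_letter_uniq m vS).2).
move=> e1 e2 e3; have := parity_arithmetic e1 e2 e3 (x_mate lu) (x_mate lv).
have tot w : w \in S -> u != w -> v != w ->
    occ (pos1 u) (pos1 v) w (+) occ (pos1 v) (pos2 u) w (+) occ (pos2 u) (pos2 v) w =
    occ (pos2 v) (size S).+1 w (+) occ 0 (pos1 u) w.
  move=> wS nuw nvw; have := occ_total wS.
  rewrite (@occ_split 0 (pos1 u)); last by order_lia.
  rewrite (@occ_split (pos1 u) (pos1 v) (size S).+1); last by order_lia.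
  rewrite (@occ_split (pos1 v) (pos2 u) (size S).+1); last by order_lia.
  rewrite (@occ_split (pos2 u) (pos2 v) (size S).+1); last by order_lia.
  rewrite !letter_pos1 // !letter_pos2 // (negbTE nuw) (negbTE nvw).
  move: (occ 0 _ _) (occ (pos1 u) _ _) (occ (pos1 v) _ _) (occ (pos2 u) _ _) (occ (pos2 v) _ _).
  by do 5 case.
have self_u i j : (j <= (size S).+1)%N -> ~~ (i < pos1 u < j)%N -> ~~ (i < pos2 u < j)%N ->
    occ i j u = false by exact: occ_self.
have self_v i j : (j <= (size S).+1)%N -> ~~ (i < pos1 v < j)%N -> ~~ (i < pos2 v < j)%N ->
    occ i j v = false by exact: occ_self.
rewrite !oddzD !odd_arc_sum; try order_lia.
rewrite -!big_split /= => H.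
(* A letter is interlaced with both [u] and [v] when its occurrences lie on opposite arcs: [A] and
   [C], or [B] and [D]. *)
have -> : common_neighbours u v = \big[addb/false]_(w <- U)
    ((occ (pos1 u) (pos1 v) w && occ (pos2 u) (pos2 v) w) (+)
     (occ (pos1 v) (pos2 u) w && occ (pos2 v) (size S).+1 w (+)
      occ (pos1 v) (pos2 u) w && occ 0 (pos1 u) w)).
  apply: eq_xor => w; rewrite mem_undup => wS.
  have [<-|nuw] := eqVneq u w.
    by rewrite interlacexx !self_u ?andbF //; order_lia.
  have [<-|nvw] := eqVneq v w.
    by rewrite interlacexx andbF !self_v ?andbF //; order_lia.
  rewrite interlace_occ // (interlace_symS _ wS) interlace_occ // -andb_addr -tot //.
  rewrite (@occ_split (pos1 u) (pos1 v)); last by order_lia.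
  rewrite (@occ_split (pos1 v) (pos2 u) (pos2 v)); last by order_lia.
  rewrite letter_pos1 // letter_pos2 // (negbTE nuw) (negbTE nvw).
  move: (occ (pos1 u) _ _) (occ (pos1 v) _ _) (occ (pos2 u) _ _).
  by do 3 case.
rewrite H /gauss_diagonal.
(* A letter met once on [A] has its other occurrence on [B], [C] or [D]. Hence [AB + AC + AD] has
   the parity of [pos1 v - pos1 u - 1]. *)
have := odd_interval (pos1 u) (leqW (leq_trans (ltnW k2) k3)).
rewrite oddB // oddS.
have -> : \big[addb/false]_(w <- U) occ (pos1 u) (pos1 v) w = \big[addb/false]_(w <- U)
   (occ (pos1 u) (pos1 v) w && occ (pos1 v) (pos2 u) w (+)
    occ (pos1 u) (pos1 v) w && occ (pos2 u) (pos2 v) w (+)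
    (occ (pos1 u) (pos1 v) w && occ (pos2 v) (size S).+1 w (+)
     occ (pos1 u) (pos1 v) w && occ 0 (pos1 u) w)).
  apply: eq_xor => w; rewrite mem_undup => wS.
  have [<-|nuw] := eqVneq u w.
    by rewrite !self_u //; order_lia.
  have [<-|nvw] := eqVneq v w.
    by rewrite !self_v //; order_lia.
  move: (tot w wS nuw nvw).
  move: (occ 0 _ _) (occ (pos1 u) _ _) (occ (pos1 v) _ _) (occ (pos2 u) _ _) (occ (pos2 v) _ _).
  by do 5 case.
move=> <-; move: (x _ _ == 1) (x _ _ == 1) (odd (pos1 u)) (odd (pos1 v)).
by do 4 case.
Qed.

Theorem gauss_invariant_crossings :
  gauss_invariant (undup S) (interlace S) pred0 gauss_diagonal.
Proof.
have side u v : u \in S -> v \in S -> (pos1 u < pos1 v)%N -> common_neighbours u v =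
    interlace S u v && ~~ (gauss_diagonal u (+) gauss_diagonal v).
  move=> uS vS uv; have nuv : u != v by apply: contraTneq uv => ->; lia.
  have [h1 h2 h3] := pos_bounds uS; have [k1 k2 k3] := pos_bounds vS.
  have [n1 n2 n3 n4] := pos_neq uS vS nuv.
  have [vu|vu] := ltnP (pos1 v) (pos2 u); last first.
    by have [-> ->] := gauss_disjoint uS vS (ltac:(lia)).
  have [vu2|vu2] := ltnP (pos2 u) (pos2 v).
    by have [-> ->] := gauss_interlaced uS vS uv vu vu2.
  by have [-> ->] := gauss_nested uS vS uv (ltac:(lia)).
split=> [u v|u]; rewrite !mem_undup => uS.
  move=> vS nuv; have [n1 _ _ _] := pos_neq uS vS nuv.
  have [uv|vu|e] := ltngtP (pos1 u) (pos1 v); last by rewrite e eqxx in n1.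
    exact: side.
  rewrite (interlace_symS _ uS) addbC -side // /common_neighbours.
  by apply: eq_xor => w; rewrite mem_undup => wS; rewrite andbC (interlace_symS _ wS) (interlace_symS _ uS).
by move=> _; exact: xor_interlace_self.
Qed.

End Parity.

(** * Stereographic projection in an orthogonal frame *)

Section Frame.
Variable R : realType.
Local Notation vec := (R * R * R)%type.
Implicit Types (P Q a d q v w z : vec).

Definition dot3 v w := v.1.1 * w.1.1 + v.1.2 * w.1.2 + v.2 * w.2.
Definition cross3 v w : vec := (v.1.2 * w.2 - v.2 * w.1.2, v.2 * w.1.1 - v.1.1 * w.2,
  v.1.1 * w.1.2 - v.1.2 * w.1.1).
Definition comb3 (r s : R) v w : vec :=
  (r * v.1.1 + s * w.1.1, r * v.1.2 + s * w.1.2, r * v.2 + s * w.2).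

Lemma dot3C v w : dot3 v w = dot3 w v.
Proof. by rewrite /dot3; ring. Qed.

Lemma dot3_comb r s v w z : dot3 (comb3 r s v w) z = r * dot3 v z + s * dot3 w z.
Proof. by rewrite /dot3 /comb3 /=; ring. Qed.

Lemma dot3_ge0 v : 0 <= dot3 v v.
Proof. by rewrite /dot3; nra. Qed.

Lemma dot3_eq0 v : dot3 v v = 0 -> v = (0, 0, 0).
Proof.
case: v => [[x y] z]; rewrite /dot3 /= => e.
by congr (_, _, _); nra.
Qed.

Lemma dot3_unit_eq v w : dot3 v v = 1 -> dot3 w w = 1 -> dot3 v w = 1 -> v = w.
Proof.
move=> vv ww vw; have : dot3 (comb3 1 (-1) v w) (comb3 1 (-1) v w) = 0.
  by rewrite dot3_comb !(dot3C _ (comb3 _ _ _ _)) !dot3_comb (dot3C w v) vv ww vw; ring.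
move=> /dot3_eq0; case: v w {vv ww vw} => [[x y] z] [[x' y'] z']; rewrite /comb3 /= => -[e1 e2 e3].
by congr (_, _, _); lra.
Qed.

Lemma dot3_cross v w : dot3 (cross3 v w) (cross3 v w) = dot3 v v * dot3 w w - dot3 v w ^+ 2.
Proof. by rewrite /dot3 /cross3 /=; ring. Qed.

Lemma dot3_crossl v w : dot3 v (cross3 v w) = 0.
Proof. by rewrite /dot3 /cross3 /=; ring. Qed.

Lemma dot3_crossr v w : dot3 w (cross3 v w) = 0.
Proof. by rewrite /dot3 /cross3 /=; ring. Qed.

Variables (q a : vec).
Hypotheses (qq : dot3 q q = 1) (qa : dot3 q a = 0) (a0 : dot3 a a != 0).
Local Notation A := (dot3 a a).
Local Notation b := (cross3 q a).

(** The vectors [a], [b], [q] are pairwise orthogonal, with squared lengths [A], [A] and 1; this is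
    the expansion of the scalar product in that frame. *)
Lemma frame_dot w z :
  A * dot3 w z = dot3 w a * dot3 z a + dot3 w b * dot3 z b + A * (dot3 w q * dot3 z q).
Proof.
have : (dot3 q q * A - dot3 q a ^+ 2) * dot3 w z = dot3 w b * dot3 z b +
    A * (dot3 w q * dot3 z q) + dot3 q q * (dot3 w a * dot3 z a) -
    dot3 q a * (dot3 w q * dot3 z a + dot3 w a * dot3 z q).
  by rewrite /dot3 /cross3 /=; ring.
by rewrite qq qa; lra.
Qed.

Lemma frame_eq0 w : dot3 w a = 0 -> dot3 w b = 0 -> dot3 w q = 0 -> w = (0, 0, 0).
Proof.
move=> wa wb wq; apply: dot3_eq0; apply: (mulfI a0).
by rewrite frame_dot wa wb wq; ring.
Qed.

(* Stereographic projection from [q], in the orthogonal frame [(a, b)] of the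
   plane orthogonal to [q]. *)
Definition chart_x P := dot3 P a / (1 - dot3 P q).
Definition chart_y P := dot3 P b / (1 - dot3 P q).

(** On the unit sphere [1 - dot3 P q] times the sum of [A] and the squares of the chart coordinates
    equals [2 * A]. The coordinates therefore determine the height, and then the other
    components. *)
Lemma chart_inj P Q : dot3 P P = 1 -> dot3 Q Q = 1 -> dot3 P q != 1 -> dot3 Q q != 1 ->
  chart_x P = chart_x Q -> chart_y P = chart_y Q -> P = Q.
Proof.
move=> PP QQ Pq Qq; rewrite /chart_x /chart_y => ex ey.
have scale S : dot3 S S = 1 -> dot3 S q != 1 -> (1 - dot3 S q) *
    ((dot3 S a / (1 - dot3 S q)) ^+ 2 + (dot3 S b / (1 - dot3 S q)) ^+ 2 + A) = 2 * A.
  move=> SS Sq; have := frame_dot S S; rewrite SS mulr1 => e.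
  have k0 : 1 - dot3 S q != 0 by rewrite subr_eq0 eq_sym.
  apply: (mulfI k0).
  rewrite (_ : _ * (_ * _) = dot3 S a ^+ 2 + dot3 S b ^+ 2 + (1 - dot3 S q) ^+ 2 * A).
    by rewrite [in RHS]mulrCA; nra.
  by field.
have A0 : 0 < A by rewrite lt_neqAle eq_sym a0 dot3_ge0.
have ek : dot3 P q = dot3 Q q.
  have := scale P PP Pq; have := scale Q QQ Qq; rewrite ex ey.
  set Z := _ ^+ 2 + _ ^+ 2 + A => e1 e2.
  have Z0 : Z != 0.
    by rewrite gt_eqF // /Z; apply: ltr_wpDl => //; rewrite addr_ge0 ?sqr_ge0.
  have : (1 - dot3 P q) * Z = (1 - dot3 Q q) * Z by rewrite e1 e2.
  by move=> /(mulIf Z0); lra.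
have k0 : (1 - dot3 Q q)^-1 != 0 by rewrite invr_eq0 subr_eq0 eq_sym.
move: ex ey; rewrite ek => /(mulIf k0) ea /(mulIf k0) eb.
apply: dot3_unit_eq => //; apply: (mulfI a0).
by rewrite frame_dot ea eb ek -frame_dot QQ.
Qed.

Definition dchart_x P d := dot3 d a * (1 - dot3 P q) + dot3 P a * dot3 d q.
Definition dchart_y P d := dot3 d b * (1 - dot3 P q) + dot3 P b * dot3 d q.

(** [dchart_x] and [dchart_y] are the numerators of the quotient rule. Together with tangency at [P]
    their vanishing forces [dot3 d q = 0], and then the other components vanish. *)
Lemma dchart_eq0 P d : dot3 P P = 1 -> dot3 P q != 1 -> dot3 P d = 0 ->
  dchart_x P d = 0 -> dchart_y P d = 0 -> d = (0, 0, 0).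
Proof.
rewrite /dchart_x /dchart_y => PP Pq Pd ex ey.
have k0 : 1 - dot3 P q != 0 by rewrite subr_eq0 eq_sym.
have dq : dot3 d q = 0.
  apply: (mulfI a0); apply: (mulfI k0); rewrite !mulr0.
  have := frame_dot P P; have := frame_dot P d; rewrite PP Pd mulr0 mulr1 => e1 e2.
  move: e1 e2 ex ey; move: (dot3 P a) (dot3 P b) (dot3 P q) (dot3 d a) (dot3 d b) (dot3 d q) (dot3 a a).
  move=> pa pb pq da db dq AA e1 e2 ex ey.
  have h : (1 - pq) * (pa * da + pb * db + AA * (pq * dq)) = 0 by rewrite -e1 mulr0.
  have -> : (1 - pq) * (AA * dq) = - ((1 - pq) * (pa * da + pb * db + AA * (pq * dq))) +
    pa * (da * (1 - pq) + pa * dq) + pb * (db * (1 - pq) + pb * dq) +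
    dq * (AA - (pa * pa + pb * pb + AA * (pq * pq))) by ring.
  by rewrite h ex ey -e2; ring.
apply: frame_eq0 => //; apply: (mulIf k0); rewrite mul0r.
  by move: ex; rewrite dq mulr0 addr0.
by move: ey; rewrite dq mulr0 addr0.
Qed.

Lemma dchart_comb r s P d d' : dchart_x P (comb3 r s d d') = r * dchart_x P d + s * dchart_x P d' /\
  dchart_y P (comb3 r s d d') = r * dchart_y P d + s * dchart_y P d'.
Proof. by rewrite /dchart_x /dchart_y !dot3_comb; split; ring. Qed.

Lemma dchart_independent P d d' : dot3 P P = 1 -> dot3 P q != 1 -> dot3 P d = 0 -> dot3 P d' = 0 ->
  (forall r s, comb3 r s d d' = (0, 0, 0) -> r = 0 /\ s = 0) ->
  dchart_x P d * dchart_y P d' - dchart_y P d * dchart_x P d' != 0.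
Proof.
move=> PP Pq Pd Pd' ind; apply/eqP => j0.
have key r s : r * dchart_x P d + s * dchart_x P d' = 0 -> r * dchart_y P d + s * dchart_y P d' = 0 ->
    r = 0 /\ s = 0.
  move=> e1 e2; apply: ind; have [c1 c2] := dchart_comb r s P d d'.
  by apply: (dchart_eq0 PP Pq); rewrite ?c1 ?c2 // dot3C dot3_comb !(dot3C _ P) Pd Pd'; ring.
have [x'0 x0] : dchart_x P d' = 0 /\ - dchart_x P d = 0 by apply: key; lra.
have [y'0 y0] : dchart_y P d' = 0 /\ - dchart_y P d = 0 by apply: key; lra.
have [] : (1 : R) = 0 /\ (0 : R) = 0 by apply: key; lra.
by move/eqP; rewrite oner_eq0.
Qed.

End Frame.

(** * A centre of projection off the curve *)

Section Pole.
Variables (R : realType) (h h' : R -> R * R * R).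
Hypothesis h_sphere : forall t, dot3 (h t) (h t) = 1.
Hypothesis dh1 : forall t : R, is_derive t (1 : R) (fun s : R => (h s).1.1) (h' t).1.1.
Hypothesis dh2 : forall t : R, is_derive t (1 : R) (fun s : R => (h s).1.2) (h' t).1.2.
Hypothesis dh3 : forall t : R, is_derive t (1 : R) (fun s : R => (h s).2) (h' t).2.

Lemma is_derive_dot3 w (t : R) : is_derive t (1 : R) (fun s : R => dot3 (h s) w) (dot3 (h' t) w).
Proof.
have c (x : R) := is_derive_const t x.
have := is_derive_add (is_derive_add (is_derive_mul (dh1 t) (c w.1.1))
  (is_derive_mul (dh2 t) (c w.1.2))) (is_derive_mul (dh3 t) (c w.2)).
by congr is_derive; rewrite /dot3; ring.
Qed.

Lemma tangent_dot3 t : dot3 (h t) (h' t) = 0.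
Proof.
have d := is_derive_add (is_derive_add (is_derive_mul (dh1 t) (dh1 t))
  (is_derive_mul (dh2 t) (dh2 t))) (is_derive_mul (dh3 t) (dh3 t)).
have e : (fun s => (h s).1.1 * (h s).1.1 + (h s).1.2 * (h s).1.2 + (h s).2 * (h s).2) = fun=> 1.
  by apply/funext => s; exact: h_sphere.
rewrite e in d; have := is_derive_derive1 d.
rewrite (is_derive_derive1 (is_derive_const t 1)) /dot3; lra.
Qed.

Hypothesis h_periodic : forall t, h (t + 1) = h t.
Hypothesis h_simple : forall t, h t = h 0 -> t \is a Num.int.
Hypothesis h'0 : dot3 (h' 0) (h' 0) != 0.

(** Rational parametrization of the great circle through [h 0] orthogonal to the velocity there;
    [l = 0] gives [h 0]. *)
Definition pole (l : R) := let A := dot3 (h' 0) (h' 0) in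
  comb3 ((1 - l ^+ 2 * A) / (1 + l ^+ 2 * A)) (2 * l / (1 + l ^+ 2 * A))
    (h 0) (cross3 (h 0) (h' 0)).

Lemma continuous_dot3 w : continuous (fun s : R => dot3 (h s) w).
Proof.
move=> t; apply: differentiable_continuous; apply/derivable1_diffP.
by have [] := is_derive_dot3 w t.
Qed.

(** A point slightly beside the simple point [h 0] is missed by the curve. Orthogonality to [h' 0]
    lets that velocity serve as the first frame vector. *)
Theorem exists_pole : exists q, [/\ dot3 q q = 1, dot3 q (h' 0) = 0 &
  forall t, dot3 (h t) q != 1].
Proof.
set p0 := h 0; set a := h' 0; set A := dot3 a a; set c := cross3 p0 a.
have A0 : 0 < A by rewrite lt_neqAle eq_sym h'0 dot3_ge0.
have pp : dot3 p0 p0 = 1 by exact: h_sphere.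
have pa : dot3 p0 a = 0 by exact: tangent_dot3.
have cc : dot3 c c = A by rewrite dot3_cross pp pa mul1r expr0n subr0.
have pc : dot3 p0 c = 0 by exact: dot3_crossl.
have ac : dot3 a c = 0 by exact: dot3_crossr.
have D0 l : 0 < 1 + l ^+ 2 * A by nra.
have Dn l : 1 + l ^+ 2 * A != 0 by rewrite gt_eqF.
have poleE l z : dot3 (pole l) z =
    ((1 - l ^+ 2 * A) * dot3 p0 z + 2 * l * dot3 c z) / (1 + l ^+ 2 * A).
  rewrite /pole dot3_comb -/p0 -/a -/A -/c; have := Dn l.
  move: (dot3 p0 z) (dot3 c z) (l ^+ 2 * A) => u w B B0; field; exact: B0.
have pole_unit l : dot3 (pole l) (pole l) = 1.
  rewrite poleE (dot3C p0) (dot3C c) !poleE (dot3C c p0) pp pc cc.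
  by field; exact: Dn.
have pole_a l : dot3 (pole l) a = 0 by rewrite poleE pa (dot3C c) ac; ring.
(* The period is centred at 0, so that the base point is visited only once, in the interior. *)
suff [l Hl] : exists l, forall t : R, -1/2 <= t <= 1/2 -> dot3 (h t) (pole l) != 1.
  exists (pole l); split=> // t.
  have -> : h t = h (frac_part (t + 1/2) - 1/2).
    have := periodic_int h_periodic (frac_part (t + 1/2) - 1/2) (Num.floor (t + 1/2)).
    by move=> <-; congr h; rewrite /frac_part; lra.
  by apply: Hl; have := frac_itv (t + 1/2); lra.
suff : \forall l \near (0 : R)^'+, forall t : R, -1/2 <= t <= 1/2 -> dot3 (h t) (pole l) != 1.
  by move=> H; have [l Hl] := @filter_ex _ (0 : R)^'+ _ _ H; exists l.
have cK : compact [set t : R | -1/2 <= t <= 1/2].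
  exact: (@segment_compact R (-1/2) (1/2)).
apply: (near_cover (P := fun l t => dot3 (h t) (pole l) != 1) cK) => t /= tK.
(* Near 0 the component along [a] changes at rate [A] while every pole is orthogonal to [a], so a
   hit could occur only at time 0, where the pole for [l > 0] differs from [h 0]. At other times the
   curve stays away from [h 0], hence from poles close to it. *)
have [t0|tn0] := eqVneq t 0.
  have A2 : 0 < A / 2 by lra.
  have /is_deriveP/(_ _ A2)/nbhs_ballP[r /= r0 Hr] := is_derive_dot3 a 0.
  exists r, 1; split=> // t' l; rewrite t0 subr0 => tr /andP[l0 _].
  apply/eqP => e; have et : h t' = pole l by exact: dot3_unit_eq.
  have : ball 0 r t' by rewrite /ball /= sub0r normrN.
  move=> /Hr; rewrite et pole_a -/p0 pa -/a -/A !subr0 sub0r normrN normrM (gtr0_norm A0) => ht.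
  have t'0 : `|t'| = 0 by have := normr_ge0 t'; nra.
  move: e; rewrite (normr0_eq0 t'0) -/p0 dot3C poleE pp (dot3C c) pc => e.
  have : 1 - l ^+ 2 * A = 1 + l ^+ 2 * A by apply: (divIf (Dn l)); rewrite divff //; lra.
  have : 0 < l ^+ 2 * A by rewrite mulr_gt0 // exprn_gt0.
  by lra.
have k0 : dot3 (h t) p0 < 1.
  rewrite lt_neqAle; apply/andP; split; last first.
    have := dot3_ge0 (comb3 1 (-1) (h t) p0).
    by rewrite dot3_comb !(dot3C _ (comb3 _ _ _ _)) !dot3_comb (dot3C p0) h_sphere pp; lra.
  apply/eqP => e; have /h_simple /intrP[m em] : h t = h 0 by exact: dot3_unit_eq.
  case/eqP: tn0; rewrite em; move: tK; rewrite em => /andP[m1 m2].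
  have : (-1 < m)%R by rewrite -(ltr_int R) intrN; lra.
  have : (m < 1)%R by rewrite -(ltr_int R); lra.
  by case: m {em m1 m2} => [[|m]|m].
pose k := 1 - dot3 (h t) p0; have k1 : dot3 (h t) p0 < 1 - k / 2 by rewrite /k; lra.
have /nbhs_ballP[r /= r0 Hr] : \forall t' \near t, dot3 (h t') p0 < 1 - k / 2.
  by apply: (@cvgr_lt _ _ _ _ _ _ (@continuous_dot3 p0 t)).
exists r, (k / 2 / (A + 1)); split=> //; first by rewrite !divr_gt0 // /k; lra.
move=> t' l tr /andP[l0 lk].
have {tr}/Hr : ball t r t' by rewrite /ball /= distrC.
have lk' : l * (A + 1) < k / 2 by rewrite -ltr_pdivlMr //; lra.
have s1 : -1 <= dot3 (h t') p0.
  have := dot3_ge0 (comb3 1 1 (h t') p0).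
  by rewrite dot3_comb !(dot3C _ (comb3 _ _ _ _)) !dot3_comb (dot3C p0) h_sphere pp; lra.
have s2 : 2 * dot3 (h t') c <= A + 1.
  have := dot3_ge0 (comb3 1 (-1) (h t') c).
  by rewrite dot3_comb !(dot3C _ (comb3 _ _ _ _)) !dot3_comb (dot3C c) h_sphere cc; lra.
move=> s3; rewrite dot3C poleE (dot3C p0) (dot3C c).
rewrite lt_eqF // ltr_pdivrMr // mul1r.
have B0 : 0 < l ^+ 2 * A by rewrite mulr_gt0 // exprn_gt0.
have : 2 * l * dot3 (h t') c <= l * (A + 1) by rewrite -mulrA mulrCA ler_pM2l.
by move: (dot3 (h t') p0) s1 s3 (l ^+ 2 * A) B0 => s s1 s3 B B0; nra.
Qed.

End Pole.

(** * Realizable words satisfy the parity conditions *)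

Section Necessity.
Variables (R : realType) (T : choiceType) (S : seq T) (x0 : T) (f : R -> 'rV[R]_3).
Variables (t0 : R) (o : bool) (ts : seq R) (pt : T -> 'rV[R]_3).
Local Notation traversal t := (f (t0 + (-1) ^+ o * t)).
Hypothesis dS : double_occurrence_word S.
Hypothesis gf : generic_immersion f.
Hypothesis base_simple : ~ double_points f (traversal 0).
Hypothesis ts_sorted : sorted <%R ts.
Hypothesis tsP : forall t, t \in ts <-> (0 < t < 1 /\ double_points f (traversal t)).
Hypothesis pt_inj : {in S &, injective pt}.
Hypothesis ptE : [seq pt x | x <- S] = [seq traversal t | t <- ts].

Definition coords (p : 'rV[R]_3) : R * R * R := (p 0 0, p 0 1, p 0 (lift 0 (lift 0 0))).

Lemma coords_inj : injective coords.
Proof.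
move=> p q [e0 e1 e2]; apply/rowP => i.
have [->|[->|->]] : i = 0 \/ i = 1 \/ i = lift 0 (lift 0 0).
- by case: i => -[|[|[|//]]] ?; [left|right; left|right; right]; exact: val_inj.
- exact: e0.
- exact: e1.
- exact: e2.
Qed.

Lemma coords_dot p q : dot3 (coords p) (coords q) = (p *m q^T) 0 0.
Proof. by rewrite mxE sum3 !mxE. Qed.

Lemma coords_comb r s p q : comb3 r s (coords p) (coords q) = coords (r *: p + s *: q).
Proof. by rewrite /comb3 /coords !mxE. Qed.

Definition lift3 t := coords (traversal t).
Definition dlift3 t := coords ((-1) ^+ o *: derive1 f (t0 + (-1) ^+ o * t)).

Let f_periodic : forall t, f (t + 1) = f t. Proof. by case: gf => -[]. Qed.
Let f_sphere : forall t, sphere2 (f t). Proof. by case: gf => -[]. Qed.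
Let f_immersed : forall t, derive1 f t != 0. Proof. by case: gf => -[]. Qed.
Let f_derivable : forall t, derivable f t 1. Proof. by case: gf => -[_ _ + _] _ _ _ t => /(_ 0%N). Qed.

Lemma is_derive_coord i (t : R) : is_derive t (1 : R) (fun s : R => traversal s 0 i)
  (((-1) ^+ o *: derive1 f (t0 + (-1) ^+ o * t)) 0 i).
Proof.
have d (s : R) : is_derive s (1 : R) (fun x : R => f x 0 i) (derive1 f s 0 i).
  have /derivable_mxP/(_ 0 i) d0 := @f_derivable s.
  rewrite derive1E derive_mx // mxE; exact: DeriveDef.
have a : is_derive t (1 : R) (fun s : R => t0 + (-1) ^+ o * s) ((-1) ^+ o).
  have := is_derive_add (is_derive_const t t0) (is_derive_mul (is_derive_const t ((-1) ^+ o)) (is_derive_var t)).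
  by congr is_derive; ring.
by rewrite mxE mulrC; exact: is_derive_compose (d _) a.
Qed.

Lemma lift3_sphere t : dot3 (lift3 t) (lift3 t) = 1.
Proof.
by have := f_sphere (t0 + (-1) ^+ o * t); rewrite /sphere2 /= sum3 /dot3 /lift3 /coords /=.
Qed.

Lemma lift3_periodic t : lift3 (t + 1) = lift3 t.
Proof.
rewrite /lift3 -[in RHS](periodic_int f_periodic _ ((-1) ^+ o)); congr (coords (f _)).
by rewrite rmorphXn rmorphN1; ring.
Qed.

Lemma same_circle_traversal s t :
  same_circle_point (t0 + (-1) ^+ o * s) (t0 + (-1) ^+ o * t) -> s - t \is a Num.int.
Proof.
rewrite /same_circle_point (_ : _ - _ = (-1) ^+ o * (s - t)); last by ring.
by case: (o); rewrite ?expr1 ?expr0 ?mul1r // mulN1r rpredN.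
Qed.

Lemma traversal_eq s t : traversal s = traversal t ->
  s - t \is a Num.int \/ double_points f (traversal s) /\ ~ same_circle_point
    (t0 + (-1) ^+ o * s) (t0 + (-1) ^+ o * t).
Proof.
move=> e; have [/same_circle_traversal|n] :=
  pselect (same_circle_point (t0 + (-1) ^+ o * s) (t0 + (-1) ^+ o * t)); first by left.
by right; split=> //; exists (t0 + (-1) ^+ o * s), (t0 + (-1) ^+ o * t).
Qed.

Lemma lift3_simple t : lift3 t = lift3 0 -> t \is a Num.int.
Proof.
move=> /coords_inj e; have [|[d _]] := traversal_eq e; first by rewrite subr0.
by case: base_simple; rewrite -e.
Qed.

Lemma dlift3_neq0 t : dlift3 t <> (0, 0, 0).
Proof.
move=> e; have /coords_inj/eqP : dlift3 t = coords 0 by rewrite e /coords !mxE.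
by rewrite scaler_eq0 signr_eq0 (negbTE (f_immersed _)).
Qed.

Lemma dlift3_independent s t : traversal s = traversal t -> ~ s - t \is a Num.int ->
  forall x y, comb3 x y (dlift3 s) (dlift3 t) = (0, 0, 0) -> x = 0 /\ y = 0.
Proof.
move=> e ns; have [//|[_ nc]] := traversal_eq e.
have [_ _ _ tr] := gf; have := eqmx_rank (tr _ _ nc e).
rewrite rank_tangent ?sphere2_neq0 // => rk x y; rewrite /dlift3 coords_comb => eq0.
move: rk; set d := derive1 f _; set d' := derive1 f _ => rk.
have {}eq0 : (x * (-1) ^+ o) *: d + (y * (-1) ^+ o) *: d' = 0.
  by apply: coords_inj; rewrite -!scalerA eq0 /coords !mxE.
have small (u v : 'rV[R]_3) (a b : R) : a *: u + b *: v = 0 -> \rank (u + v)%MS = 2%N -> a = 0.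
  move=> uv ruv; apply/eqP; apply: contraT => a0.
  have : (u <= v)%MS.
    have -> : u = (- (a^-1 * b)) *: v.
      rewrite scaleNr -scalerA -scalerN (_ : - (b *: v) = a *: u) ?scalerA ?mulVf ?scale1r //.
      by apply/esym/eqP; rewrite -addr_eq0 uv.
    exact: scalemx_sub (submx_refl _).
  by move=> /addsmx_idPr e1; have := eqmx_rank (introT eqmxP e1); rewrite ruv => e2; have := rank_leq_row v; rewrite -e2.
have s0 : (-1) ^+ o != 0 :> R by rewrite signr_eq0.
split; apply: (mulIf s0); rewrite mul0r.
  exact: small eq0 rk.
apply: (small d' d _ (x * (-1) ^+ o)); first by rewrite addrC.
by rewrite addsmxC.
Qed.

Local Notation N := (size S).
Local Notation mates := (same_letter x0 S).

(** The list and the default value supply the two ends of the period: [met 0] is 0 and [met N.+1] is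
    1. *)
Definition met k := nth 1 (0 :: ts) k.

Lemma size_ts : size ts = N.
Proof. by have := congr1 size ptE; rewrite !size_map. Qed.

Lemma met_inner m : inner N m -> [/\ met m \in ts, 0 < met m < 1 &
  pt (letter x0 S m) = traversal (met m)].
Proof.
case: m => // m /andP[_ mN]; have mt : (m < size ts)%N by rewrite size_ts.
have mem : met m.+1 \in ts by exact: mem_nth.
have [b _] := (tsP (met m.+1)).1 mem; split=> //.
have := congr1 (fun s => nth (pt x0) s m) ptE; rewrite /= (nth_map x0) // => ->.
by rewrite (nth_map 1).
Qed.

Lemma met_in t : t \in ts -> exists2 m, inner N m & t = met m.
Proof.
move=> tt; exists (index t ts).+1; last by rewrite /met /= nth_index.
by rewrite /inner /= -size_ts index_mem.
Qed.

Lemma met_lt k : (k <= N)%N -> met k < met k.+1.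
Proof.
move=> kN; have srt : sorted <%R (0 :: ts).
  rewrite /= path_sortedE; last exact: lt_trans.
  by rewrite ts_sorted andbT; apply/allP => t /tsP [/andP[]].
have [kN'|kN'] := ltnP k N.
  by apply: (sorted_ltn_nth lt_trans 1 srt) => //=; rewrite inE /= size_ts ltnS // ltnW.
have -> : k = N by apply/eqP; rewrite eqn_leq kN.
rewrite {2}/met nth_default /= ?size_ts //.
have [e|N0] := posnP N; first by rewrite e /met /= ltr01.
have iN : inner N N by rewrite /inner N0 leqnn.
by have [_ /andP[_ ->]] := met_inner iN.
Qed.

Lemma mates_sym : symmetric mates.
Proof. by move=> m n; rewrite /same_letter andbCA eq_sym [letter _ _ _ == _]eq_sym. Qed.

Lemma mates_inner m n : mates m n -> inner N m /\ inner N n.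
Proof. by case/and4P. Qed.

Lemma mates_uniq m n n' : mates m n -> mates m n' -> n = n'.
Proof.
move=> /and4P[/andP[m0 mN] /andP[n0 nN] mn /eqP e] /and4P[_ /andP[n'0 n'N] mn' /eqP e'].
have p k : (0 < k)%N -> (k <= N)%N -> (k.-1 < N)%N by case: k.
have := no_third_occurrence dS (p m m0 mN) (p n n0 nN) (p n' n'0 n'N) e e'.
by move: m0 n0 n'0 mn mn'; clear; lia.
Qed.

Lemma has_mates m : inner N m -> exists2 n, inner N n & mates m n.
Proof.
case: m => // m /andP[_ mN]; have [n [nN nm e]] := other_occurrence x0 dS mN.
by exists n.+1; rewrite /same_letter /inner //= mN nN eqSS eq_sym nm /letter /= e eqxx.
Qed.

Lemma met_inj m n : inner N m -> inner N n -> met m = met n -> m = n.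
Proof.
have lt m' n' : (m' < n')%N -> (n' <= N)%N -> met m' < met n'.
  elim: n' => // n' IH; rewrite ltnS leq_eqVlt => /orP[/eqP -> /ltnW /met_lt //|mn] nN.
  exact: lt_trans (IH mn (ltnW nN)) (met_lt (ltnW nN)).
move=> /andP[_ mN] /andP[_ nN] e; have [mn|nm|//] := ltngtP m n.
  by have := lt _ _ mn nN; rewrite e ltxx.
by have := lt _ _ nm mN; rewrite e ltxx.
Qed.

Lemma unit_int (t : R) : 0 < t -> t <= 1 -> t \is a Num.int -> t = 1.
Proof.
move=> t0' t1 /intrP[m em]; move: t0' t1; rewrite em ltr0z => m0.
by rewrite -[1]/(1%:~R) ler_int => m1; congr _%:~R; move: m0 m1; clear; lia.
Qed.

Lemma not_int_diff (s t : R) : 0 < s < 1 -> 0 < t < 1 -> s != t -> ~ s - t \is a Num.int.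
Proof.
move=> s01 t01 st H; have [lt|lt|e] := ltrgtP s t; last by rewrite e eqxx in st.
  have H' : t - s \is a Num.int by rewrite -opprB rpredN.
  have b1 : 0 < t - s by lra.
  have b2 : t - s <= 1 by lra.
  by have := unit_int b1 b2 H'; lra.
have b1 : 0 < s - t by lra.
have b2 : s - t <= 1 by lra.
by have := unit_int b1 b2 H; lra.
Qed.

Lemma lift3_coincide (s t : R) : 0 <= s -> s < t -> t <= 1 -> lift3 s = lift3 t ->
  (s = 0 /\ t = 1) \/ exists m n, [/\ inner N m, inner N n, mates m n, s = met m & t = met n].
Proof.
move=> s0 st t1 /coords_inj e; have [i|[dp nc]] := traversal_eq e.
  have i' : t - s \is a Num.int by rewrite -opprB rpredN.
  have b1 : 0 < t - s by lra.
  have b2 : t - s <= 1 by lra.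
  by left; have := unit_int b1 b2 i'; lra.
right.
have s0' : 0 < s.
  by rewrite lt_neqAle s0 andbT; apply/eqP => es; case: base_simple; rewrite es.
have t1' : t < 1.
  rewrite lt_neqAle t1 andbT; apply/eqP => et; case: base_simple.
  have /coords_inj <- : lift3 1 = lift3 0 by rewrite -(lift3_periodic 0) add0r.
  have <- : traversal t = traversal 1 by rewrite et.
  by rewrite -e.
have ss : s \in ts by apply/tsP; split=> //; rewrite s0' (lt_trans st).
have tt : t \in ts by apply/tsP; split; [rewrite t1' (lt_trans s0')|rewrite -e].
have [m im em] := met_in ss; have [n jn en] := met_in tt.
exists m, n; split=> //; rewrite /same_letter.
have [_ _ pm] := met_inner im; have [_ _ pn] := met_inner jn.
have mn : m != n by apply: contraTneq st => emn; rewrite em en emn ltxx.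
apply/and4P; split=> //; apply/eqP/pt_inj.
- by apply: letter_in.
- by apply: letter_in.
by rewrite pm pn -em -en.
Qed.

(** Projection from the pole is injective on the curve and preserves independence of velocities, so
    the crossing identities for plane curves apply. *)
Theorem realizes_gauss : exists d, gauss_invariant (undup S) (interlace S) pred0 d.
Proof.
have dh1 (t : R) : is_derive t (1 : R) (fun s : R => (lift3 s).1.1) (dlift3 t).1.1.
  exact: is_derive_coord.
have dh2 (t : R) : is_derive t (1 : R) (fun s : R => (lift3 s).1.2) (dlift3 t).1.2.
  exact: is_derive_coord.
have dh3 (t : R) : is_derive t (1 : R) (fun s : R => (lift3 s).2) (dlift3 t).2.
  exact: is_derive_coord.
have a0 : dot3 (dlift3 0) (dlift3 0) != 0.
  by apply/eqP => /dot3_eq0; exact: dlift3_neq0.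
have [q [qq qa qh]] := exists_pole lift3_sphere dh1 dh2 dh3 lift3_periodic lift3_simple a0.
set a := dlift3 0 in qa a0; set b := cross3 q a.
have k0 t : 1 - dot3 (lift3 t) q != 0 by rewrite subr_eq0 eq_sym.
have d_dot w t := is_derive_dot3 dh1 dh2 dh3 w t.
have d_chart w t : is_derive t (1 : R) (fun s : R => dot3 (lift3 s) w / (1 - dot3 (lift3 s) q))
    ((dot3 (dlift3 t) w * (1 - dot3 (lift3 t) q) + dot3 (lift3 t) w * dot3 (dlift3 t) q) /
      (1 - dot3 (lift3 t) q) ^+ 2).
  have dk := @is_derive_sub R (fun=> 1) _ t _ _ (is_derive_const t 1) (d_dot q t).
  have := is_derive_mul (d_dot w t) (@is_derive_inv R (fun s => 1 - dot3 (lift3 s) q) t _ (k0 t) dk).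
  by congr is_derive; field; exact: k0.
have cont w : continuous (fun s : R => dot3 (lift3 s) w / (1 - dot3 (lift3 s) q)).
  move=> t; apply: differentiable_continuous; apply/derivable1_diffP.
  by have [] := d_chart w t.
pose gx t := chart_x q a (lift3 t); pose gy t := chart_y q a (lift3 t).
pose dx m := dchart_x q a (lift3 (met m)) (dlift3 (met m)) / (1 - dot3 (lift3 (met m)) q) ^+ 2.
pose dy m := dchart_y q a (lift3 (met m)) (dlift3 (met m)) / (1 - dot3 (lift3 (met m)) q) ^+ 2.
have met0 : met 0 = 0 by [].
have metN : met N.+1 = 1 by rewrite /met nth_default //= size_ts.
have e01 : lift3 0 = lift3 1 by rewrite -(lift3_periodic 0) add0r.
have mate_eq m n : inner N m -> inner N n -> mates m n ->
    [/\ m != n, gx (met m) = gx (met n), gy (met m) = gy (met n) & jac dx dy m n != 0].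
  move=> im jn /and4P[_ _ mn /eqP el].
  have [_ m01 pm] := met_inner im; have [_ n01 pn] := met_inner jn.
  have et : traversal (met m) = traversal (met n) by rewrite -pm -pn el.
  have e : lift3 (met m) = lift3 (met n) by rewrite /lift3 et.
  split=> //; try by rewrite /gx /gy e.
  have ni : ~ met m - met n \is a Num.int.
    by apply: not_int_diff => //; apply: contraNneq mn => /met_inj ->.
  have := dchart_independent qq qa a0 (lift3_sphere (met m)) (qh (met m))
    (tangent_dot3 lift3_sphere dh1 dh2 dh3 (met m)) _ (dlift3_independent et ni).
  rewrite {1}e => /(_ (tangent_dot3 lift3_sphere dh1 dh2 dh3 (met n))).
  apply: contraNneq => j0; apply/eqP; have kk : (1 - dot3 (lift3 (met m)) q) ^+ 2 != 0 by rewrite expf_neq0.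
  apply: (mulIf (invr_neq0 kk)); apply: (mulIf (invr_neq0 kk)); rewrite !mul0r.
  by rewrite -[RHS]j0 /jac /dx /dy -e; ring.
have coinc s t : 0 <= s -> s < t -> t <= 1 -> gx s = gx t -> gy s = gy t ->
    (s = 0 /\ t = 1) \/ exists m n, [/\ inner N m, inner N n, mates m n, s = met m & t = met n].
  move=> s0 st t1 ex ey; apply: lift3_coincide => //.
  by apply: (chart_inj qq qa a0) => //; exact: lift3_sphere.
have cx : continuous gx by exact: cont. 
have cy : continuous gy by exact: cont.
have dgx m : inner N m -> is_derive (met m) (1 : R) gx (dx m) by move=> _; exact: d_chart.
have dgy m : inner N m -> is_derive (met m) (1 : R) gy (dy m) by move=> _; exact: d_chart.
have gx01 : gx 0 = gx 1 by rewrite /gx e01.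
have gy01 : gy 0 = gy 1 by rewrite /gy e01.
exists (gauss_diagonal S (strand_sign mates dx dy)).
apply: (gauss_invariant_crossings (x0 := x0)) => //.
- by move=> m n im jn; apply: (strand_signC mates_sym mate_eq).
- by move=> m n mn; rewrite /strand_sign mn; case: ifP => _; [right|left].
- by move=> m n /negbTE mn; rewrite /strand_sign mn.
- exact: (crossing_self met0 metN met_lt cx cy dgx dgy gx01 gy01 mates_sym mates_uniq has_mates mate_eq coinc).
- exact: (crossing_disjoint met0 metN met_lt cx cy dgx dgy gx01 gy01 mates_sym mates_uniq has_mates mate_eq coinc).
- exact: (crossing_nested met0 metN met_lt cx cy dgx dgy gx01 gy01 mates_sym mates_uniq has_mates mate_eq coinc).
exact: (crossing_interlaced met0 metN met_lt cx cy dgx dgy gx01 gy01 mates_sym mates_uniq has_mates mate_eq coinc).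
Qed.

End Necessity.

Theorem realizable_gauss (R : realType) (T : choiceType) (S : seq T) :
  double_occurrence_word S -> realizable R S ->
  exists d, gauss_invariant (undup S) (interlace S) pred0 d.
Proof.
case: S => [|x0 S'] dS; first by exists xpred0; split.
set S := x0 :: S' in dS *; move=> [f [gf [t0 [ o [ts [pt [h1 h2 h3 h4 h5]]]]]]].
exact: (realizes_gauss x0 dS gf h1 h2 h3 h4 h5).
Qed.

(** * Idempotent matrices, orthoprojection graphs and the parity conditions *)

Section Projection.
Variable V : finType.
Implicit Types (e : rel V).

Lemma F2_nat n : n%:R = (odd n)%:R :> 'F_2.
Proof.
rewrite -[in LHS](odd_double_half n) natrD -muln2 natrM.
by rewrite (_ : 2%:R = 0 :> 'F_2) ?mulr0 ?addr0 //; exact: val_inj.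
Qed.

Lemma F2_neq0 (z : 'F_2) : z = (z != 0)%:R.
Proof. by case: z => -[|[|//]] k; exact/val_inj. Qed.

Lemma F2_bool_inj : injective (fun b : bool => b%:R : 'F_2).
Proof. by case=> -[]. Qed.

Lemma odd_card (P : pred V) : odd #|[set w | P w]%SET| = \big[addb/false]_w P w.
Proof.
rewrite cardsE -sum1_card big_mkcond /=.
by rewrite (big_morph odd oddD (erefl : odd 0 = false)); apply: eq_bigr => w _; rewrite unfold_in; case: (P w).
Qed.

Lemma adjacency_idempotent e : symmetric e ->
  adjacency_mx 'F_2 e *m adjacency_mx 'F_2 e = adjacency_mx 'F_2 e <->
  forall u v, odd #|[set w | e u w && e v w]%SET| = e u v.
Proof.
move=> se; have E i j : (adjacency_mx 'F_2 e *m adjacency_mx 'F_2 e) i j =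
    (odd #|[set w | e (enum_val i) w && e (enum_val j) w]%SET|)%:R.
  rewrite mxE cardsE -F2_nat -sum1_card natr_sum (reindex _ (onW_bij _ (@enum_val_bij V))) /=.
  rewrite [RHS]big_mkcond /=; apply: eq_bigr => k _; rewrite !mxE unfold_in (se (enum_val k)).
  by rewrite -natrM mulnb; case: (_ && _).
split=> [H u v|H].
  have := congr1 (fun M : 'M['F_2]_#|V| => M (enum_rank u) (enum_rank v)) H.
  by rewrite E mxE !enum_rankK => /F2_bool_inj.
by apply/matrixP => i j; rewrite E H mxE.
Qed.

End Projection.

Section Words.
Variables (T : choiceType) (S : seq T).
Hypothesis dS : double_occurrence_word S.
Local Notation graph := (@interlacement_graph T S).
Implicit Types (u v w : seq_sub S) (A : {set seq_sub S}) (d : T -> bool).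

Lemma graphE u v : graph u v = interlace S (val u) (val v).
Proof. by rewrite /interlacement_graph interlacedE //; exact: valP. Qed.

Lemma graph_sym : symmetric graph.
Proof. by move=> u v; rewrite !graphE; apply: interlace_sym; apply: dS; exact: valP. Qed.

Lemma graph_irr u : graph u u = false.
Proof. by rewrite graphE interlacexx. Qed.

Lemma add_loops_sym A : symmetric (add_loops graph A).
Proof.
move=> u v; rewrite /add_loops graph_sym [u == v]eq_sym.
by have [->|] := eqVneq v u.
Qed.

Lemma xor_symbols (F : T -> bool) :
  \big[addb/false]_(w <- undup S) F w = \big[addb/false]_(w : seq_sub S) F (val w).
Proof.
rewrite -big_enum -(big_map val xpredT F); apply: perm_big.
apply: uniq_perm; rewrite ?undup_uniq ?(map_inj_uniq val_inj) ?enum_uniq // => x.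
rewrite mem_undup; apply/idP/mapP => [xS|[u _ ->]]; last exact: valP.
by exists (SeqSub xS); rewrite ?mem_enum.
Qed.

Lemma xor_pred1 u (b : bool) : \big[addb/false]_w ((u == w) && b) = b.
Proof.
by rewrite (bigD1 u) //= eqxx big1 ?addbF // => w /negbTE; rewrite eq_sym => ->.
Qed.

(** A loop at [u] adds [u] to its own neighbours, so the diagonal condition is even degree whatever
    [A] is. For adjacent [u] and [v] a loop at either adds one common neighbour, which is the term
    in [d]. *)
Lemma gauss_projection d A : (forall u, (u \in A) = d (val u)) ->
  gauss_invariant (undup S) (interlace S) pred0 d <->
  forall u v, odd #|[set w | add_loops graph A u w && add_loops graph A v w]%SET| =
    add_loops graph A u v.
Proof.
move=> Ad.
have diag u : odd #|[set w | add_loops graph A u w && add_loops graph A u w]%SET| =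
    \big[addb/false]_(w <- undup S) interlace S (val u) w (+) (u \in A).
  rewrite odd_card xor_symbols -[X in _ (+) X](xor_pred1 u) -big_split /=.
  apply: eq_bigr => w _; rewrite andbb /add_loops -graphE.
  by have [<-|_] := eqVneq u w; rewrite ?graph_irr ?andbF ?orbF ?addbF.
have off u v : u != v ->
    odd #|[set w | add_loops graph A u w && add_loops graph A v w]%SET| =
    \big[addb/false]_(w <- undup S) (interlace S (val u) w && interlace S w (val v)) (+)
    (graph u v && ((u \in A) (+) (v \in A))).
  move=> nuv; rewrite odd_card xor_symbols andb_addr addbA.
  rewrite -[X in _ (+) X (+) _](xor_pred1 u) -[X in _ (+) X](xor_pred1 v) -!big_split /=.
  apply: eq_bigr => w _; rewrite /add_loops -!graphE (graph_sym w).
  have [<-|nuw] := eqVneq u w.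
    by rewrite graph_irr eq_sym (negbTE nuv) graph_sym /= orbF addbF andbC.
  have [<-|_] := eqVneq v w; last by rewrite /= !orbF !addbF.
  by rewrite graph_irr /= orbF andbF.
split=> [[h1 h2] u v|H].
  have uS := valP u; have vS := valP v; rewrite /= in uS vS.
  have [->|nuv] := eqVneq u v.
    rewrite diag (_ : \big[_/_]_(_ <- _) _ = false); last by apply: h2; rewrite ?mem_undup.
    by rewrite /add_loops graph_irr eqxx.
  have := h1 (val u) (val v); rewrite !mem_undup => /(_ uS vS); rewrite (inj_eq val_inj) => /(_ nuv).
  rewrite off // => ->; rewrite -graphE -!Ad /add_loops (negbTE nuv) /= orbF.
  by case: graph => //=; case: (u \in A); case: (v \in A).
split=> [x y|x]; rewrite !mem_undup => xS.
  move=> yS nxy; have := H (SeqSub xS) (SeqSub yS).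
  have nuv : SeqSub xS != SeqSub yS by rewrite -(inj_eq val_inj).
  rewrite off // /add_loops (negbTE nuv) /= orbF graphE !Ad /=.
  case: (interlace S x y) => /=; last by rewrite addbF.
  by case: (\big[_/_]_(_ <- _) _); case: (d x); case: (d y).
move=> _; have := H (SeqSub xS) (SeqSub xS); rewrite diag /add_loops graph_irr eqxx /=.
by case: (\big[_/_]_(_ <- _) _); case: (_ \in A).
Qed.

End Words.

Theorem theorem2 (R : realType) (T : choiceType) (S : seq T)
    (hS : double_occurrence_word S) :
  [<-> realizable R S;
       exists A : {set seq_sub S},
         orthoprojection_graph (add_loops (@interlacement_graph T S) A);
       exists D : 'M['F_2]_#|{: seq_sub S}|,
         is_diag_mx D /\
         (interlacement_mx S + D) *m (interlacement_mx S + D)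
           = interlacement_mx S + D].
Proof.
pose loops (A : {set seq_sub S}) := add_loops (@interlacement_graph T S) A.
pose D (A : {set seq_sub S}) : 'M['F_2]_#|{: seq_sub S}| :=
  \matrix_(i, j) ((i == j) && (enum_val i \in A))%:R.
have DE A : interlacement_mx S + D A = adjacency_mx 'F_2 (loops A).
  apply/matrixP => i j; rewrite !mxE /loops /add_loops (inj_eq enum_val_inj).
  by have [<-|_] := eqVneq i j; rewrite ?graph_irr ?add0r //= orbF addr0.
tfae.
- move=> /(realizable_gauss hS) [d gd].
  exists [set u | d (val u)]%SET; split; first exact: add_loops_sym.
  have /(_ _)/iffLR := gauss_projection hS (A := [set u | d (val u)]%SET) (d := d).
  by move=> H u v; rewrite H // => w; rewrite inE.
- move=> [A [sA oA]]; exists (D A); split.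
    by apply/is_diag_mxP => i j /negbTE nij; rewrite mxE [i == j]nij.
  rewrite DE; apply/adjacency_idempotent => // u v.
  by apply/idP/idP => /oA.
move=> [D' [/is_diag_mxP dD' ]].
(* Over GF(2) a diagonal matrix is determined by the set of its nonzero diagonal entries, here the
   looped vertices. *)
pose A := [set u | D' (enum_rank u) (enum_rank u) != 0]%SET.
have -> : D' = D A.
  apply/matrixP => i j; rewrite !mxE; have [<-|nij] := eqVneq i j; last by rewrite dD'.
  by rewrite inE enum_valK /=; exact: F2_neq0.
rewrite DE => /adjacency_idempotent/(_ _)/= H.
pose d x := [exists u in A, val u == x].
have Ad u : (u \in A) = d (val u).
  apply/idP/existsP => [uA|[v /andP[vA /eqP/val_inj <-]] //].
  by exists u; rewrite uA eqxx.
apply: (@gauss_realizable R T S d hS); apply/(gauss_projection hS Ad).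
by apply: H; exact: add_loops_sym.
Qed.
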